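(* Let $n\in\{1,2,3\}$ and $d_j=j^{-2}$ for $j\in\mathbb{N}$. Let $K\in L^1(\mathbb{R}^n)$ be a radial function, $K(x)=J(|x|)$, satisfying the following assumption, and let $h:[0,1]\to\mathbb{R}$ be defined accordingly. - If $n=1$: $J\in C([0,+\infty))$ and $\lim_{r\to+\infty}e^rJ(r)$ exists; $h(\lambda):=J(-\log\lambda)/\lambda$ for $\lambda\in(0,1]$ and $h(0):=\lim_{r\to+\infty}e^rJ(r)$. - If $n=2$: $J\in C^1([0,+\infty))$ and there exists $\alpha>1/2$ such that $\lim_{r\to+\infty}r^\alpha e^rJ'(r)$ exists; with $A(r):=-\frac{2r}{\pi}\int_0^{+\infty}J'(r\cosh s)\,ds$, $h(\lambda):=A(-\log\lambda)/\lambda$ for $\lambda\in(0,1]$ and $h(0):=\lim_{r\to+\infty}e^rA(r)=0$. - If $n=3$: $J\in C((0,+\infty))$ and both $\lim_{r\to+0}rJ(r)$ and $\lim_{r\to+\infty}re^rJ(r)$ exist; $h(\lambda):=-(\log\lambda)J(-\log\lambda)/\lambda$ for $\lambda\in(0,1)$, $h(0):=\lim_{r\to+\infty}re^rJ(r)$ and $h(1):=\lim_{r\to+0}rJ(r)$. Let $N\in\mathbb{N}$ and $K_{N+1}=\sum_{j=1}^{N+1}\alpha_jk_j$. (i) When $\alpha_j=\beta_{j-1,N}[h]/c_{j-1,n}$ ($1\le j\le N+1$), for $m\in\{0,1\}$ there exists a constant $E(m)>0$ independent of $K$ such that if $h\in C^m([0,1])$, then $$\|K-K_{N+1}\|_{L^1}\le\frac{2E(m)\pi^{n/2}}{\Gamma(n/2)}N^{-m/2}\,\omega(h^{(m)},N^{-1/2}).$$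 (ii) When $\alpha_j=l_{j-1,N}[h]/c_{j-1,n}$ ($1\le j\le N+1$), for $h\in\mathrm{Lip}([0,1])$ it holds that $$\|K-K_{N+1}\|_{L^1}\le\frac{2\pi^{n/2}}{\Gamma(n/2)}\Big(2+\frac2\pi\log N\Big)\,\omega(h,N^{-1}).$$
   Context: For $d_j=j^{-2}$ the Green functions $k_j$ of $-d_j\Delta+1$ on $\mathbb{R}^n$ are: $k_j(x)=\frac j2e^{-j|x|}$ if $n=1$; $k_j(x)=\frac{j^2}{2\pi}M_0(j|x|)$ if $n=2$; $k_j(x)=\frac{j^2}{4\pi|x|}e^{-j|x|}$ if $n=3$, where $M_0(r)=\int_0^{+\infty}e^{-r\cosh s}\,ds$. When $n=2$, $A(0)$ is understood as $\lim_{r\to+0}A(r)=0$. Constants: $c_{j,1}=\frac{j+1}{2}$, $c_{j,2}=\frac{(j+1)^2}{2\pi}$, $c_{j,3}=\frac{(j+1)^2}{4\pi}$. The constant $E(m)$ in (i) is independent of $N$ as well. Modulus of continuity: $\omega(h,\eta)=\sup\{|h(\lambda_1)-h(\lambda_2)|:\lambda_1,\lambda_2\in[0,1],\ |\lambda_1-\lambda_2|\le\eta\}$. Bernstein coefficients: $\beta_{j,N}[h]=\sum_{\nu=0}^j(-1)^{j-\nu}h\big(\frac\nu N\big)\binom Nj\binom j\nu$ for $0\le j\le N$. Lagrange–Chebyshev coefficients: with $[\cdot]$ the integer part (Gauss symbol), for $N\in\mathbb{N}$ set $C_{k,N}=(-1)^k2^{N-2k-1}\frac{N}{N-k}\binom{N-k}{k}$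 $(0\le k\le[N/2])$; $\mu^{(N)}_{k,j}=(-1)^j2^{N-2k-j}\binom{N-2k}{j}C_{k,N}$; $\xi_{k,N}=\sum_{\nu=0}^{[N/2]-[(k+1)/2]}\mu^{(N)}_{\nu,N-2\nu-k}$ if $N$ is even and $\xi_{k,N}=\sum_{\nu=0}^{[N/2]-[k/2]}\mu^{(N)}_{\nu,N-2\nu-k}$ if $N$ is odd; $r_{j,N}=\frac12+\frac12\cos\frac{(2j+1)\pi}{2N}$ $(0\le j\le N-1)$; $\zeta_{j,N}[h]=h(r_{j,N+1})\big/\prod_{k=0,k\ne j}^N(r_{j,N+1}-r_{k,N+1})$ $(0\le j\le N)$; $\tau^{(N)}_{j,\nu}=\sum_{k=j}^{N-1}(r_{\nu,N})^{k-j}\xi_{k+1,N}$ $(0\le j,\nu\le N-1)$; $l_{j,N}[h]=\frac{1}{2^{2N+1}}\sum_{\nu=0}^N\zeta_{\nu,N}[h]\,\tau^{(N+1)}_{j,\nu}$ $(0\le j\le N)$. (Thus $\sum_{j=0}^N\beta_{j,N}[h]\lambda^j$ is the degree-$N$ Bernstein polynomial of $h$, and $\sum_{j=0}^Nl_{j,N}[h]\lambda^j$ is the Lagrange interpolation polynomial of $h$ at the $N+1$ Chebyshev nodes $r_{0,N+1},\ldots,r_{N,N+1}$ of $[0,1]$.) *)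

(* Defs.v *)
From HB Require Import structures.
From mathcomp Require Import all_boot all_order all_algebra.
From mathcomp Require Import all_classical all_reals all_analysis.
Import Order.TTheory GRing.Theory Num.Theory.
Import numFieldNormedType.Exports.
Set Implicit Arguments.
Unset Strict Implicit.
Unset Printing Implicit Defensive.
Local Open Scope classical_set_scope.
Local Open Scope ring_scope.

Lemma product_sigma_finite (R : realType) (d1 d2 : measure_display)
    (T1 : measurableType d1) (T2 : measurableType d2)
    (m1 : {sigma_finite_measure set T1 -> \bar R})
    (m2 : {sigma_finite_measure set T2 -> \bar R}) :
  sigma_finite setT (m1 \x m2)%E.
Proof.
have /sigma_finiteP[F [TF ndF Foo]] := sigma_finiteT m1.
have /sigma_finiteP[G [TG ndG Goo]] := sigma_finiteT m2.
exists (fun n => F n `*` G n).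
  rewrite -setXTT TF TG predeqE => -[x y]; split.
    move=> [/= [n _ Fnx] [k _ Gky]]; exists (maxn n k) => //; split.
    - by move: x Fnx; exact/subsetPset/ndF/leq_maxl.
    - by move: y Gky; exact/subsetPset/ndG/leq_maxr.
  by move=> [n _ []/= ? ?]; split; exists n.
move=> k; have [? ?] := Foo k; have [? ?] := Goo k.
split; first exact: measurableX.
by rewrite product_measure1E// lte_mul_pinfty// ge0_fin_numE.
Qed.

(* R^n is the type of n-tuples, with the product sigma-algebra of the library.
   Its Lebesgue measure is the n-fold product of the one-dimensional one. *)
Section tuple_product.
Context (R : realType).

Definition cons_pair n (p : measurableTypeR R * n.-tuple (measurableTypeR R)) :
  n.+1.-tuple (measurableTypeR R) := [tuple of p.1 :: p.2].

Lemma measurable_cons_pair n : measurable_fun setT (@cons_pair n).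
Proof. exact: measurable_cons. Qed.

Context n
  (m : {sigma_finite_measure set (n.-tuple (measurableTypeR R)) -> \bar R}).

Definition lebesgue_cons : set (n.+1.-tuple (measurableTypeR R)) -> \bar R :=
  pushforward (lebesgue_measure \x m)%E (@cons_pair n).

Let lebesgue_cons0 : (lebesgue_cons set0 = 0)%E.
Proof. by rewrite /lebesgue_cons /pushforward preimage_set0 measure0. Qed.

Let lebesgue_cons_ge0 A : (0 <= lebesgue_cons A)%E.
Proof. exact: (measure_ge0 (lebesgue_measure \x m)%E). Qed.

Let lebesgue_cons_sigma_additive : semi_sigma_additive lebesgue_cons.
Proof.
move=> F mF tF mUF; rewrite /lebesgue_cons /pushforward preimage_bigcup.
apply: (@measure_semi_sigma_additive _ _ _ (lebesgue_measure \x m)%E).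
- by move=> k; rewrite -[X in measurable X]setTI; exact: measurable_cons_pair.
- apply/trivIsetP => /= i j _ _ ij; rewrite -preimage_setI.
  by move/trivIsetP : tF => /(_ _ _ _ _ ij) ->//; rewrite preimage_set0.
- rewrite -preimage_bigcup -[X in measurable X]setTI.
  exact: measurable_cons_pair.
Qed.

HB.instance Definition _ := isMeasure.Build _ _ _ lebesgue_cons
  lebesgue_cons0 lebesgue_cons_ge0 lebesgue_cons_sigma_additive.

Let lebesgue_cons_sigma_finite : sigma_finite setT lebesgue_cons.
Proof.
have [F TF Foo] : sigma_finite setT (@lebesgue_measure R \x m)%E.
  exact: (@product_sigma_finite R _ _ _ _ (@lebesgue_measure R) m).
pose u (t : n.+1.-tuple (measurableTypeR R)) :
  measurableTypeR R * n.-tuple (measurableTypeR R) :=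
  (thead t, [tuple of behead t]).
have mu : measurable_fun setT u.
  by apply/measurable_fun_pairP; split;
    [exact: measurable_tnth | exact: measurable_behead].
have uK : cancel (@cons_pair n) u.
  by move=> [x t]; rewrite /u theadE; congr pair; exact: val_inj.
exists (fun k => u @^-1` F k); first by rewrite -preimage_bigcup -TF.
move=> k; split.
  by rewrite -[X in measurable X]setTI; apply: mu => //; exact: (Foo k).1.
rewrite /lebesgue_cons /pushforward -comp_preimage.
rewrite (_ : u \o @cons_pair n = id); first exact: (Foo k).2.
by apply/funext => p /=; rewrite uK.
Qed.

HB.instance Definition _ := Measure_isSigmaFinite.Build _ _ _ lebesgue_cons
  lebesgue_cons_sigma_finite.

End tuple_product.

Fixpoint lebesgue (R : realType) n :
    {sigma_finite_measure set (n.-tuple (measurableTypeR R)) -> \bar R} :=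
  match n with
  | 0 => \d_ [tuple]
  | n'.+1 => lebesgue_cons (lebesgue R n')
  end.

(* The norm on tuples is the Euclidean one, unlike the library's sup norm on
   row vectors. *)
Definition enorm (R : realType) n (x : n.-tuple (measurableTypeR R)) : R :=
  Num.sqrt (\sum_(i < n) (tnth x i : R) ^+ 2).

Section calculus.
Context (R : realType).
Local Notation mu := (@lebesgue_measure R).
Implicit Types (A : set R) (f h : R -> R).

(* Difference quotients are taken inside A, so that the derivative is one-sided
   at a boundary point belonging to A. *)
Definition quotient_in A f x : set_system R :=
  ((f y - f x) / (y - x)) @[y --> within A x^'].

Definition derive_in A f (x : R) : R := lim (quotient_in A f x).

Fixpoint C_in m A f : Prop :=
  match m with
  | 0 => {within A, continuous f}
  | m'.+1 => (forall x, A x -> cvg (quotient_in A f x)) /\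
             C_in m' A (derive_in A f)
  end.

Definition modulus h (eta : R) : R :=
  sup [set z | exists l1 l2 : R, [/\ l1 \in `[0, 1], l2 \in `[0, 1],
    `|l1 - l2| <= eta & z = `|h l1 - h l2|]].

Definition cosh (s : R) : R := (expR s + expR (- s)) / 2.

Definition Gamma (x : R) : R :=
  \int[mu]_(t in `[0, +oo[) (t `^ (x - 1) * expR (- t)).

End calculus.

Section kernels.
Context (R : realType).
Local Notation mu := (@lebesgue_measure R).
Implicit Types (n j : nat) (J : R -> R) (r l : R).

Definition M0 r : R := \int[mu]_(s in `[0, +oo[) expR (- r * cosh s).

(* Green function of - j^-2 Delta + 1 on R^n, as a function of the radius r;
   for n = 2, 3 it is singular at r = 0, where its value is immaterial. *)
Definition green n j r : R :=
  match n with
  | 1 => j%:R / 2 * expR (- j%:R * r)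
  | 2 => j%:R ^+ 2 / (2 * pi) * M0 (j%:R * r)
  | 3 => j%:R ^+ 2 / (4 * pi * r) * expR (- j%:R * r)
  | _ => 0
  end.

Definition kcoef n j : R :=
  match n with
  | 1 => j.+1%:R / 2
  | 2 => j.+1%:R ^+ 2 / (2 * pi)
  | 3 => j.+1%:R ^+ 2 / (4 * pi)
  | _ => 1
  end.

Definition kernel_sum n N (alpha : nat -> R)
    (x : n.-tuple (measurableTypeR R)) : R :=
  \sum_(1 <= j < N.+2) alpha j * green n j (enorm x).

Definition kernel_assumption n J : Prop :=
  match n with
  | 1 => C_in 0 `[0, +oo[ J /\ cvg (expR r * J r @[r --> +oo])
  | 2 => C_in 1 `[0, +oo[ J /\
         exists2 alpha : R, 1 / 2 < alpha &
           cvg (r `^ alpha * expR r * derive_in `[0, +oo[ J r @[r --> +oo])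
  | 3 => [/\ C_in 0 `]0, +oo[ J, cvg (r * J r @[r --> 0^'+]) &
             cvg (r * expR r * J r @[r --> +oo])]
  | _ => False
  end.

Definition abelA_formula J r : R :=
  - (2 * r / pi) *
    \int[mu]_(s in `[0, +oo[) derive_in `[0, +oo[ J (r * cosh s).

Definition abelA J r : R :=
  if r == 0 then lim (abelA_formula J t @[t --> 0^'+])
  else abelA_formula J r.

(* The function h on [0, 1] attached to J; values outside [0, 1] are
   irrelevant. *)
Definition profile n J l : R :=
  match n with
  | 1 => if l == 0 then lim (expR r * J r @[r --> +oo])
         else J (- ln l) / l
  | 2 => if l == 0 then lim (expR r * abelA J r @[r --> +oo])
         else abelA J (- ln l) / l
  | 3 => if l == 0 then lim (r * expR r * J r @[r --> +oo])
         else if l == 1 then lim (r * J r @[r --> 0^'+])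
         else - ln l * J (- ln l) / l
  | _ => 0
  end.

End kernels.
Arguments kcoef {R} n j.
Arguments kernel_sum {R} n N alpha x.

Section coefficients.
Context (R : realType).
Implicit Types (h : R -> R) (N j k nu : nat).

Definition bernstein_coef N h j : R :=
  \sum_(0 <= nu < j.+1)
    (-1) ^+ (j - nu) * h (nu%:R / N%:R) * 'C(N, j)%:R * 'C(j, nu)%:R.

Definition cheb_C N k : R :=
  (-1) ^+ k * 2 ^ (N%:Z - (2 * k)%:Z - 1) *
  (N%:R / (N - k)%:R) * 'C(N - k, k)%:R.

Definition cheb_mu N k j : R :=
  (-1) ^+ j * 2 ^+ (N - 2 * k - j) * 'C(N - 2 * k, j)%:R * cheb_C N k.

(* uphalf k = [(k + 1) / 2] and k./2 = [k / 2]. *)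
Definition cheb_xi N k : R :=
  if odd N then \sum_(0 <= nu < (N./2 - k./2).+1) cheb_mu N nu (N - 2 * nu - k)
  else \sum_(0 <= nu < (N./2 - uphalf k).+1) cheb_mu N nu (N - 2 * nu - k).

Definition cheb_node N j : R :=
  1 / 2 + 1 / 2 * cos ((2 * j + 1)%:R * pi / (2 * N)%:R).

Definition cheb_zeta N h j : R :=
  h (cheb_node N.+1 j) /
  \prod_(0 <= k < N.+1 | k != j) (cheb_node N.+1 j - cheb_node N.+1 k).

Definition cheb_tau N j nu : R :=
  \sum_(j <= k < N) cheb_node N nu ^+ (k - j) * cheb_xi N k.+1.

Definition lagrange_coef N h j : R :=
  1 / 2 ^+ (2 * N + 1) *
  \sum_(0 <= nu < N.+1) cheb_zeta N h nu * cheb_tau N.+1 j nu.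

End coefficients.

(* Main.v *)
Require Import Defs.
From mathcomp Require Import all_boot all_order all_algebra.
From mathcomp Require Import all_classical all_reals all_analysis.
From mathcomp Require Import measurable_realfun zify ring lra.
Import Order.TTheory GRing.Theory Num.Theory.
Import numFieldNormedType.Exports.
Set Implicit Arguments.
Unset Strict Implicit.
Unset Printing Implicit Defensive.
Local Open Scope classical_set_scope.
Local Open Scope ring_scope.

(* In the variable l = exp (- r), K(x) divided by the Green function phi of
   - Delta + 1 becomes h(l), while the normalized kernel k_j becomes l^(j-1): this
   is immediate for n = 1 and n = 3. For n = 2 it holds under the integral
   M0(r) = \int_0^oo exp (- r cosh s) ds, because J is recovered from A by
   J(r) = \int_0^oo A(r cosh u) du (Abel inversion; the constant of integration
   vanishes since K is integrable). A uniform error S of a polynomial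
   approximation of h on [0, 1] thus gives the pointwise error S phi(|x|), and
   phi has integral 2 pi^(n/2) / Gamma(n/2).

   (i) The Bernstein polynomials satisfy |h - B_N h| <= 2 w(h, N^(-1/2)) by the
   variance of the binomial law, and |h - B_N h| <= 2 N^(-1/2) w(h', N^(-1/2)) by
   the mean value theorem, so that E(m) = 2 works.

   (ii) With n = N + 1 nodes and h(1/2 + 1/2 cos t) = G(t), the interpolation error
   at t is cos(n t) / (2 n) times an alternating sum, over the 2 n nodes t_k nearest
   to t, of cot((t_k - t) / 2) (G(t) - G(t_k)). The cotangents decrease away from
   t, and neighbouring values of G differ by at most 2 w(h, 1/N), so summation by
   parts bounds the error by w(h, 1/N) times the plain sum of the weights, plus
   one extra weight when the nearest node on one side is too far from t. As
   cot x <= 1/x and sin(pi s) <= 4 s (1 - s), the weights add up to at most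
   4/pi \sum_(i < n) 1 / (2 i + 1) <= 4/pi + 2/pi ln n. *)

(** * Radial integration *)

(** No surface measure on spheres is used: the image of Lebesgue measure under the norm is
    determined by the volumes of balls, which scaling gives up to a constant, and the constant comes
    from a Gaussian integrated in two ways. For n = 2 the same radial formula serves as polar
    coordinates in the Abel inversion. Changes of variables and of the order of integration are
    carried out for nonnegative measurable functions with values in the extended reals. As J' has no
    sign, an explicit multiple of exp (- t) dominating |J'| is added to it and subtracted again. In
    (ii) a term-by-term estimate fails: G(t) - G(t_k) may be many times w(h, 1/N), and only
    differences between neighbours are controlled. Their angular step pi / (N + 1) exceeds 2 / N for
    N >= 2, which costs 2 w(h, 1/N); but the alternating tails that multiply these differences add
    up to at most half of the weights, which restores the factor 1. *)

Section density.
Context (R : realType).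
Local Notation mu := (@lebesgue_measure R).
Local Open Scope ereal_scope.

Lemma ge0_integral_mrestr d (T : measurableType d)
    (m : {measure set T -> \bar R}) (D : set T) (mD : measurable D)
    (f : T -> \bar R) :
  measurable_fun setT f -> (forall x, 0 <= f x) ->
  \int[mrestr m mD]_x f x = \int[m]_(x in D) f x.
Proof.
move=> mf f0; rewrite -(setUv D) ge0_integral_setU//=.
- rewrite [X in _ + X](_ : _ = 0) ?adde0; last first.
    rewrite -(@integral_measure_zero _ _ _ (~` D) f).
    apply: eq_measure_integral => A mA AD; rewrite /= /mrestr.
    by have /disjoints_subset -> := AD; rewrite measure0.
  by apply: eq_measure_integral => A mA AD; rewrite /= /mrestr setIidl.
- exact: measurableC.
- by rewrite setUv.
- by apply/disj_setPCl.
Qed.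

(** The measure of density w is realized as plane Lebesgue measure restricted to the region between
    0 and w, so that sigma-additivity is free and Tonelli computes its integrals. Its image under
    phi agrees with nu on the rays ]-oo, b[, a pi-system generating the Borel sets, hence
    everywhere. *)
Lemma ge0_integral_density (w phi : R -> R)
    (nu : {measure set measurableTypeR R -> \bar R}) (g : R -> \bar R) :
  measurable_fun setT w -> (forall x, 0 <= w x)%R ->
  measurable_fun setT phi ->
  (forall b, nu `]-oo, b[%classic < +oo) ->
  (forall b, \int[mu]_(x in phi @^-1` `]-oo, b[%classic) (w x)%:E = nu `]-oo, b[%classic) ->
  measurable_fun setT g -> (forall x, 0 <= g x) ->
  \int[nu]_x g x = \int[mu]_x (g (phi x) * (w x)%:E).
Proof.
move=> mw w0 mphi nuoo nuE mg g0.
pose S := [set z : measurableTypeR R * measurableTypeR R | (0 <= z.2 < w z.1)%R].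
have mS : measurable S.
  have -> : S = snd @^-1` `[0%R, +oo[%classic `&` (fun z => w z.1 -
    z.2)%R @^-1` `]0%R, +oo[%classic.
    by apply/seteqP; split => z /=; rewrite /S/= !in_itv/= !andbT subr_gt0 => /andP.
  apply: measurableI; rewrite -[X in measurable X]setTI.
    exact: measurable_snd.
  have : measurable_fun setT (fun z : measurableTypeR R * measurableTypeR R => (w z.1 - z.2)%R).
    by apply: measurable_funB => //; exact: measurableT_comp.
  exact.
pose P := fun z : measurableTypeR R * measurableTypeR R => phi z.1 : measurableTypeR R.
have mP : measurable_fun setT P by exact: measurableT_comp.
have key (f : R -> \bar R) : measurable_fun setT f -> (forall x, 0 <= f x) ->
    \int[pushforward (mrestr (mu \x mu) mS) P]_x f x =
    \int[mu]_x (f (phi x) * (w x)%:E).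
  move=> mf f0.
  rewrite ge0_integral_pushforward// preimage_setT ge0_integral_mrestr; first last.
  - by move=> z; exact: f0.
  - exact: (measurableT_comp mf mP).
  rewrite integral_mkcond fubini_tonelli1//; last 2 first.
  - apply/(measurable_restrictT _ _).1 => //; apply: measurable_funTS.
    exact: measurableT_comp.
  - by move=> z; apply: erestrict_ge0 => y _; exact: f0.
  apply: eq_integral => x _; rewrite /fubini_F /=.
  rewrite (_ : (fun y => _) = (fun y => f (phi x) * (\1_`[0, w x[ y)%:E)).
    rewrite ge0_integralZl//; last by apply/measurable_EFinP.
    rewrite integral_indic// setIT /= lebesgue_measure_itv /= lte_fin.
    by case: ltgtP (w0 x) => // [?|<-] _; rewrite ?sube0.
  apply/funext => y; rewrite /patch indicE.
  have -> : ((x, y) \in S) = (y \in `[0%R, w x[%classic).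
    by apply/idP/idP; rewrite !inE /S /= in_itv.
  by case: ifP; rewrite ?mule1 ?mule0.
rewrite -key//; apply: eq_measure_integral => A mA _.
have Gphi b : pushforward (mrestr (mu \x mu) mS) P `]-oo, b[%classic = nu `]-oo, b[%classic.
  have mB : measurable (`]-oo, b[%classic : set (measurableTypeR R)) by [].
  set m1 := pushforward _ _; rewrite -nuE integral_mkcond.
  transitivity (\int[m1]_x (\1_(`]-oo, b[%classic : set R) x)%:E).
    by rewrite integral_indic// setIT.
  rewrite key.
  - apply: eq_integral => x _; rewrite /patch indicE.
    have -> : (x \in phi @^-1` `]-oo, b[%classic) = (phi x \in `]-oo, b[%classic) by [].
    by case: ifP => _; rewrite ?mul1e ?mul0e.
  - exact/measurable_EFinP.
  - by move=> x; rewrite lee_fin.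
apply/esym; set m1 := (X in X A = _).
refine (@measure_unique _ R (measurableTypeR R) (@RGenInftyO.G R)
  (fun k => `]-oo, k%:R[%classic) _ _ _ _ _ nu _ _ A mA) => //.
- exact: RGenInftyO.measurableE.
- move=> _ _ [a ->] [b ->]; exists (Order.min a b).
  by apply/seteqP; split => x /=; rewrite !in_itv/= lt_min => /andP.
- by move=> k; exists k%:R.
- apply/seteqP; split => x // _; exists (Num.truncn `|x|).+1 => //=.
  by rewrite in_itv/= (le_lt_trans (ler_norm x))// truncnS_gt.
- by move=> _ [b ->]; exact: Gphi.
- by move=> k; have := nuoo k%:R; rewrite -Gphi.
Qed.

End density.

(** * Substitution on the half-line and dilation of the line *)

Section substitution.
Context (R : realType).
Local Notation mu := (@lebesgue_measure R).
Local Open Scope ereal_scope.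

(** This is [ge0_integral_density] with nu the Lebesgue measure of the half-line: a ray ]-oo, b[
    with b > 0 pulls back to [0, c[ where F c = b, and f integrates over it to F c - F 0 = b. In
    this way g may be any nonnegative measurable function. *)
Lemma ge0_integration_by_substitution_0y (F f : R -> R) (g : R -> \bar R) :
  continuous f -> (forall x : R, 0 <= x -> 0 <= f x)%R ->
  (forall x : R, is_derive x 1%R F (f x)) -> F 0%R = 0%R ->
  {in `[0%R, +oo[ &, {mono F : x y / (x < y)%R}} ->
  (forall b : R, 0 < b -> exists2 c, 0 < c & F c = b)%R ->
  measurable_fun setT g -> (forall x, 0 <= g x) ->
  \int[mu]_(x in `[0%R, +oo[) g x =
  \int[mu]_(x in `[0%R, +oo[) (g (F x) * (f x)%:E).
Proof.
move=> cf f0 dF F0 Fmono Fsurj mg g0.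
have m0y : measurable (`[0%R, +oo[%classic : set (measurableTypeR R)) by [].
have mf : measurable_fun setT f by exact: continuous_measurable_fun.
have cF : continuous F.
  by move=> x; apply/differentiable_continuous/derivable1_diffP; have [] := dF x.
rewrite -(@ge0_integral_mrestr R _ _ mu _ m0y)//.
rewrite (@ge0_integral_density _ (f \_ `[0%R, +oo[) F)//; first last.
- move=> b; rewrite integral_mkcond.
  transitivity (\int[mu]_(x in (F @^-1` `]-oo, b[%classic) `&` `[0%R, +oo[%classic) (f x)%:E).
    rewrite [RHS]integral_mkcond; apply: eq_integral => x _.
    by rewrite /patch in_setI; do 2 case: (_ \in _).
  rewrite /= /mrestr.
  have [b0|b0] := leP b 0%R.
    rewrite (_ : _ `&` _ = set0); last first.
      rewrite -subset0 => x [/=]; rewrite !in_itv/= andbT => Fb x0.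
      have : (F 0 <= F x)%R.
        move: x0; rewrite le_eqVlt => /predU1P[<-//|x0].
        by rewrite ltW// Fmono ?in_itv//= ?lexx ?andbT// ltW.
      by rewrite F0 leNgt (lt_le_trans Fb b0).
    rewrite integral_set0 (_ : _ `&` _ = set0) ?measure0//.
    rewrite -subset0 => x [/=]; rewrite !in_itv/= andbT => xb x0.
    by have := lt_le_trans (le_lt_trans x0 xb) b0; rewrite ltxx.
  have [c c0 Fc] := Fsurj _ b0.
  rewrite (_ : _ `&` _ = `[0%R, c[%classic); last first.
    apply/seteqP; split => x /=; rewrite !in_itv/= andbT.
      by move=> [+ x0]; rewrite -Fc Fmono ?in_itv/= ?andbT ?(ltW c0)// => ->; rewrite x0.
    by move=> /andP[x0 xc]; rewrite -Fc Fmono ?in_itv/= ?andbT ?(ltW c0).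
  rewrite [in RHS](_ : _ `&` _ = `[0%R, b[%classic); last first.
    by apply/seteqP; split => x /=; rewrite !in_itv/= andbT;
      [move=> [-> ->]|move=> /andP[-> ->]].
  rewrite integral_itv_bndo_bndc; last exact/measurable_EFinP/measurable_funTS.
  rewrite lebesgue_measure_itv /= lte_fin b0 -EFinB subr0.
  rewrite (@continuous_FTC2 _ _ F)//.
  + by rewrite F0 Fc sube0.
  + exact: continuous_subspaceT.
  + split => [x _||]; last 2 first.
    * exact/cvg_at_right_filter/cF.
    * exact/cvg_at_left_filter/cF.
    by have [] := dF x.
  + by move=> x _; rewrite derive1E; have [] := dF x.
- move=> b; rewrite /= /mrestr; apply: (@le_lt_trans _ _ (mu `[0%R, b])).
    rewrite le_measure ?inE//; first exact: measurableI.
    by move=> x [/=]; rewrite !in_itv/= andbT => /ltW -> ->.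
  by rewrite lebesgue_measure_itv/=; case: ifP => _; rewrite ltry.
- exact: continuous_measurable_fun.
- by move=> x; rewrite /patch; case: ifPn => //; rewrite inE/= in_itv/= andbT => /f0.
- by apply/(measurable_restrictT _ _).1 => //; exact: measurable_funTS.
rewrite [RHS]integral_mkcond; apply: eq_integral => x _; rewrite /patch.
by case: ifP; rewrite ?mule0.
Qed.

(** By uniqueness on intervals, Lebesgue measure is c times its image under the dilation by c. *)
Lemma ge0_integral_scale (c : R) (g : R -> \bar R) : (0 < c)%R ->
  measurable_fun setT g -> (forall x, 0 <= g x) ->
  \int[mu]_x g (c * x)%R = (c^-1)%:E * \int[mu]_x g x.
Proof.
move=> c0 mg g0.
pose phi := (fun x => c * x)%R : measurableTypeR R -> measurableTypeR R.
have mphi : measurable_fun setT phi by exact: measurable_funM.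
have muE A : measurable A -> mu A = mscale (NngNum (ltW c0)) (pushforward mu phi) A.
  apply: (@lebesgue_measure_unique R (mscale (NngNum (ltW c0)) (pushforward mu phi))) =>
    _ [[a b] _ <-].
  have phiE : phi @^-1` `]a, b]%classic = `](a / c)%R, (b / c)%R]%classic.
    by apply/seteqP; split => x /=; rewrite !in_itv/= /phi ltr_pdivrMr// ler_pdivlMr// mulrC.
  transitivity (c%:E * mu `](a / c)%R, (b / c)%R]); last by rewrite -phiE.
  rewrite !lebesgue_measure_itv /= !lte_fin ltr_pM2r ?invr_gt0//.
  case: ifP => _; rewrite ?mule0// -!EFinB -EFinM -mulrBl mulrC divfK// gt_eqF//.
rewrite [X in _ = _ * X](@eq_measure_integral _ _ _ _ (mscale (NngNum (ltW c0))
  (pushforward mu phi)) mu) => [|A mA _]; last by first [exact: muE | exact/esym/muE].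
rewrite ge0_integral_mscale//= muleA -EFinM mulVf ?gt_eqF// mul1e.
by rewrite ge0_integral_pushforward.
Qed.

End substitution.

(** * Lebesgue measure on tuples: norm and dilations *)

Section tuple_lebesgue.
Context (R : realType).
Local Notation mu := (@lebesgue_measure R).
Local Notation T n := (n.-tuple (measurableTypeR R)).
Local Open Scope ereal_scope.

Lemma measurable_sqr_enorm n :
  measurable_fun setT (fun x : T n => \sum_(i < n) (tnth x i : R) ^+ 2)%R.
Proof.
apply: measurable_sum => i; apply: measurable_funX; exact: measurable_tnth.
Qed.

Lemma measurable_enorm n : measurable_fun setT (@enorm R n).
Proof.
have ms : measurable_fun setT (@Num.sqrt R : R -> R).
  by apply: continuous_measurable_fun; exact: sqrt_continuous.
exact: (measurableT_comp ms (@measurable_sqr_enorm n)).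
Qed.

Lemma enorm_ge0 n (x : T n) : (0 <= enorm x)%R.
Proof. exact: sqrtr_ge0. Qed.

Lemma ge0_integral_lebesgue_cons n (f : T n.+1 -> \bar R) :
  measurable_fun setT f -> (forall x, 0 <= f x) ->
  \int[lebesgue R n.+1]_x f x =
  \int[mu]_t \int[lebesgue R n]_x f [tuple of t :: x].
Proof.
move=> mf f0; rewrite /= ge0_integral_pushforward//; last first.
  exact: measurable_cons_pair.
rewrite preimage_setT fubini_tonelli1//.
  by apply: measurableT_comp => //; exact: measurable_cons_pair.
by move=> x; exact: f0.
Qed.

Definition scale_tuple (c : R) n (x : T n) : T n := [tuple (c * tnth x i)%R | i < n].

Lemma measurable_scale_tuple c n : measurable_fun setT (@scale_tuple c n).
Proof.
apply/measurable_fun_tnthP => i.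
rewrite (_ : _ \o _ = (fun x : T n => c * tnth x i)%R).
  by apply: measurable_funM => //; exact: measurable_tnth.
by apply/funext => x /=; rewrite tnth_mktuple.
Qed.

Lemma scale_cons c n (t : measurableTypeR R) (x : T n) :
  scale_tuple c [tuple of t :: x] = [tuple of (c * t)%R :: scale_tuple c x].
Proof.
apply: eq_from_tnth => i; rewrite tnth_mktuple.
case: (unliftP ord0 i) => [j ->|->]; last by rewrite !tnth0.
by rewrite !tnthS tnth_mktuple.
Qed.

Lemma ge0_integral_lebesgue_scale (c : R) n (f : T n -> \bar R) : (0 < c)%R ->
  measurable_fun setT f -> (forall x, 0 <= f x) ->
  \int[lebesgue R n]_x f (scale_tuple c x) =
  (c^-1 ^+ n)%:E * \int[lebesgue R n]_x f x.
Proof.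
move=> c0; elim: n f => [|n IH] f mf f0.
  rewrite mul1e; apply: eq_integral => x _; congr (f _).
  exact: etrans (tuple0 _) (esym (tuple0 _)).
rewrite !ge0_integral_lebesgue_cons//; last first.
  by apply: measurableT_comp => //; exact: measurable_scale_tuple.
have mcons t : measurable_fun setT (fun x : T n => [tuple of t :: x] : T n.+1).
  exact: measurable_cons.
under eq_integral => t _.
  under eq_integral => x _ do rewrite scale_cons.
  rewrite (IH (fun x => f [tuple of (c * t)%R :: x]))//;
    last exact: (measurableT_comp mf (mcons _)).
  over.
rewrite ge0_integralZl//; last 3 first.
- apply: (measurable_fun_fubini_tonelli_F (fun z : _ * T n =>
    f [tuple of (c * z.1)%R :: z.2])) => //.
  apply: (measurableT_comp mf); apply: measurable_cons; last exact: measurable_snd.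
  by apply: measurable_funM => //; exact: measurable_fst.
- by move=> t _; exact: integral_ge0.
- by rewrite lee_fin exprn_ge0// invr_ge0 ltW.
rewrite (@ge0_integral_scale R c (fun t => \int[lebesgue R n]_x f [tuple of t :: x]))//.
- by rewrite muleA -EFinM exprSr.
- apply: (measurable_fun_fubini_tonelli_F (fun z : _ * T n => f [tuple of z.1 :: z.2])) => //.
  by apply: (measurableT_comp mf); exact: measurable_cons_pair.
- by move=> t; exact: integral_ge0.
Qed.

End tuple_lebesgue.

(** * Integrals of radial functions *)

Section radial.
Context (R : realType).
Local Notation mu := (@lebesgue_measure R).
Local Notation T n := (n.-tuple (measurableTypeR R)).
Local Open Scope ereal_scope.

(** The Gaussian factorizes over the coordinates, so its integral is known in every dimension; it
    fixes the constant of radial integration below. *)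
Lemma integral_lebesgue_gauss n :
  \int[lebesgue R n]_x (expR (- enorm x ^+ 2))%:E = (Num.sqrt pi ^+ n)%:E.
Proof.
have E k (x : T k) : expR (- enorm x ^+ 2) = expR (- \sum_(i < k) (tnth x i : R) ^+ 2).
  by rewrite sqr_sqrtr// sumr_ge0// => i _; exact: sqr_ge0.
under eq_integral do rewrite E.
have mE k : measurable_fun setT (fun x : T k => (expR (- \sum_(i < k) (tnth x i : R) ^+ 2))%:E).
  apply/measurable_EFinP; have mS := measurable_funN (@measurable_sqr_enorm R k).
  exact: (measurableT_comp (@measurable_expR R) mS).
elim: n => [|n IH].
  rewrite expr0 (integral_dirac [tuple] measurableT (mE 0%N)) diracE in_setT mul1e.
  by rewrite big_ord0 oppr0 expR0.
rewrite ge0_integral_lebesgue_cons; first last.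
- by move=> x; rewrite lee_fin expR_ge0.
- exact: mE.
under eq_integral => t _.
  under eq_integral => x _.
    rewrite big_ord_recl tnth0 opprD expRD EFinM.
    under eq_bigr do rewrite tnthS.
    over.
  rewrite ge0_integralZl//; last exact: mE.
  rewrite IH. over.
rewrite /=.
transitivity (\int[mu]_t ((gauss_fun t)%:E * (Num.sqrt pi ^+ n)%:E)).
  by apply: eq_integral => t _; rewrite muleC.
rewrite ge0_integralZr//.
- by rewrite integralT_gauss exprS.
- by apply/measurable_EFinP; exact: measurable_gauss_fun.
- by move=> t _; rewrite lee_fin gauss_fun_ge0.
Qed.

Lemma measurable_ball_enorm n (b : R) :
  measurable ([set x | enorm x < b]%R : set (T n)).
Proof.
rewrite (_ : [set x | _] = @enorm R n @^-1` `]-oo, b[%classic); last first.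
  by apply/seteqP; split => x /=; rewrite in_itv.
rewrite -[X in measurable X]setTI; exact: measurable_enorm.
Qed.

(** Markov inequality: the Gaussian is at least exp (-1) on the unit ball. *)
Lemma lebesgue_ball_lty n : lebesgue R n [set x | enorm x < 1]%R < +oo.
Proof.
have mB := @measurable_ball_enorm n 1%R.
have : (expR (-1))%:E * lebesgue R n [set x | enorm x < 1]%R < +oo.
  rewrite -[X in lebesgue R n X]setIT -integral_indic// -ge0_integralZl//;
    last exact/measurable_EFinP.
  apply: (@le_lt_trans _ _ (Num.sqrt pi ^+ n)%:E); last exact: ltry.
  rewrite -integral_lebesgue_gauss; apply: ge0_le_integral => //.
  - by apply: emeasurable_funM => //; exact/measurable_EFinP.
  - apply/measurable_EFinP.
    have mS : measurable_fun setT (fun x : T n => - enorm x ^+ 2)%R.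
      by apply: measurable_funN; apply: measurable_funX; exact: measurable_enorm.
    exact: (measurableT_comp (@measurable_expR R) mS).
  - move=> x _; rewrite indicE; case: (boolP (x \in _)).
  + rewrite inE/= mule1 lee_fin ler_expR lerN2 => x1.
    by rewrite expr_le1// ?enorm_ge0// ltW.
  + by rewrite mule0 lee_fin expR_ge0.
by rewrite -lte_pdivlMl ?expR_gt0// gt0_muley// lte_fin invr_gt0 expR_gt0.
Qed.

Lemma enorm_scale c n (x : T n) : (0 <= c)%R ->
  enorm (scale_tuple c x) = (c * enorm x)%R.
Proof.
move=> c0; rewrite /enorm; under eq_bigr do rewrite tnth_mktuple exprMn.
by rewrite -mulr_sumr sqrtrM ?sqr_ge0// sqrtr_sqr ger0_norm.
Qed.

Lemma lebesgue_ballE n (b : R) : (0 < b)%R ->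
  lebesgue R n [set x | enorm x < b]%R =
  (b ^+ n)%:E * lebesgue R n [set x | enorm x < 1]%R.
Proof.
move=> b0.
have mB1 := @measurable_ball_enorm n 1%R; have mBb := @measurable_ball_enorm n b.
have b1 : (0 < b^-1)%R by rewrite invr_gt0.
have := @ge0_integral_lebesgue_scale R b^-1 n
  (fun x => (\1_([set x | enorm x < 1]%R : set (T n)) x)%:E) b1.
have -> : \int[lebesgue R n]_x (\1_([set x | enorm x < 1]%R : set (T n)) x)%:E =
    lebesgue R n [set x | enorm x < 1]%R by rewrite integral_indic// setIT.
rewrite invrK => <-.
- transitivity (\int[lebesgue R n]_x (\1_([set x | enorm x < b]%R : set (T n)) x)%:E).
    by rewrite integral_indic// setIT.
  apply: eq_integral => x _; rewrite !indicE.
  congr ((nat_of_bool _)%:R%:E); apply/idP/idP; rewrite !inE/= enorm_scale ?ltW//.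
    by rewrite ltr_pdivrMl// mulr1.
  by rewrite ltr_pdivrMl// mulr1.
- exact/measurable_EFinP.
- by move=> x; rewrite lee_fin.
Qed.

(** With v the volume of the unit ball, the image of Lebesgue measure under the norm gives ]-oo, b[
    the mass v b^n for b > 0. This is the integral of n v r^(n-1) over [0, b[, and
    [ge0_integral_density] applies with phi the identity. *)
Lemma ge0_integral_radial_ball n (g : R -> \bar R) : (0 < n)%N ->
  measurable_fun setT g -> (forall x, 0 <= g x) ->
  \int[lebesgue R n]_x g (enorm x) =
  (n%:R * fine (lebesgue R n [set x | enorm x < 1]%R))%:E *
  \int[mu]_(r in `[0%R, +oo[) (g r * (r ^+ n.-1)%:E).
Proof.
move=> n0 mg g0; pose nrm := @enorm R n : T n -> measurableTypeR R.
have mnorm : measurable_fun setT nrm := @measurable_enorm R n.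
pose v := fine (lebesgue R n [set x | enorm x < 1]%R).
have vE : lebesgue R n [set x | enorm x < 1]%R = v%:E.
  by rewrite fineK// ge0_fin_numE ?lebesgue_ball_lty// measure_ge0.
have v0 : (0 <= v)%R by rewrite fine_ge0// measure_ge0.
pose f (r : R) := (n%:R * v * r ^+ n.-1)%R.
have cf : continuous f.
  by move=> r; apply: cvgM; [exact: cvg_cst|exact: exprn_continuous].
have mf : measurable_fun setT f by exact: continuous_measurable_fun.
have nuE (b : R) : pushforward (lebesgue R n) nrm `]-oo, b[%classic =
    lebesgue R n [set x | enorm x < b]%R.
  have E : nrm @^-1` `]-oo, b[%classic = [set x | enorm x < b]%R.
    by apply/seteqP; split => x /=; rewrite in_itv.
  by rewrite /pushforward -E.
have nu0 (b : R) : (b <= 0)%R -> lebesgue R n [set x | enorm x < b]%R = 0.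
  move=> b0; rewrite (_ : [set _ | _]%R = set0) ?measure0// -subset0 => x /= xb.
  by have := lt_le_trans (le_lt_trans (enorm_ge0 x) xb) b0; rewrite ltxx.
transitivity (\int[pushforward (lebesgue R n) nrm]_r g r).
  by rewrite ge0_integral_pushforward.
rewrite (@ge0_integral_density _ (f \_ `[0%R, +oo[) id)//; first last.
- move=> b; rewrite [RHS](nuE b) integral_mkcond.
  transitivity (\int[mu]_(x in `]-oo, b[%classic `&` `[0%R, +oo[%classic) (f x)%:E).
    rewrite [RHS]integral_mkcond; apply: eq_integral => x _.
    by rewrite /patch in_setI; do 2 case: (_ \in _).
  have [b0|b0] := leP b 0%R.
    rewrite nu0// (_ : _ `&` _ = set0) ?integral_set0//.
    rewrite -subset0 => x [/=]; rewrite !in_itv/= andbT => xb x0.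
    by have := lt_le_trans (le_lt_trans x0 xb) b0; rewrite ltxx.
  rewrite (_ : _ `&` _ = `[0%R, b[%classic); last first.
    by apply/seteqP; split => x /=; rewrite !in_itv/= andbT;
      [move=> [-> ->]|move=> /andP[-> ->]].
  rewrite integral_itv_bndo_bndc; last exact/measurable_EFinP/measurable_funTS.
  have dF (x : R) : is_derive x 1%R (fun r : R => v * r ^+ n)%R (f x).
    rewrite (_ : (fun r => _) = (v \*: (id ^+ n : R -> R)))%R; last first.
      by apply/funext => r; rewrite /= exprfctE.
    by apply: is_derive_eq; rewrite /f /= /GRing.scale /= mulr1 mulrCA mulrA.
  have cF : continuous (fun r : R => v * r ^+ n)%R.
    by move=> r; apply: cvgM; [exact: cvg_cst|exact: exprn_continuous].
  rewrite (@continuous_FTC2 _ _ (fun r : R => v * r ^+ n)%R)//.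
  + by rewrite lebesgue_ballE// vE expr0n gtn_eqF// mulr0 sube0 mulrC.
  + exact: continuous_subspaceT.
  + split => [x _||]; last 2 first.
    * exact/cvg_at_right_filter/cF.
    * exact/cvg_at_left_filter/cF.
    by have [] := dF x.
  + by move=> x _; rewrite derive1E; have [] := dF x.
- move=> b; rewrite [X in X < _](nuE b); have [b0|b0] := leP b 0%R; first by rewrite nu0.
  by rewrite lebesgue_ballE// vE -EFinM ltry.
- move=> x; rewrite /patch; case: ifPn => //; rewrite inE/= in_itv/= andbT => x0.
  by rewrite mulr_ge0// ?exprn_ge0// mulr_ge0.
- by apply/(measurable_restrictT _ _).1 => //; exact: measurable_funTS.
rewrite -ge0_integralZl//.
- rewrite [RHS]integral_mkcond; apply: eq_integral => x _; rewrite /patch.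
  by case: ifP; rewrite ?mule0// /f EFinM muleCA.
- by apply: emeasurable_funM; apply: measurable_funTS => //; apply/measurable_EFinP;
    exact: exprn_measurable.
- by move=> x /=; rewrite in_itv/= andbT => x0; rewrite mule_ge0// lee_fin exprn_ge0.
- by rewrite lee_fin mulr_ge0.
Qed.

Definition gauss_moment n := \int[mu]_(r in `[0%R, +oo[)
  ((expR (- r ^+ 2))%:E * (r ^+ n.-1)%:E).

Lemma measurable_gauss_EFin : measurable_fun setT (fun r : R => (expR (- r ^+ 2))%:E).
Proof. by apply/measurable_EFinP; exact: measurable_gauss_fun. Qed.

Lemma gauss_momentE n : (0 < n)%N ->
  (Num.sqrt pi ^+ n)%:E =
  (n%:R * fine (lebesgue R n [set x | enorm x < 1]%R))%:E * gauss_moment n.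
Proof.
move=> n0; rewrite -integral_lebesgue_gauss.
apply: (@ge0_integral_radial_ball n (fun r => (expR (- r ^+ 2))%:E) n0
  measurable_gauss_EFin) => x.
by rewrite lee_fin expR_ge0.
Qed.

(** If the moment were +oo, its product with a constant c >= 0 would be 0 or +oo, and not the
    positive real pi^(n/2). *)
Lemma gauss_moment_fin_num n : (0 < n)%N -> gauss_moment n \is a fin_num.
Proof.
move=> n0; have := gauss_momentE n0; set c := (_ * _)%R.
have I0 : 0 <= gauss_moment n.
  apply: integral_ge0 => r /=; rewrite in_itv/= andbT => r0.
  by rewrite mule_ge0// lee_fin ?expR_ge0// exprn_ge0.
have p0 : (0 < Num.sqrt pi ^+ n :> R)%R by rewrite exprn_gt0// sqrtr_gt0 pi_gt0.
move: I0; case: (gauss_moment n) => // _.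
have : (0 <= c)%R by rewrite mulr_ge0// fine_ge0.
rewrite le_eqVlt => /predU1P[<-|c0]; last by rewrite gt0_muley.
by rewrite mul0e => -[] p; move: p0; rewrite p ltxx.
Qed.

Lemma Gamma_half n : (0 < n)%N ->
  Gamma (n%:R / 2) = (2 * fine (gauss_moment n))%R :> R.
Proof.
move=> n0; have I := gauss_moment_fin_num n0.
transitivity (fine (2%:E * gauss_moment n)); last by rewrite fineM.
congr fine.
pose g t : \bar R := (t `^ (n%:R / 2 - 1) * expR (- t))%R%:E.
have mg : measurable_fun setT g.
  apply/measurable_EFinP; apply: measurable_funM; first exact: measurable_powR.
  exact: measurableT_comp.
have dF (x : R) : is_derive x 1%R (fun r : R => r ^+ 2)%R (2 * x)%R.
  rewrite (_ : (fun r => _) = (id ^+ 2 : R -> R))%R; last first.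
    by apply/funext => r; rewrite exprfctE.
  by apply: is_derive_eq; rewrite /GRing.scale /= mulr1 expr1.
rewrite (@ge0_integration_by_substitution_0y _ (fun r => r ^+ 2)%R (fun r =>
  2 * r)%R g _ _ dF)//.
- have mX : measurable_fun setT (fun r : R => (r ^+ n.-1)%:E).
    by apply/measurable_EFinP; exact: exprn_measurable.
  have mp := emeasurable_funM measurable_gauss_EFin mX.
  have mg2 : measurable_fun setT (fun r : R => g (r ^+ 2)%R * (2 * r)%:E).
    apply: emeasurable_funM.
      by apply: (measurableT_comp mg); exact: exprn_measurable.
    by apply/measurable_EFinP; exact: measurable_funM.
  rewrite -ge0_integralZl//; first last.
  + by move=> r /=; rewrite in_itv/= andbT => r0; rewrite mule_ge0// lee_fin ?expR_ge0//
      exprn_ge0.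
  + exact: measurable_funTS.
  (* For n = 1 the two integrands differ at r = 0, so this point is dropped before they are
     compared. *)
  rewrite -[RHS]integral_itv_obnd_cbnd; last first.
    by apply: measurable_funTS; exact: emeasurable_funM.
  rewrite -[LHS]integral_itv_obnd_cbnd; last exact: measurable_funTS.
  apply: eq_integral => r; rewrite inE/= in_itv/= andbT => r0.
  rewrite /g -!EFinM; congr EFin.
  have -> : (r ^+ n.-1 = (r ^+ 2) `^ (n%:R / 2 - 1) * r)%R.
    rewrite -!powR_mulrn ?ltW// -powRrM -{3}(powRr1 (ltW r0)) -powRD; last first.
      by apply/implyP => _; rewrite gt_eqF.
    congr (_ `^ _)%R.
    have : (n%:R = n.-1%:R + 1 :> R)%R by rewrite natr1 prednK.
    by move: (n%:R : R)%R (n.-1%:R : R)%R => a b ->; field.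
  set a := (_ `^ _)%R; set b := expR _; move: (r : R) a b => t a b; ring.
- by move=> x; apply: cvgM; [exact: cvg_cst|exact: cvg_id].
- by move=> x x0; rewrite mulr_ge0.
- by rewrite expr0n.
- move=> x y; rewrite !in_itv/= !andbT => x0 y0.
  by rewrite ltr_pXn2r.
- move=> b b0; exists (Num.sqrt b); first by rewrite sqrtr_gt0.
  by rewrite sqr_sqrtr// ltW.
- by move=> x; rewrite lee_fin mulr_ge0// ?powR_ge0 ?expR_ge0.
Qed.

(** With v the volume of the unit ball and I = [gauss_moment n], the Gaussian gives pi^(n/2) = n v
    I, while Gamma (n/2) = 2 I. The constant n v follows without computing v. *)
Lemma ge0_integral_radial n (g : R -> \bar R) : (0 < n)%N ->
  measurable_fun setT g -> (forall x, 0 <= g x) ->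
  \int[lebesgue R n]_x g (enorm x) =
  (2 * pi `^ (n%:R / 2) / Gamma (n%:R / 2))%:E *
  \int[mu]_(r in `[0%R, +oo[) (g r * (r ^+ n.-1)%:E).
Proof.
move=> n0 mg g0; rewrite ge0_integral_radial_ball//; congr (_%:E * _).
have I := gauss_moment_fin_num n0; have := gauss_momentE n0.
rewrite Gamma_half//; set c := (_ * fine _)%R.
rewrite -(fineK I); move: (fine (gauss_moment n)) => {}I [] piE.
have -> : (pi `^ (n%:R / 2) = Num.sqrt pi ^+ n :> R)%R.
  by rewrite mulrC powRrM powR12_sqrt ?pi_ge0// powR_mulrn// sqrtr_ge0.
have p0 : (0 < Num.sqrt pi ^+ n :> R)%R by rewrite exprn_gt0// sqrtr_gt0 pi_gt0.
have Ineq0 : I != 0%R by apply/eqP => I0; move: p0; rewrite piE I0 mulr0 ltxx.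
by rewrite piE /=; field.
Qed.

End radial.

(** * The kernel M0 and the inversion of the Abel transform *)

Section hyperbolic.
Context (R : realType).
Local Notation mu := (@lebesgue_measure R).

Definition sinh (s : R) : R := (expR s - expR (- s)) / 2.

Lemma is_derive_expRN (x : R) : is_derive x 1 (fun s : R => expR (- s)) (- expR (- x)).
Proof.
have H := is_derive1_comp (is_derive_expR (- x)) (is_deriveNid x 1).
by apply: (@is_derive_eq _ _ _ _ _ _ _ _ H); rewrite mulrN1.
Qed.

Lemma is_derive_sinh (x : R) : is_derive x 1 sinh (cosh x).
Proof.
rewrite (_ : sinh = 2^-1 \*: (expR - (fun s => expR (- s)))); last first.
  by apply/funext => s; rewrite /sinh /= mulrC.
have H := is_derive_expRN x.
by apply: is_derive_eq; rewrite /GRing.scale /= opprK mulrC.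
Qed.

Lemma is_derive_cosh (x : R) : is_derive x 1 (@cosh R) (sinh x).
Proof.
rewrite (_ : @cosh R = 2^-1 \*: (expR + (fun s => expR (- s)))); last first.
  by apply/funext => s; rewrite /cosh /= mulrC.
have H := is_derive_expRN x.
by apply: is_derive_eq; rewrite /GRing.scale /= mulrC.
Qed.

Lemma continuous_sinh : continuous sinh.
Proof.
by move=> x; apply/differentiable_continuous/derivable1_diffP; have [] := is_derive_sinh x.
Qed.

Lemma continuous_cosh : continuous (@cosh R).
Proof.
by move=> x; apply/differentiable_continuous/derivable1_diffP; have [] := is_derive_cosh x.
Qed.

Lemma measurable_cosh : measurable_fun setT (@cosh R).
Proof. exact: continuous_measurable_fun continuous_cosh. Qed.

Lemma cosh2 (x : R) : cosh x ^+ 2 = 1 + sinh x ^+ 2.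
Proof.
rewrite /cosh /sinh; have : expR x * expR (- x) = 1 by rewrite -expRD subrr expR0.
move: (expR x) (expR (- x)) => a b ab; rewrite -[X in _ = X + _]ab; by field.
Qed.

Lemma cosh_ge1 (x : R) : 1 <= cosh x.
Proof.
have c0 : 0 < cosh x by rewrite divr_gt0// addr_gt0 ?expR_gt0.
have : 1 <= cosh x ^+ 2 by rewrite cosh2 lerDl sqr_ge0.
by rewrite expr_ge1// ltW.
Qed.

Lemma cosh_gt0 (x : R) : 0 < cosh x.
Proof. exact: lt_le_trans ltr01 (cosh_ge1 x). Qed.

Lemma sinh_mono : {mono sinh : x y / x < y}.
Proof.
apply/leW_mono/le_mono => x y xy; rewrite ltr_pM2r// ltrD ?ltr_expR// ltrN2.
by rewrite ltr_expR ltrN2.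
Qed.

Lemma sinh0 : sinh 0 = 0.
Proof. by rewrite /sinh oppr0 subrr mul0r. Qed.

Lemma sinh_surj (b : R) : 0 < b -> exists2 c, 0 < c & sinh c = b.
Proof.
move=> b0; pose q := Num.sqrt (b ^+ 2 + 1).
have q2 : q ^+ 2 = b ^+ 2 + 1 by rewrite sqr_sqrtr// addr_ge0 ?sqr_ge0.
have q0 : 0 < q by rewrite sqrtr_gt0 ltr_wpDl// sqr_ge0.
have bq : 0 < b + q by rewrite addr_gt0.
have E : sinh (ln (b + q)) = b.
  rewrite /sinh expRN lnK ?posrE//.
  have -> : (b + q)^-1 = q - b.
    apply: (mulfI (lt0r_neq0 bq)); rewrite mulfV ?lt0r_neq0//.
    by rewrite (_ : _ * _ = q ^+ 2 - b ^+ 2); [rewrite q2; ring|ring].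
  by field.
exists (ln (b + q)) => //.
by rewrite -sinh_mono sinh0 E.
Qed.

Lemma ge0_integral_even (f : R -> \bar R) : measurable_fun setT f ->
  (forall x, 0 <= f x)%E -> (forall x, f (- x) = f x) ->
  (\int[mu]_x f x = 2%:E * \int[mu]_(x in `[0%R, +oo[) f x)%E.
Proof.
move=> mf f0 fN.
have mI : measurable (`[0%R, +oo[%classic : set (measurableTypeR R)) by [].
rewrite -(setUv `[0%R, +oo[%classic) ge0_integral_setU//=.
- rewrite mule_natl mule2n; congr +%E.
  rewrite setCitvr integral_itv_bndo_bndc; last exact: measurable_funTS.
  rewrite ge0_integration_by_substitution0//.
  by apply: eq_integral => x _; rewrite fN.
- exact: measurableC.
- by rewrite setUv.
- exact/disj_setPCl.
Qed.

Lemma cvgr_expR_scale (c : R) : 0 < c -> expR (- c * x) @[x --> +oo] --> (0 : R).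
Proof.
move=> c0; rewrite (_ : (fun x => _) = (fun z => expR (- z)) \o (fun z => c * z)).
  by apply: (@cvg_comp _ _ _ _ _ _ (pinfty_nbhs R)); [exact: gt0_cvgMry|exact: cvgr_expR].
by apply/funext => x; rewrite mulNr.
Qed.

Lemma is_derive_expR_scale (c x : R) :
  is_derive x 1 (fun r => expR (c * r)) (c * expR (c * x)).
Proof.
have H1 : is_derive x 1 (c \*: (id : R -> R)) (c *: (1 : R)) by apply: is_deriveZ.
have H := is_derive1_comp (is_derive_expR (c * x)) H1.
by apply: (@is_derive_eq _ _ _ _ _ _ _ _ H); rewrite /GRing.scale /= mulr1 mulrC.
Qed.

Lemma continuous_expR_scale (c : R) : continuous (fun r => expR (c * r)).
Proof.
by move=> x; apply/differentiable_continuous/derivable1_diffP;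
  have [] := is_derive_expR_scale c x.
Qed.

Lemma measurable_expR_scale (c : R) : measurable_fun setT (fun r => expR (c * r)).
Proof. by apply: continuous_measurable_fun; exact: continuous_expR_scale. Qed.

Lemma integral_expRN_0y (c : R) : 0 < c ->
  (\int[mu]_(r in `[0%R, +oo[) (expR (- c * r))%:E = (c^-1)%:E)%E.
Proof.
move=> c0.
have dF (x : R) : is_derive x 1 (fun r => - c^-1 * expR (- c * r)) (expR (- c * x)).
  have H := is_derive_expR_scale (- c) x.
  rewrite (_ : (fun r => _) = - c^-1 \*: (fun r => expR (- c * r)))//.
  by apply: is_derive_eq; rewrite /GRing.scale /= mulrA mulrNN mulVf ?mul1r// gt_eqF.
rewrite (@ge0_continuous_FTC2y _ _ (fun r => - c^-1 * expR (- c * r)) _ 0)//.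
- by rewrite mulr0 expR0 mulr1 EFinN oppeK add0e.
- by apply: continuous_subspaceT; exact: continuous_expR_scale.
- by rewrite -(mulr0 (- c^-1)); apply: cvgMr; exact: cvgr_expR_scale.
- by apply: cvg_at_right_filter; apply: cvgMr; exact: continuous_expR_scale.
- by move=> x _; rewrite derive1E; have [] := dF x.
Qed.

Lemma cvgr_id_expRN (c : R) : 0 < c -> x * expR (- c * x) @[x --> +oo] --> (0 : R).
Proof.
move=> c0; have c20 : 0 < c / 2 by rewrite divr_gt0.
apply: (@squeeze_cvgr _ _ _ _ (cst 0) (fun x => 2 / c * expR (- (c / 2) * x))).
- near=> x; have x0 : 0 <= x by near: x; exact: nbhs_pinfty_ge.
  rewrite /cst mulr_ge0 ?expR_ge0//=.
  (* One of the two halves of the exponential absorbs x, as c x / 2 <= exp (c x / 2). *)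
  have -> : - c * x = - (c / 2) * x + - (c / 2) * x by field.
  rewrite expRD mulrA ler_pM2r ?expR_gt0//.
  rewrite mulNr expRN ler_pdivrMr ?expR_gt0// -ler_pdivrMl ?divr_gt0//.
  rewrite invfM invrK mulrC (le_trans _ (expR_ge1Dx _))// mulrC.
  by rewrite (mulrC 2^-1) lerDr.
- exact: cvg_cst.
- by rewrite -(mulr0 (2 / c)); apply: cvgMr; exact: cvgr_expR_scale.
Unshelve. all: by end_near. Qed.

Lemma integral_id_expRN_0y (c : R) : 0 < c ->
  (\int[mu]_(r in `[0%R, +oo[) (r * expR (- c * r))%:E = (c ^- 2)%:E)%E.
Proof.
move=> c0; have cn0 : c != 0 by rewrite gt_eqF.
pose F (r : R) : R := - (c^-1 * r + c ^- 2) * expR (- c * r).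
have dF (x : R) : is_derive x 1 F (x * expR (- c * x)).
  have H := is_derive_expR_scale (- c) x.
  rewrite (_ : F = - (c^-1 \*: id + cst (c ^- 2)) * (fun r => expR (- c * r)))//.
  apply: is_derive_eq; rewrite /GRing.scale /=.
  move: (expR _) => E; change (- (c^-1 * x + c ^- 2) * (- c * E) + E * - (c^-1 * 1 + 0) =
    x * E).
  by field.
have cf : continuous (fun r : R => r * expR (- c * r)).
  by move=> x; apply: cvgM; [exact: cvg_id|exact: continuous_expR_scale].
rewrite (@ge0_continuous_FTC2y _ _ F _ 0)//.
- by rewrite /F !mulr0 expR0 mulr1 -EFinB !add0r opprK.
- by move=> x x0; rewrite mulr_ge0// expR_ge0.
- exact: continuous_subspaceT.
- rewrite (_ : F = fun r => - c^-1 * (r * expR (- c * r)) + - c ^- 2 * expR (- c * r)).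
    rewrite -[X in _ --> X](addr0 0) -[X in _ --> X + _](mulr0 (- c^-1)) -[X in _ --> _ +
      X](mulr0 (- c ^- 2)).
    by apply: cvgD; apply: cvgMr; [exact: cvgr_id_expRN|exact: cvgr_expR_scale].
  by apply/funext => r; rewrite /F; ring.
- apply: cvg_at_right_filter; apply/differentiable_continuous/derivable1_diffP.
  by have [] := dF 0.
- by move=> x _; rewrite derive1E; have [] := dF x.
Qed.

Lemma integral_cosh_inv_sqr :
  (\int[mu]_(s in `[0%R, +oo[) (cosh s ^- 2)%:E = 1)%E.
Proof.
(* This is tanh, in a form whose limit 1 at infinity is immediate. *)
pose F (s : R) : R := 1 - expR (- s) * (cosh s)^-1.
have dF (x : R) : is_derive x 1 F (cosh x ^- 2).
  have cn0 : cosh x != 0 by rewrite gt_eqF// cosh_gt0.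
  have H1 := is_derive_expRN x; have H2 := is_derive_cosh x.
  rewrite (_ : F = cst 1 - (fun s => expR (- s)) * (fun s => (cosh s)^-1))//.
  have H3 : is_derive x 1 (fun s => (cosh s)^-1) (- cosh x ^- 2 *: sinh x).
    by split; [apply: derivableV|rewrite deriveV// derive_val].
  apply: is_derive_eq; rewrite /GRing.scale /=.
  have e0 : 0 < expR x by exact: expR_gt0.
  move: cn0; rewrite /cosh /sinh expRN; move: (expR x) e0 => e e0 cn0.
  have e2 : e ^+ 2 + 1 != 0 by rewrite gt_eqF// addr_gt0// exprn_gt0.
  by field; rewrite e2 gt_eqF.
have cf : continuous (fun s : R => cosh s ^- 2).
  move=> x; apply: cvgV; first by rewrite expf_neq0// gt_eqF// cosh_gt0.
  by apply: cvgM; exact: continuous_cosh.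
rewrite (@ge0_continuous_FTC2y _ _ F _ 1)//.
- rewrite /F /cosh oppr0 expR0 mul1r.
  by rewrite (_ : 1 + 1 = 2)// divff// invr1 subrr sube0.
- by move=> x x0; rewrite invr_ge0 sqr_ge0.
- exact: continuous_subspaceT.
- rewrite -[X in _ --> X]subr0; apply: cvgB; first exact: cvg_cst.
  apply: (@squeeze_cvgr _ _ _ _ (cst 0) (fun x => expR (- x))).
  + near=> x; rewrite /cst divr_ge0 ?expR_ge0 ?(ltW (cosh_gt0 x))//=.
    by rewrite ler_piMr ?expR_ge0// invf_le1 ?cosh_gt0// cosh_ge1.
  + exact: cvg_cst.
  + exact: cvgr_expR.
- apply: cvg_at_right_filter; apply/differentiable_continuous/derivable1_diffP.
  by have [] := dF 0.
- by move=> x _; rewrite derive1E; have [] := dF x.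
Unshelve. all: by end_near. Qed.

(** The crude bound cosh u >= u / 2 suffices for integrability. *)
Lemma expR_cosh_ub (a u : R) : 0 < a -> expR (- a * cosh u) <= expR (- a / 2 * u).
Proof.
move=> a0; rewrite ler_expR -mulrA !mulNr lerN2 ler_pM2l// /cosh mulrC ler_pM2r//.
rewrite (le_trans (_ : u <= 1 + u)) ?lerDr//.
by rewrite (le_trans (expR_ge1Dx _))// lerDl expR_ge0.
Qed.

Lemma measurable_expR_cosh :
  measurable_fun setT (fun z : R * R => (expR (- z.1 * cosh z.2))%:E).
Proof.
apply/measurable_EFinP; apply: (measurableT_comp (@measurable_expR R)).
apply: measurable_funM; first by apply: measurable_funN; exact: measurable_fst.
by apply: (measurableT_comp measurable_cosh); exact: measurable_snd.
Qed.

Lemma integral_expR_cosh_lty (a : R) : 0 < a ->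
  (\int[mu]_(s in `[0%R, +oo[) (expR (- a * cosh s))%:E < +oo)%E.
Proof.
move=> a0; apply: (@le_lt_trans _ _ (\int[mu]_(s in `[0%R, +oo[) (expR (- (a / 2) * s))%:E)%E).
  apply: ge0_le_integral => //.
  - apply/measurable_EFinP; apply: measurable_funTS.
    apply: (measurableT_comp (@measurable_expR R)).
    by apply: measurable_funM => //; exact: measurable_cosh.
  - apply/measurable_EFinP; apply: measurable_funTS.
    exact: measurable_expR_scale.
  - by move=> x _; rewrite lee_fin -mulNr expR_cosh_ub.
by rewrite integral_expRN_0y ?divr_gt0// ltry.
Qed.

Lemma M0E (a : R) : 0 < a ->
  (M0 a)%:E = (\int[mu]_(s in `[0%R, +oo[) (expR (- a * cosh s))%:E)%E.
Proof.
move=> a0; rewrite /M0 /Rintegral fineK// ge0_fin_numE ?integral_expR_cosh_lty//.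
by apply: integral_ge0 => x _; rewrite lee_fin expR_ge0.
Qed.

Lemma ge0_fubini_tonelli_in (D : set R) (f : R * R -> \bar R) :
  measurable (D : set (measurableTypeR R)) -> measurable_fun setT f ->
  (forall x y, D x -> D y -> (0 <= f (x, y))%E) ->
  (\int[mu]_(x in D) \int[mu]_(y in D) f (x, y) =
   \int[mu]_(y in D) \int[mu]_(x in D) f (x, y))%E.
Proof.
move=> mD mf f0; pose g := (f \_ (D `*` D))%E.
have mDD : measurable (D `*` D : set (measurableTypeR R * measurableTypeR R)%type).
  exact: measurableX.
have := @fubini_tonelli _ _ _ _ R mu mu g.
have gE x y : g (x, y) = if (x \in D) && (y \in D) then f (x, y) else 0%E.
  by rewrite /g /patch in_setX.
have -> : (\int[mu]_x \int[mu]_y g (x, y) = \int[mu]_(x in D) \int[mu]_(y in D) f (x, y))%E.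
  rewrite [RHS]integral_mkcond; apply: eq_integral => x _; rewrite /patch.
  case: ifPn => xD.
    by rewrite [RHS]integral_mkcond; apply: eq_integral => y _; rewrite gE xD.
  by rewrite integral0_eq// => y _; rewrite gE (negbTE xD).
have -> : (\int[mu]_y \int[mu]_x g (x, y) = \int[mu]_(y in D) \int[mu]_(x in D) f (x, y))%E.
  rewrite [RHS]integral_mkcond; apply: eq_integral => y _; rewrite /patch.
  case: ifPn => yD.
    by rewrite [RHS]integral_mkcond; apply: eq_integral => x _; rewrite gE yD andbT.
  by rewrite integral0_eq// => x _; rewrite gE (negbTE yD) andbF.
apply.
- by apply/(measurable_restrictT _ _).1 => //; exact: measurable_funTS.
- move=> [x y]; rewrite gE; case: ifPn => // /andP[]; rewrite !inE; exact: f0.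
Qed.

(** Integrating first in r, the function r exp (- r cosh s) contributes 1 / cosh(s)^2, whose
    integral in s is 1. *)
Lemma integral_M0 :
  (\int[mu]_(r in `[0%R, +oo[) ((M0 r)%:E * r%:E) = 1)%E.
Proof.
have mI : measurable (`[0%R, +oo[%classic : set (measurableTypeR R)) by [].
transitivity (\int[mu]_(r in `[0%R, +oo[) \int[mu]_(s in `[0%R, +oo[)
   ((expR (- r * cosh s))%:E * r%:E))%E.
  (* At r = 0 the integral defining [M0] diverges, but the factor r annihilates both sides. *)
  apply: eq_integral => r; rewrite inE/= in_itv/= andbT le_eqVlt => /predU1P[<-|r0].
    by rewrite mule0 integral0_eq// => s _; rewrite mule0.
  have mr : measurable_fun setT (fun s => (expR (- r * cosh s))%:E).
    have := measurableT_comp measurable_expR_cosh (@measurable_pair1 _ _ R R r).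
    by [].
  rewrite M0E// ge0_integralZr//.
  - exact: measurable_funTS.
  - by rewrite lee_fin ltW.
rewrite (@ge0_fubini_tonelli_in _ (fun z => (expR (- z.1 * cosh z.2))%:E * (z.1)%:E)%E)//.
- rewrite -[RHS]integral_cosh_inv_sqr; apply: eq_integral => s _.
  rewrite -integral_id_expRN_0y ?cosh_gt0//; apply: eq_integral => r _ /=.
  rewrite -EFinM; congr EFin; rewrite [LHS]mulrC; congr (_ * expR _).
  by rewrite !mulNr mulrC.
- apply: emeasurable_funM; first exact: measurable_expR_cosh.
  by apply/measurable_EFinP; exact: measurable_fst.
- move=> x y /=; rewrite !in_itv/= !andbT => x0 y0.
  by rewrite mule_ge0// lee_fin expR_ge0.
Qed.

Lemma measurable_M0 : measurable_fun setT (@M0 R).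
Proof.
apply: (measurableT_comp (@fine_measurable R _ measurableT)).
have mI : measurable (setT `*` `[0%R, +oo[%classic : set (measurableTypeR R *
  measurableTypeR R)%type).
  exact: measurableX.
pose f := ((fun z : R * R => (expR (- z.1 * cosh z.2))%:E) \_ (setT `*` `[0%R, +oo[%classic))%E.
rewrite (_ : (fun _ => _) = (fun r => \int[mu]_s f (r, s))%E).
  apply: measurable_fun_fubini_tonelli_F.
    by apply/(measurable_restrictT _ _).1 => //; apply: measurable_funTS;
      exact: measurable_expR_cosh.
  by move=> z; apply: erestrict_ge0 => y _; rewrite lee_fin expR_ge0.
apply/funext => r; rewrite integral_mkcond; apply: eq_integral => s _.
by rewrite /f /patch in_setX in_setT.
Qed.

End hyperbolic.

(** * The double integral behind the Abel inversion *)

Section abel.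
Context (R : realType).
Local Notation mu := (@lebesgue_measure R).
Local Notation T n := (n.-tuple (measurableTypeR R)).

Lemma Gamma1 : Gamma (2%:R / 2) = 1 :> R.
Proof.
rewrite divff// /Gamma; transitivity (\int[mu]_(t in `[0, +oo[) expR (- 1 * t)).
  by apply: eq_Rintegral => t _; rewrite subrr powRr0 mul1r mulN1r.
by rewrite /Rintegral integral_expRN_0y//= invr1.
Qed.

Local Open Scope ereal_scope.

Lemma measurable_fun_integral_in (D : set R) (f : R * R -> \bar R) :
  measurable (D : set (measurableTypeR R)) -> measurable_fun setT f ->
  (forall z, 0 <= f z) ->
  measurable_fun setT (fun x => \int[mu]_(y in D) f (x, y)).
Proof.
move=> mD mf f0.
have mI : measurable (setT `*` D : set (measurableTypeR R * measurableTypeR R)%type).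
  exact: measurableX.
pose h := f \_ (setT `*` D).
rewrite (_ : (fun _ => _) = (fun r => \int[mu]_s h (r, s))).
  apply: measurable_fun_fubini_tonelli_F.
    by apply/(measurable_restrictT _ _).1 => //; exact: measurable_funTS.
  by move=> z; apply: erestrict_ge0.
apply/funext => r; rewrite integral_mkcond; apply: eq_integral => s _.
by rewrite /h /patch in_setX in_setT.
Qed.

Lemma integral_lebesgue2 (f : R -> R -> \bar R) :
  measurable_fun setT (fun z : R * R => f z.1 z.2) ->
  (forall x y, 0 <= f x y) ->
  \int[mu]_x \int[mu]_y f x y =
  \int[lebesgue R 2]_t f (tnth t ord0) (tnth t ord_max).
Proof.
move=> mf f0; have m2 : measurable_fun setT (fun t : T 2 => f (tnth t ord0) (tnth t ord_max)).
  apply: (@measurableT_comp _ _ _ _ _ _ (fun z : R * R => f z.1 z.2) _ (fun t : T 2 =>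
    (tnth t ord0, tnth t ord_max))) => //.
  by apply/measurable_fun_pairP; split; exact: measurable_tnth.
rewrite ge0_integral_lebesgue_cons//.
apply: eq_integral => x _.
have mx : measurable_fun setT (fun t : T 1 => f x (tnth t ord0)).
  apply: (@measurableT_comp _ _ _ _ _ _ (fun z : R * R => f z.1 z.2) _ (fun t : T 1 =>
    (x, tnth t ord0))) => //.
  by apply/measurable_fun_pairP; split; [exact: measurable_cst|exact: measurable_tnth].
transitivity (\int[lebesgue R 1]_t f x (tnth t ord0)).
  rewrite ge0_integral_lebesgue_cons//.
  apply: eq_integral => y _; rewrite integral_dirac//.
    by rewrite diracE in_setT mul1e tnth0.
  by under eq_fun do rewrite tnth0; exact: measurable_cst.
apply: eq_integral => t _; rewrite tnth0.
by rewrite (_ : ord_max = lift ord0 ord0) ?tnthS//; exact: val_inj.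
Qed.

(** Radial integration in the plane, whose constant 2 pi is divided by 4 because the integrand is
    even in each variable. *)
Lemma ge0_integral_quadrant (k : R -> \bar R) :
  measurable_fun setT k -> (forall x, 0 <= k x) ->
  \int[mu]_(x in `[0%R, +oo[) \int[mu]_(y in `[0%R, +oo[) k (x ^+ 2 + y ^+ 2)%R =
  (pi / 2)%:E * \int[mu]_(r in `[0%R, +oo[) (k (r ^+ 2)%R * r%:E).
Proof.
move=> mk k0.
have mk2 : measurable_fun setT (fun z : R * R => k (z.1 ^+ 2 + z.2 ^+ 2)%R).
  apply: (measurableT_comp mk); apply: measurable_funD; apply: measurable_funX.
    exact: measurable_fst.
  exact: measurable_snd.
have E : \int[mu]_x \int[mu]_y k (x ^+ 2 + y ^+ 2)%R =
    (2 * pi)%:E * \int[mu]_(r in `[0%R, +oo[) (k (r ^+ 2)%R * r%:E).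
  rewrite (integral_lebesgue2 mk2)//.
  rewrite (eq_integral (fun t : T 2 => (fun r => k (r ^+ 2)%R) (enorm t))); last first.
    move=> t _ /=; rewrite /enorm sqr_sqrtr ?sumr_ge0// => [|i _]; last exact: sqr_ge0.
    by rewrite big_ord_recl big_ord1; congr (k (_ + tnth t _ ^+ 2)%R); exact: val_inj.
  rewrite (@ge0_integral_radial R 2 (fun r => k (r ^+ 2)%R))//.
    by rewrite Gamma1 divff// powRr1 ?pi_ge0// divr1.
  by apply: (measurableT_comp mk); exact: exprn_measurable.
pose H x := \int[mu]_(y in `[0%R, +oo[) k (x ^+ 2 + y ^+ 2)%R.
have mI : measurable (`[0%R, +oo[%classic : set (measurableTypeR R)) by [].
have HE x : \int[mu]_y k (x ^+ 2 + y ^+ 2)%R = 2%:E * H x.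
  apply: ge0_integral_even => //.
    exact: (measurableT_comp mk2 (measurable_pair1 x)).
  by move=> y; rewrite sqrrN.
have mH : measurable_fun setT H by exact: (measurable_fun_integral_in mI mk2).
have H0 x : 0 <= H x by exact: integral_ge0.
move: E; under eq_integral do rewrite HE.
rewrite ge0_integralZl// ge0_integral_even//; last by move=> x; rewrite /H sqrrN.
rewrite -[\int[mu]_(x in _) \int[mu]_(y in _) _]/(\int[mu]_(x in `[0%R, +oo[) H x).
rewrite muleA -EFinM => E4.
rewrite -[LHS]mul1e (_ : 1 = (4^-1 * (2 * 2))%:E); last by congr EFin; field.
rewrite EFinM -muleA E4 muleA -EFinM; congr (_%:E * _); by field.
Qed.

(* Substituting x = sinh u, y = cosh u * sinh s turns the left-hand side into an
   integral over a quadrant of a function of x^2 + y^2 alone. *)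
Lemma ge0_abel (g : R -> R) (r : R) : (0 < r)%R ->
  measurable_fun setT g -> (forall x, 0 <= g x)%R ->
  \int[mu]_(u in `[0%R, +oo[) \int[mu]_(s in `[0%R, +oo[)
    (r * cosh u * g (r * cosh u * cosh s))%:E =
  (pi / 2)%:E * \int[mu]_(t in `[0%R, +oo[) (g (t + r))%:E.
Proof.
move=> r0 mg g0.
(* With q = x^2 + y^2 one has 1 + q = (cosh u cosh s)^2, and multiplication by the Jacobian cosh u
   (cosh u cosh s) turns k(q) into the integrand of the left-hand side. *)
pose k q := (r * g (r * Num.sqrt (1 + q)) * (1 + q) `^ (- 2^-1))%:E.
have m1 : measurable_fun setT (fun q : R => 1 + q)%R by exact: measurable_funD.
have msq : measurable_fun setT (@Num.sqrt R : R -> R).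
  by apply: continuous_measurable_fun; exact: sqrt_continuous.
have mk : measurable_fun setT k.
  apply/measurable_EFinP; apply: measurable_funM.
    apply: measurable_funM => //; apply: (measurableT_comp mg).
    by apply: measurable_funM => //; exact: (measurableT_comp msq m1).
  exact: (measurableT_comp (measurable_powR _) m1).
have k0 q : 0 <= k q by rewrite lee_fin mulr_ge0 ?powR_ge0// mulr_ge0// ltW.
have kE (q c : R) : (0 < c -> 1 + q = c ^+ 2 -> k q = (r * g (r * c) / c)%:E)%R.
  move=> c0 qE; rewrite /k qE sqrtr_sqr gtr0_norm// powRN powR12_sqrt ?sqr_ge0//.
  by rewrite sqrtr_sqr gtr0_norm.
have mI : measurable (`[0%R, +oo[%classic : set (measurableTypeR R)) by [].
have mk2 : measurable_fun setT (fun z : R * R => k (z.1 ^+ 2 + z.2 ^+ 2)%R).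
  apply: (measurableT_comp mk); apply: measurable_funD; apply: measurable_funX.
    exact: measurable_fst.
  exact: measurable_snd.
pose H x := \int[mu]_(y in `[0%R, +oo[) k (x ^+ 2 + y ^+ 2)%R.
have mH : measurable_fun setT H by exact: (measurable_fun_integral_in mI mk2).
have H0 x : 0 <= H x by exact: integral_ge0.
transitivity (\int[mu]_(x in `[0%R, +oo[) H x).
  rewrite [RHS](@ge0_integration_by_substitution_0y _ (@sinh R) (@cosh R) H
    (@continuous_cosh R) (fun x _ => ltW (cosh_gt0 x)) (@is_derive_sinh R) (sinh0 R))//;
      first last.
  - exact: sinh_surj.
  - by move=> x y _ _; exact: sinh_mono.
  apply: eq_integral => v _; move: (v : R) => {v}u.
  have cu := cosh_gt0 u.
  have dF (x : R) : is_derive x 1%R (fun s => cosh u * sinh s)%R (cosh u * cosh x)%R.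
    have H1 := is_derive_sinh x.
    rewrite (_ : (fun s => _) = (cosh u \*: @sinh R))%R//.
    by apply: is_derive_eq.
  have cf : continuous (fun s : R => cosh u * cosh s)%R.
    by move=> x; apply: cvgMr; exact: continuous_cosh.
  have mku : measurable_fun setT (fun y : R => k (sinh u ^+ 2 + y ^+ 2)%R).
    exact: (measurableT_comp mk2 (measurable_pair1 (sinh u))).
  rewrite /H (@ge0_integration_by_substitution_0y _ (fun s => cosh u * sinh s)%R
    (fun s => cosh u * cosh s)%R (fun y : R => k (sinh u ^+ 2 + y ^+ 2)%R) cf _ dF)//;
      first last.
  - move=> b b0; have [c c0 cE] := @sinh_surj R (b / cosh u) (divr_gt0 b0 cu).
    by exists c => //; rewrite cE mulrC divfK// gt_eqF.
  - by move=> x y _ _; rewrite ltr_pM2l// sinh_mono.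
  - by rewrite sinh0 mulr0.
  - by move=> x _; rewrite mulr_ge0// ltW// cosh_gt0.
  rewrite -ge0_integralZr//.
  - apply: eq_integral => v _; move: (v : R) => {v}s.
    rewrite (kE _ (cosh u * cosh s)%R); last 2 first.
    + by rewrite mulr_gt0// cosh_gt0.
    + have E (a b c d : R) : (d ^+ 2 = 1 + c ^+ 2 -> b ^+ 2 = 1 + a ^+ 2 ->
          1 + (a ^+ 2 + (b * c) ^+ 2) = (b * d) ^+ 2)%R.
        by move=> dE bE; rewrite !exprMn dE bE; ring.
      exact: E (cosh2 s) (cosh2 u).
    rewrite -!EFinM; congr EFin; rewrite divfK.
      by rewrite (mulrA r) mulrAC.
    by rewrite mulf_neq0// gt_eqF// cosh_gt0.
  - apply: measurable_funTS; apply: emeasurable_funM.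
      apply: (measurableT_comp mku); apply: measurable_funM => //.
      by apply: continuous_measurable_fun; exact: continuous_sinh.
    apply/measurable_EFinP; apply: measurable_funM => //; exact: measurable_cosh.
  - by move=> s _; rewrite mule_ge0// lee_fin mulr_ge0// ltW// cosh_gt0.
  - by rewrite lee_fin ltW.
rewrite ge0_integral_quadrant//; congr (_ * _).
(* With x the radius in the quadrant, the remaining substitution is t = r sqrt (1 + x^2) - r. *)
pose F (x : R) : R := (r * Num.sqrt (1 + x ^+ 2) - r)%R.
pose f (x : R) : R := (r * x / Num.sqrt (1 + x ^+ 2))%R.
have q0 (x : R) : (0 < 1 + x ^+ 2)%R by rewrite ltr_pwDl// sqr_ge0.
have s0 (x : R) : (0 < Num.sqrt (1 + x ^+ 2))%R by rewrite sqrtr_gt0.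
have dS (x : R) : is_derive x 1%R (@Num.sqrt R \o (fun x : R => 1 + x ^+ 2)%R)
    ((2 * Num.sqrt (1 + x ^+ 2))^-1 * (2 * x))%R.
  have D1 : is_derive x 1%R (fun x : R => 1 + x ^+ 2)%R (2 * x)%R.
    rewrite (_ : (fun x => _) = (cst 1 + id ^+ 2 : R -> R))%R; last first.
      by apply/funext => t; rewrite fctE exprfctE.
    by apply: is_derive_eq; rewrite /GRing.scale /= mulr1 expr1 add0r.
  exact: (@is_derive1_comp R (@Num.sqrt R) (fun x =>
    1 + x ^+ 2)%R x _ _ (is_derive1_sqrt (q0 x)) D1).
have dF (x : R) : is_derive x 1%R F (f x).
  have D2 := dS x.
  rewrite (_ : F = (r \*: (@Num.sqrt R \o (fun x : R => 1 + x ^+ 2)) - cst r))%R//.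
  apply: is_derive_eq; rewrite /GRing.scale /= subr0 /f.
  by field; rewrite gt_eqF.
have cS : continuous (@Num.sqrt R \o (fun x : R => 1 + x ^+ 2)%R).
  by move=> x; apply/differentiable_continuous/derivable1_diffP; have [] := dS x.
have cf : continuous f.
  move=> x; apply: cvgM; first by apply: cvgMr; exact: cvg_id.
  apply: cvgV; first by rewrite gt_eqF.
  exact: cS.
rewrite (@ge0_integration_by_substitution_0y _ F f (fun t => (g (t + r))%:E) cf _ dF)//;
  first last.
- by move=> x; rewrite lee_fin.
- by apply/measurable_EFinP; apply: (measurableT_comp mg); exact: measurable_funD.
- move=> b b0; exists (Num.sqrt ((b / r + 1) ^+ 2 - 1)).
    rewrite sqrtr_gt0 subr_gt0 exprn_egt1// ltrDr divr_gt0//.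
  rewrite /F sqr_sqrtr.
    have br : (0 <= b / r + 1)%R by rewrite addr_ge0// divr_ge0// ltW.
    by rewrite (addrC 1%R) subrK sqrtr_sqr ger0_norm// mulrDr mulr1 addrK mulrC divfK// gt_eqF.
  by rewrite subr_ge0 exprn_ege1// lerDr ltW// divr_gt0.
- move=> x y; rewrite !in_itv/= !andbT => x0 y0.
  by rewrite ltrD2r ltr_pM2l// ltr_sqrt// ltrD2l ltr_pXn2r.
- by rewrite /F expr0n addr0 sqrtr1 mulr1 subrr.
- by move=> x x0; rewrite /f divr_ge0 ?(ltW (s0 x))// mulr_ge0// ltW.
apply: eq_integral => v _; move: (v : R) => {v}x.
rewrite (kE _ (Num.sqrt (1 + x ^+ 2))%R)//; last by rewrite sqr_sqrtr// ltW.
rewrite -!EFinM; congr EFin; rewrite /F /f subrK.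
by move: (g _) => G; rewrite mulrAC -!mulrA mulrCA.
Qed.

End abel.

(** * The derivative of J on the half-line *)

Section derive_in_interior.
Context (R : realType).
Local Notation mu := (@lebesgue_measure R).
Implicit Types (J : R -> R).

Lemma derive_in_nbhs (A : set R) f (x : R) : nbhs x A -> cvg (quotient_in A f x) ->
  is_derive x 1 f (derive_in A f x).
Proof.
move=> xA cq.
have q : (f y - f x) / (y - x) @[y --> x^'] --> derive_in A f x.
  apply: cvg_trans cq; apply: cvg_app => P AP.
  have xA' : \forall y \near x^', A y by exact: nbhs_dnbhs.
  have AP' : \forall y \near x^', A y -> P y by exact: AP.
  by apply: filterS2 xA' AP' => y Ay; exact.
have s : h + x @[h --> (0 : R)^'] --> x^'.
  move=> P /nbhs_ballP[e e0 H]; apply/nbhs_ballP; exists e => //= h.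
  rewrite /ball/= sub0r normrN => he h0; apply: H.
    by rewrite /ball/= opprD addrCA subrr addr0 normrN.
  by rewrite -subr_eq0 addrK.
have q0 : h^-1 *: (f (h *: 1 + x) - f x) @[h --> 0^'] --> derive_in A f x.
  apply: cvg_trans (cvg_comp _ _ s q); apply: near_eq_cvg; near=> h.
  by rewrite /= addrK scaler1 mulrC.
split; first by apply/cvg_ex; exists (derive_in A f x).
exact: cvg_lim q0.
Unshelve. all: by end_near. Qed.

Definition derive_ray J := derive_in `[0, +oo[ J.

Lemma is_derive_derive_ray J (x : R) : C_in 1 `[0, +oo[ J -> 0 < x -> is_derive x 1 J
  (derive_ray J x).
Proof.
move=> [dJ _] x0; apply: derive_in_nbhs.
  by apply: filterS (lt_nbhsr x0) => y y0 /=; rewrite in_itv/= andbT ltW.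
by apply: dJ; rewrite /= in_itv/= andbT ltW.
Qed.

(** Beyond [M'] >= 1 the factor t^alpha is at least 1, so the convergence of t^alpha exp (t) J'(t)
    bounds exp (t) |J'(t)|; on [0, [M']] the continuity of J' does. *)
Lemma derive_ray_ub J : kernel_assumption 2 J ->
  exists2 C : R, 0 <= C & forall t, 0 <= t -> `|derive_ray J t| <= C * expR (- t).
Proof.
move=> [[_ /= cD] [alpha alpha12 /cvg_ex[l cl]]].
have ll1 : `|l| < `|l| + 1 by rewrite ltrDl.
have [M [Mreal HM]] : \forall t \near +oo, `|t `^ alpha * expR t * derive_ray J t| <= `|l| + 1.
  exact: (@cvgr_norm_le _ _ _ _ _ _ _ cl _ ll1).
pose M' := Num.max M 1 + 1.
have M'1 : 1 <= M' by rewrite /M' (le_trans (_ : 1 <= Num.max M 1)) ?lerDl// le_max lexx orbT.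
have M'M : M < M' by rewrite /M' (le_lt_trans (_ : M <= Num.max M 1)) ?ltrDl// le_max lexx.
have M'0 : 0 <= M' := le_trans ler01 M'1.
have cN : {within `[0, M'], continuous (fun t => `|derive_ray J t|)}.
  have : {within `[0, M'], continuous (derive_ray J)}.
    by apply: continuous_subspaceW cD => t /=; rewrite !in_itv/= andbT => /andP[].
  move=> cJ t; apply: cvg_norm; exact: cJ.
have [c _ Hc] := EVT_max M'0 cN.
exists (`|l| + 1 + `|derive_ray J c| * expR M') => [|t t0].
  by rewrite !addr_ge0// mulr_ge0// expR_ge0.
rewrite mulrDl; have [tM|Mt] := leP t M'.
  rewrite ler_wpDl ?mulr_ge0 ?expR_ge0 ?addr_ge0//.
  rewrite (le_trans (Hc t _)) ?in_itv/= ?t0// -mulrA -expRD ler_peMr//.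
  by rewrite -expR0 ler_expR subr_ge0.
rewrite ler_wpDr ?mulr_ge0 ?expR_ge0//.
have t1 : 1 <= t := le_trans M'1 (ltW Mt).
rewrite expRN ler_pdivlMr ?expR_gt0// mulrC (le_trans _ (HM t _)) ?(lt_trans M'M)//.
rewrite !normrM ger0_norm ?powR_ge0// ger0_norm ?expR_ge0//
  -mulrA ler_peMl ?mulr_ge0 ?expR_ge0//.
rewrite -(powRr0 t) ler_powR//.
by rewrite (le_trans _ (ltW alpha12))// divr_ge0.
Qed.

(** With e(t) = C exp (- t), the function J - e is nondecreasing and J + e nonincreasing. Hence J -
    e is bounded above by (J + e)(1) on [1, +oo[ and converges, and so does J. *)
Lemma cvgy_of_derive_ray_ub J (C : R) : C_in 1 `[0, +oo[ J -> 0 <= C ->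
  (forall t, 0 <= t -> `|derive_ray J t| <= C * expR (- t)) ->
  cvg (J t @[t --> +oo]).
Proof.
move=> CJ C0 HC.
have dJ (x : R) : 0 < x -> is_derive x 1 J (derive_ray J x) by exact: is_derive_derive_ray.
pose e (t : R) : R := C * expR (- t).
have de (x : R) : is_derive x 1 e (- (C * expR (- x))).
  have H := is_derive_expRN x.
  rewrite (_ : e = C \*: (fun s => expR (- s)))//.
  by apply: is_derive_eq; rewrite /GRing.scale /= mulrN.
have dP (x : R) : 0 < x -> is_derive x 1 (J - e) (derive_ray J x + e x).
  move=> x0; have H1 := dJ _ x0; have H2 := de x.
  by apply: is_derive_eq; rewrite opprK.
have dQ (x : R) : 0 < x -> is_derive x 1 (J + e) (derive_ray J x - e x).
  by move=> x0; have H1 := dJ _ x0; have H2 := de x; apply: is_derive_eq.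
have Pnd x y : 1 <= x -> x <= y -> (J - e) x <= (J - e) y.
  move=> x1 xy; apply: (@ger0_derive1_le_oo _ (J - e) 0 (y + 1)) => //.
  - by move=> z; rewrite in_itv/= => /andP[z0 _]; have [] := dP _ z0.
  - move=> z; rewrite in_itv/= => /andP[z0 _]; rewrite derive1E.
    have [_ ->] := dP _ z0; rewrite -lerBlDr sub0r.
    by have := HC z (ltW z0); rewrite ler_norml => /andP[].
  - move=> z; rewrite inE/= in_itv/= => /andP[z0 _].
    by apply/differentiable_continuous/derivable1_diffP; have [] := dP _ z0.
  - by rewrite in_itv/= (lt_le_trans ltr01)//= (le_lt_trans xy)// ltrDl.
  - by rewrite in_itv/= (lt_le_trans ltr01 (le_trans x1 xy))//= ltrDl.
have Qni x y : 1 <= x -> x <= y -> (J + e) y <= (J + e) x.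
  move=> x1 xy; apply: (@ler0_derive1_le_oo _ (J + e) 0 (y + 1)) => //.
  - by move=> z; rewrite in_itv/= => /andP[z0 _]; have [] := dQ _ z0.
  - move=> z; rewrite in_itv/= => /andP[z0 _]; rewrite derive1E.
    have [_ ->] := dQ _ z0; rewrite subr_le0.
    by have := HC z (ltW z0); rewrite ler_norml => /andP[].
  - move=> z; rewrite inE/= in_itv/= => /andP[z0 _].
    by apply/differentiable_continuous/derivable1_diffP; have [] := dQ _ z0.
  - by rewrite in_itv/= (lt_le_trans ltr01 (le_trans x1 xy))//= ltrDl.
  - by rewrite in_itv/= (lt_le_trans ltr01)//= (le_lt_trans xy)// ltrDl.
(* Freezing the argument below 1 makes the function monotone on the whole line. *)
pose f (t : R) := (J - e) (Num.max 1 t).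
have fnd : nondecreasing_fun f.
  move=> x y xy; apply: Pnd; first by rewrite le_max lexx.
  by rewrite le_max2.
have fub : has_ubound (range f).
  exists ((J + e) 1) => _ [t _ <-].
  rewrite (le_trans _ (Qni 1 (Num.max 1 t) _ _)) ?le_max ?lexx//.
  rewrite /f !fctE lerD2l -subr_ge0 opprK addr_ge0// mulr_ge0// expR_ge0.
have cf := nondecreasing_cvgr fnd fub.
apply/cvg_ex; exists (sup (range f) + C * 0).
have ce : e t @[t --> +oo] --> C * 0 by apply: cvgMr; exact: cvgr_expR.
apply: cvg_trans (cvgD cf ce); apply: near_eq_cvg; near=> t.
have t1 : 1 <= t by near: t; exact: nbhs_pinfty_ge.
by rewrite /f !fctE (max_idPr t1) subrK.
Unshelve. all: by end_near. Qed.

End derive_in_interior.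

(** * Abel inversion for a derivative of variable sign *)

Section abel_inversion.
Context (R : realType).
Local Notation mu := (@lebesgue_measure R).
Variables (J : R -> R) (C c : R).
Hypothesis CJ : C_in 1 `[0, +oo[ J.
Hypothesis C0 : 0 <= C.
Hypothesis JC : forall t, 0 <= t -> `|derive_ray J t| <= C * expR (- t).
Hypothesis Jc : J t @[t --> +oo] --> c.

Let mI : measurable (`[0%R, +oo[%classic : set (measurableTypeR R)).
Proof. by []. Qed.

(** On the half-line J' = [g1] - [g2], where both terms are nonnegative by [JC], as [ge0_abel]
    demands. The extension of J' by 0 makes them measurable on the whole line. *)
Let Jp := (derive_ray J) \_ `[0, +oo[.
Let g2 (t : R) := C * expR (- t).
Let g1 (t : R) := Jp t + g2 t.

Let JpE t : 0 <= t -> Jp t = derive_ray J t.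
Proof. by move=> t0; rewrite /Jp patchE ifT// inE/= in_itv/= t0. Qed.

Let measurable_Jp : measurable_fun setT Jp.
Proof.
apply/(measurable_restrictT _ _).1 => //.
by apply: subspace_continuous_measurable_fun => //; case: CJ.
Qed.

Let measurable_g2 : measurable_fun setT g2.
Proof.
apply: measurable_funM => //; apply: (measurableT_comp (@measurable_expR R)).
exact: measurable_funN.
Qed.

Let measurable_g1 : measurable_fun setT g1.
Proof. exact: measurable_funD. Qed.

Let g2_ge0 t : 0 <= g2 t.
Proof. by rewrite mulr_ge0// expR_ge0. Qed.

Let g1_ge0 t : 0 <= g1 t.
Proof.
have [t0|t0] := leP 0 t.
  by rewrite /g1 JpE// -lerBlDr sub0r; have := JC t0; rewrite ler_norml => /andP[].
by rewrite /g1 /Jp patchE ifF ?add0r// memNset//= in_itv/= leNgt t0.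
Qed.

Let integrable_g2 (a : R) : 0 < a ->
  mu.-integrable `[0, +oo[ (EFin \o (fun s => g2 (a * cosh s))).
Proof.
move=> a0; apply/integrableP; split.
  apply/measurable_EFinP; apply: measurable_funTS; apply: (measurableT_comp measurable_g2).
  by apply: measurable_funM => //; exact: measurable_cosh.
under eq_integral do rewrite /= ger0_norm//.
rewrite /g2; under eq_integral do rewrite EFinM -mulNr.
rewrite ge0_integralZl//.
- by rewrite -M0E// ltry.
- by apply: measurable_funTS; exact: (measurableT_comp (@measurable_expR_cosh R)
    (measurable_pair1 a)).
Qed.

Let integrable_Jp (a : R) : 0 < a ->
  mu.-integrable `[0, +oo[ (EFin \o (fun s => Jp (a * cosh s))).
Proof.
move=> a0; apply: (le_integrable mI _ _ (integrable_g2 a0)).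
  apply/measurable_EFinP; apply: measurable_funTS; apply: (measurableT_comp measurable_Jp).
  by apply: measurable_funM => //; exact: measurable_cosh.
move=> s _ /=; rewrite lee_fin.
have a1 : 0 <= a * cosh s by rewrite mulr_ge0// ltW// cosh_gt0.
by rewrite JpE// [leRHS]ger0_norm// JC.
Qed.

Let abel_g (g : R -> R) (a : R) := \int[mu]_(s in `[0, +oo[) g (a * cosh s).

Let abelA_formulaE a : 0 < a ->
  abelA_formula J a = - (2 / pi) * (a * abel_g g1 a - a * abel_g g2 a).
Proof.
move=> a0; rewrite /abelA_formula.
have -> : \int[mu]_(s in `[0, +oo[) derive_in `[0, +oo[ J (a * cosh s) =
    abel_g g1 a - abel_g g2 a.
  rewrite /abel_g /g1 RintegralD//; [|exact: integrable_Jp|exact: integrable_g2].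
  rewrite addrK; apply: eq_Rintegral => s _; rewrite JpE// mulr_ge0 ?ltW//.
  exact: cosh_gt0.
by rewrite -mulrBr mulrA; congr (_ * _); rewrite !mulNr -!mulrA (mulrC a).
Qed.

Variable r : R.
Hypothesis r0 : 0 < r.

Let rc u : 0 < r * cosh u.
Proof. by rewrite mulr_gt0// cosh_gt0. Qed.

Let integral_abel_g (g : R -> R) : measurable_fun setT g ->
  (forall t, 0 <= g t) ->
  (forall a, 0 < a -> mu.-integrable `[0, +oo[ (EFin \o (fun s => g (a * cosh s)))) ->
  (\int[mu]_(u in `[0%R, +oo[) (r * cosh u * abel_g g (r * cosh u))%:E =
   (pi / 2)%:E * \int[mu]_(t in `[0%R, +oo[) (g (t + r))%:E)%E.
Proof.
move=> mg g0 ig; rewrite -ge0_abel//; apply: eq_integral => u _.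
under [RHS]eq_integral do rewrite EFinM.
have ru := rc u.
rewrite ge0_integralZl//.
- rewrite EFinM; congr (_ * _)%E.
  rewrite /abel_g /Rintegral fineK//.
  by have := integrable_fin_num mI (ig _ ru).
- have := measurable_int _ (ig _ ru); exact.
- by move=> s _; rewrite lee_fin.
- by rewrite lee_fin ltW.
Qed.

Let measurable_abel (g : R -> R) : measurable_fun setT g -> (forall t, 0 <= g t) ->
  measurable_fun setT (fun u => r * cosh u * abel_g g (r * cosh u)).
Proof.
move=> mg g0; apply: measurable_funM.
  by apply: measurable_funM => //; exact: measurable_cosh.
apply: (measurableT_comp (@fine_measurable R _ measurableT)).
apply: (measurable_fun_integral_in (f := fun z => (g (r * cosh z.1 * cosh z.2))%:E) mI).
- apply/measurable_EFinP; apply: (measurableT_comp mg); apply: measurable_funM.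
    apply: measurable_funM => //.
    by apply: (measurableT_comp (@measurable_cosh R)); exact: measurable_fst.
  by apply: (measurableT_comp (@measurable_cosh R)); exact: measurable_snd.
- by move=> z; rewrite lee_fin.
Qed.

Let integral_g2 : (\int[mu]_(t in `[0%R, +oo[) (g2 (t + r))%:E = (g2 r)%:E)%E.
Proof.
transitivity (\int[mu]_(t in `[0%R, +oo[) ((g2 r)%:E * (expR (- 1 * t))%:E))%E.
  apply: eq_integral => t _; rewrite -EFinM /g2; congr EFin.
  by rewrite -mulrA -expRD mulN1r opprD addrC.
rewrite ge0_integralZl//.
- by rewrite integral_expRN_0y// invr1 mule1.
- by apply/measurable_EFinP; apply: measurable_funTS; exact: measurable_expR_scale.
- by rewrite lee_fin.
Qed.

Let continuous_Jp (y : R) : 0 < y -> {for y, continuous Jp}.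
Proof.
move=> y0; case: CJ => _ /= /continuous_within_itvcyP[cJ _].
have cy : {for y, continuous (derive_ray J)} by apply: cJ; rewrite in_itv/= y0.
rewrite /prop_for /continuous_at (JpE (ltW y0)); apply: cvg_trans cy; apply: near_eq_cvg.
near=> t; rewrite JpE// ltW//; near: t; exact: lt_nbhsr.
Unshelve. all: by end_near. Qed.

Let integral_g1 :
  (\int[mu]_(t in `[0%R, +oo[) (g1 (t + r))%:E = (c - J r + g2 r)%:E)%E.
Proof.
(* As [g2] has the derivative - [g2], the function J - [g2] is a primitive of [g1]. *)
pose F (t : R) : R := J (t + r) - g2 (t + r).
have dshift (t : R) : is_derive t 1 (fun t => t + r) (1 : R).
  rewrite (_ : (fun _ => _) = (id + cst r))//.
  by apply: is_derive_eq; rewrite addr0.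
have dg2 (x : R) : is_derive x 1 g2 (- g2 x).
  have H := is_derive_expRN x.
  rewrite {1}(_ : g2 = C \*: (fun s => expR (- s)))//.
  by apply: is_derive_eq; rewrite /GRing.scale /= mulrN.
have dF (t : R) : 0 <= t -> is_derive t 1 F (g1 (t + r)).
  move=> t0; have tr : 0 < t + r by rewrite ltr_wpDl.
  have H1 := @is_derive1_comp R J (fun t => t + r) t _ _ (is_derive_derive_ray CJ tr)
    (dshift t).
  have H2 := @is_derive1_comp R g2 (fun t => t + r) t _ _ (dg2 (t + r)) (dshift t).
  rewrite (_ : F = (J \o (fun t => t + r)) - (g2 \o (fun t => t + r)))//.
  by apply: is_derive_eq; rewrite !mulr1 opprK /g1 JpE// ltW.
have cshift : continuous (fun t : R => t + r).
  by move=> x; apply: cvgD; [exact: cvg_id|exact: cvg_cst].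
have cg (t : R) : 0 <= t -> {for t, continuous (fun t => g1 (t + r))}.
  move=> t0; have tr : 0 < t + r by rewrite ltr_wpDl.
  apply: (@continuous_comp _ _ _ (fun t => t + r) g1); first exact: cshift.
  apply: cvgD; first exact: continuous_Jp.
  by apply/differentiable_continuous/derivable1_diffP; have [] := dg2 (t + r).
have shifty : t + r @[t --> +oo] --> (+oo : set_system R).
  apply/cvgryPge => A; near=> t; rewrite -lerBlDr; near: t.
  by apply: nbhs_pinfty_ge; exact: num_real.
rewrite (@ge0_continuous_FTC2y _ _ F _ c)//.
- by rewrite /F add0r -EFinB opprB addrA addrAC.
- apply/continuous_within_itvcyP; split.
    by move=> t; rewrite in_itv/= andbT => t0; apply: cg; exact: ltW.
  by apply: cvg_at_right_filter; exact: cg.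
- rewrite -[X in _ --> X]subr0; apply: cvgB.
    exact: (@cvg_comp _ _ _ (fun t => t + r) J _ _ _ shifty Jc).
  apply: (@cvg_comp _ _ _ (fun t => t + r) g2 _ _ _ shifty).
  by rewrite -(mulr0 C); apply: cvgMr; exact: cvgr_expR.
- by move=> t t0; have [] := dF t (ltW t0).
- apply: cvg_at_right_filter; apply/differentiable_continuous/derivable1_diffP.
  by have [] := dF 0 (lexx _).
- move=> t; rewrite in_itv/= andbT => t0; rewrite derive1E.
  by have [] := dF t (ltW t0).
Unshelve. all: by end_near. Qed.

Let integrable_abel (g : R -> R) l : measurable_fun setT g ->
  (forall t, 0 <= g t) ->
  (forall a, 0 < a -> mu.-integrable `[0, +oo[ (EFin \o (fun s => g (a * cosh s)))) ->
  (\int[mu]_(t in `[0%R, +oo[) (g (t + r))%:E = l%:E)%E ->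
  mu.-integrable `[0, +oo[ (EFin \o (fun u => r * cosh u * abel_g g (r * cosh u))).
Proof.
move=> mg g0 ig gl; apply/integrableP; split.
  by apply/measurable_EFinP; apply: measurable_funTS; exact: measurable_abel.
under eq_integral => u _.
  rewrite /= ger0_norm; last first.
    by rewrite mulr_ge0 ?(ltW (rc u))// Rintegral_ge0.
  over.
by rewrite integral_abel_g// gl -EFinM ltry.
Qed.

Let ig1 a : 0 < a -> mu.-integrable `[0, +oo[ (EFin \o (fun s => g1 (a * cosh s))).
Proof.
move=> a0; rewrite (_ : EFin \o _ =
  (EFin \o (fun s => Jp (a * cosh s)%R)) \+ (EFin \o (fun s => g2 (a * cosh s)%R)))%E//.
by apply: integrableD => //; [exact: integrable_Jp|exact: integrable_g2].
Qed.

Let iB1 := integrable_abel measurable_g1 g1_ge0 ig1 integral_g1.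
Let iB2 := integrable_abel measurable_g2 g2_ge0 integrable_g2 integral_g2.

Lemma integrable_abelA :
  mu.-integrable `[0, +oo[ (EFin \o (fun u => abelA_formula J (r * cosh u))).
Proof.
rewrite (_ : EFin \o _ = (fun u => (- (2 / pi))%:E *
  ((EFin \o (fun u => r * cosh u * abel_g g1 (r * cosh u))%R) \-
   (EFin \o (fun u => r * cosh u * abel_g g2 (r * cosh u))%R)) u))%E.
  by apply: integrableZl => //; exact: integrableB.
by apply/funext => u /=; rewrite abelA_formulaE.
Qed.

(** The factor 2 / pi of A cancels the pi / 2 of [ge0_abel], and the contributions of [g2] cancel
    each other. What remains is minus the integral of J' over [r, +oo[. *)
Lemma abel_inversion :
  \int[mu]_(u in `[0, +oo[) abelA_formula J (r * cosh u) = J r - c.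
Proof.
transitivity (\int[mu]_(u in `[0, +oo[) (- (2 / pi) *
  (r * cosh u * abel_g g1 (r * cosh u) - r * cosh u * abel_g g2 (r * cosh u)))).
  by apply: eq_Rintegral => u _; rewrite abelA_formulaE.
have iB := integrableB mI iB1 iB2.
rewrite RintegralZl// RintegralB// /Rintegral.
rewrite !integral_abel_g//.
rewrite integral_g1 integral_g2 /= -mulrBr addrK mulrA mulNr.
have p0 : pi != 0 :> R by rewrite gt_eqF// pi_gt0.
by rewrite (mulrA (2 / pi)) divfK// divff// mulN1r opprB.
Qed.

End abel_inversion.

(** * From a uniform bound on [0, 1] to the L1 norm *)

Section L1_error.
Context (R : realType).
Local Notation mu := (@lebesgue_measure R).
Local Notation T n := (n.-tuple (measurableTypeR R)).

(* The Green function of - Delta + 1 up to a constant, normalized so that its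
   integral over R^n is the surface area of the unit sphere. *)
Definition unit_green n (r : R) : R :=
  match n with
  | 1 => expR (- r)
  | 2 => M0 r
  | _ => expR (- r) * r `^ (-1)
  end.

Lemma measurable_unit_green n : measurable_fun setT (unit_green n).
Proof.
have me : measurable_fun setT (fun r : R => expR (- r)).
  by apply: (measurableT_comp (@measurable_expR R)); exact: measurable_funN.
case: n => [|[|[|n]]] //=; [|exact: measurable_M0|].
- by apply: measurable_funM => //; exact: measurable_powR.
- by apply: measurable_funM => //; exact: measurable_powR.
Qed.

Lemma M0_ge0 (r : R) : 0 <= M0 r.
Proof. by apply: Rintegral_ge0 => s _; exact: expR_ge0. Qed.

Lemma unit_green_ge0 n r : 0 <= unit_green n r.
Proof.
by case: n => [|[|[|n]]] /=; rewrite ?M0_ge0 ?mulr_ge0 ?expR_ge0 ?powR_ge0.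
Qed.

Lemma green_kcoef1 j r : green 1 j.+1 r / kcoef 1 j = expR (- r) ^+ j.+1 :> R.
Proof.
rewrite /green /kcoef mulrAC divff ?mul1r ?mulf_neq0 ?invr_eq0 ?pnatr_eq0//.
by rewrite mulNr mulrC -mulNr -expRM_natr.
Qed.

Lemma green_kcoef2 j r : green 2 j.+1 r / kcoef 2 j = M0 (j.+1%:R * r) :> R.
Proof.
rewrite /green /kcoef mulrAC divff ?mul1r//.
by rewrite mulf_neq0 ?expf_neq0 ?invr_eq0 ?mulf_neq0 ?pnatr_eq0// gt_eqF// pi_gt0.
Qed.

Lemma green_kcoef3 j r : 0 < r ->
  green 3 j.+1 r / kcoef 3 j = expR (- r) ^+ j.+1 / r :> R.
Proof.
move=> r0; rewrite /green /kcoef.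
have -> : expR (- j.+1%:R * r) = expR (- r) ^+ j.+1.
  by rewrite -expRM_natr !mulNr mulrC.
have p0 : pi != 0 :> R by rewrite gt_eqF// pi_gt0.
have j0 : j.+1%:R != 0 :> R by rewrite pnatr_eq0.
have rn0 : r != 0 by rewrite gt_eqF.
by move: (_ ^+ j.+1) (pi : R) p0 (j.+1%:R : R) j0 => E p p0 i i0; field; rewrite rn0 p0 i0.
Qed.

Lemma measurable_kernel_sum n N alpha : measurable_fun setT (@kernel_sum R n N alpha).
Proof.
rewrite /kernel_sum; apply: measurable_sum => j; apply: measurable_funM => //.
have mE (a : R) : measurable_fun setT (fun x : T n => expR (a * enorm x)).
  by apply: (measurableT_comp (measurable_expR_scale _)); exact: measurable_enorm.
case: n mE => [|[|[|[|n]]]] mE //=.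
- exact: measurable_funM.
- apply: measurable_funM => //; apply: (measurableT_comp (@measurable_M0 R)).
  by apply: measurable_funM => //; exact: measurable_enorm.
- apply: measurable_funM => //.
  under eq_fun => x do rewrite -powR_inv1 ?mulr_ge0 ?pi_ge0 ?enorm_ge0//.
  apply: measurable_funM => //; apply: (measurableT_comp (measurable_powR _)).
  by apply: measurable_funM => //; exact: measurable_enorm.
Qed.

(** Radial integration of the indicator of {0}: a single radius is negligible. Since the Green
    functions for n = 2 and n = 3 are singular at the origin, pointwise estimates are made only away
    from it. *)
Lemma ae_enorm_gt0 n : (0 < n)%N -> {ae lebesgue R n, forall x, 0 < enorm x}.
Proof.
move=> n0; pose g (r : R) : \bar R := (\1_[set 0] r)%:E.
have mg : measurable_fun setT g by apply/measurable_EFinP; exact: measurable_indic.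
have : (\int[lebesgue R n]_x g (enorm x) = 0)%E.
  rewrite ge0_integral_radial//; last by move=> r; rewrite lee_fin.
  rewrite -integral_itv_obnd_cbnd; last first.
    apply: measurable_funTS; apply: emeasurable_funM => //.
    by apply/measurable_EFinP; exact: exprn_measurable.
  rewrite integral0_eq ?mule0// => r /=; rewrite in_itv/= andbT => r0.
  by rewrite /g indicE memNset ?mul0e//= => r00; rewrite r00 ltxx in r0.
have mZ : measurable (@enorm R n @^-1` [set 0]).
  by rewrite -[X in measurable X]setTI; apply: measurable_enorm.
rewrite (eq_integral (fun x => (\1_(@enorm R n @^-1` [set 0]) x)%:E)); last first.
  by move=> x _; rewrite /g !indicE.
rewrite integral_indic// setIT => Z0.
exists (@enorm R n @^-1` [set 0]); split => // x /= /negP.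
by rewrite -leNgt => x0; apply/eqP; rewrite eq_le x0 enorm_ge0.
Qed.

(** Radial integration leaves the integrals of exp (- r), r M0(r) and r exp (- r) over the
    half-line, each equal to 1. *)
Lemma integral_unit_green n : n \in [:: 1; 2; 3]%N ->
  (\int[lebesgue R n]_x (unit_green n (enorm x))%:E =
   (2 * pi `^ (n%:R / 2) / Gamma (n%:R / 2))%:E)%E.
Proof.
move=> n123; have n0 : (0 < n)%N by move: n123; rewrite !inE => /or3P[] /eqP ->.
rewrite (@ge0_integral_radial R n (fun r => (unit_green n r)%:E))//; last 2 first.
- by apply/measurable_EFinP; exact: measurable_unit_green.
- by move=> r; rewrite lee_fin unit_green_ge0.
rewrite -[RHS]mule1; congr (_ * _)%E.
move: n123; rewrite !inE => /or3P[] /eqP -> /=.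
- transitivity (1^-1 : R)%:E; last by rewrite invr1.
  rewrite -integral_expRN_0y//.
  by apply: eq_integral => r _; rewrite mule1 mulN1r.
- exact: integral_M0.
- transitivity (1 ^- 2 : R)%:E; last by rewrite expr1n invr1.
  rewrite -integral_id_expRN_0y//.
  apply: eq_integral => r; rewrite inE/= in_itv/= andbT => r0.
  rewrite -EFinM; congr EFin; rewrite powR_inv1// mulN1r -mulrA mulrC; congr (_ * _).
  by have [->|rn0] := eqVneq r 0; rewrite ?expr0n ?mulr0// expr2 mulrA mulVf// mul1r.
Qed.

Lemma Lnorm1_radial_ub n (K KN : T n -> R) (S : R) : n \in [:: 1; 2; 3]%N ->
  0 <= S -> measurable_fun setT K -> measurable_fun setT KN ->
  {ae lebesgue R n, forall x, 0 < enorm x -> `|K x - KN x| <= S * unit_green n (enorm x)} ->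
  (Lnorm (lebesgue R n) 1 (fun x => (K x - KN x)%:E) <=
   (2 * pi `^ (n%:R / 2) / Gamma (n%:R / 2) * S)%:E)%E.
Proof.
move=> n123 S0 mK mKN KS; rewrite Lnorm1.
have n0 : (0 < n)%N by move: n123; rewrite !inE => /or3P[] /eqP ->.
have mg : measurable_fun setT (fun x : T n => (unit_green n (enorm x))%:E).
  apply/measurable_EFinP; apply: (measurableT_comp (@measurable_unit_green n)).
  exact: measurable_enorm.
rewrite mulrC EFinM -integral_unit_green// -ge0_integralZl//; last first.
  by move=> x _; rewrite lee_fin unit_green_ge0.
apply: ae_ge0_le_integral => //.
- apply: measurableT_comp => //; apply/measurable_EFinP; exact: measurable_funB.
- by move=> x _; rewrite mule_ge0// lee_fin unit_green_ge0.
- by apply: emeasurable_funM.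
apply: filterS2 KS (ae_enorm_gt0 n0) => x + x0 _; move=> /(_ x0).
by rewrite -EFinM lee_fin.
Qed.

End L1_error.

(** * From the profile on [0, 1] to the kernel *)

Section kernel_error.
Context (R : realType).
Local Notation mu := (@lebesgue_measure R).
Local Notation T n := (n.-tuple (measurableTypeR R)).

Lemma integrable_expR_cosh (a : R) : 0 < a ->
  mu.-integrable `[0, +oo[ (EFin \o (fun s => expR (- a * cosh s))).
Proof.
move=> a0; apply/integrableP; split.
  apply: measurable_funTS.
  exact: (measurableT_comp (@measurable_expR_cosh R) (measurable_pair1 a)).
under eq_integral do rewrite /= ger0_norm ?expR_ge0//.
exact: integral_expR_cosh_lty.
Qed.

(** Brings a sum of two-dimensional kernels under the integral of [M0], where it is a polynomial in
    exp (- r cosh s). *)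
Lemma sum_M0 (B : nat -> R) (r : R) N : 0 < r ->
  mu.-integrable `[0, +oo[
    (EFin \o (fun s => \sum_(0 <= j < N) B j * expR (- (j.+1%:R * r) * cosh s))) /\
  \sum_(0 <= j < N) B j * M0 (j.+1%:R * r) =
  \int[mu]_(s in `[0, +oo[) \sum_(0 <= j < N) B j * expR (- (j.+1%:R * r) * cosh s).
Proof.
move=> r0; have mI : measurable (`[0, +oo[%classic : set (measurableTypeR R)) by [].
elim: N => [|N [iN sN]].
  rewrite (_ : EFin \o _ = cst 0%E); last by apply/funext => s /=; rewrite big_geq.
  split; first exact: integrable0.
  rewrite big_geq//; under eq_Rintegral do rewrite big_geq//.
  by rewrite Rintegral_cst// mul0r.
have iE : mu.-integrable `[0, +oo[
    (EFin \o (fun s => B N * expR (- (N.+1%:R * r) * cosh s))).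
  rewrite (_ : EFin \o _ = (fun s => (B N)%:E * (expR (- (N.+1%:R * r) * cosh s))%:E)%E)//.
  by apply: integrableZl => //; apply: integrable_expR_cosh; rewrite mulr_gt0.
split.
  rewrite (_ : EFin \o _ = ((EFin \o
      (fun s => \sum_(0 <= j < N) B j * expR (- (j.+1%:R * r) * cosh s))%R) \+
    (EFin \o (fun s => B N * expR (- (N.+1%:R * r) * cosh s))%R))%E).
    exact: integrableD.
  by apply/funext => s /=; rewrite big_nat_recr//= EFinD.
rewrite big_nat_recr//= sN.
under [in RHS]eq_Rintegral do rewrite big_nat_recr//=.
rewrite RintegralD//; congr (_ + _).
by rewrite RintegralZl//; apply: integrable_expR_cosh; rewrite mulr_gt0.
Qed.

(** If c were nonzero, |K| would be at least |c| / 2 almost everywhere outside some disc, on a set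
    of infinite area. *)
Lemma radial_integrable_lim0 (J : R -> R) (K : T 2 -> R) (c : R) :
  (lebesgue R 2).-integrable setT (EFin \o K) ->
  {ae lebesgue R 2, forall x, K x = J (enorm x)} ->
  J t @[t --> +oo] --> c -> c = 0.
Proof.
move=> /integrableP[mK Koo] KJ Jc; apply: contrapT => /eqP c0.
have c2 : 0 < `|c| / 2 by rewrite divr_gt0// normr_gt0.
have [M [_ HM]] : \forall t \near +oo, `|c| / 2 <= `|J t|.
  apply: (cvgr_norm_ge _ Jc); rewrite ltr_pdivrMr// ltr_pMr ?normr_gt0//.
  by rewrite ltr1n.
(* Taking [r0] >= 1 allows the radial weight r to be bounded below by 1. *)
pose r0 := Num.max 1 M + 1.
pose g (r : R) : \bar R := (\1_(`[r0, +oo[%classic : set R) r)%:E.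
have mg : measurable_fun setT g by apply/measurable_EFinP; exact: measurable_indic.
have : (\int[lebesgue R 2]_x ((`|c| / 2)%:E * g (enorm x)) < +oo)%E.
  apply: le_lt_trans Koo; apply: ae_ge0_le_integral => //.
  - by move=> x _; rewrite mule_ge0// lee_fin// ltW.
  - apply: measurable_funeM; apply: (measurableT_comp mg); exact: measurable_enorm.
  - exact: measurableT_comp.
  - apply: filterS KJ => x Kx _ /=; rewrite Kx /g indicE.
    case: (boolP (_ \in _)) => [|_]; last by rewrite mule0.
    rewrite inE/= in_itv/= andbT mule1 lee_fin => xr; apply: HM.
    by rewrite (lt_le_trans _ xr)// /r0 (le_lt_trans (_ : M <= Num.max 1 M)) ?ltrDl//
      le_max lexx orbT.
rewrite ge0_integralZl//; last 2 first.
- apply: (measurableT_comp mg); exact: measurable_enorm.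
- by move=> x _; rewrite lee_fin.
rewrite ge0_integral_radial//; last by move=> r; rewrite lee_fin.
rewrite Gamma1 divff// powRr1 ?pi_ge0// divr1.
suff -> : (\int[mu]_(r in `[0%R, +oo[) (g r * (r ^+ 1)%:E) = +oo)%E.
  by rewrite !gt0_muley ?lte_fin// mulr_gt0// pi_gt0.
apply/eqP; rewrite -leye_eq.
have r01 : 1 <= r0 by rewrite /r0 (le_trans (_ : 1 <= Num.max 1 M)) ?lerDl// le_max lexx.
apply: (@le_trans _ _ (\int[mu]_(r in `[0%R, +oo[) g r)%E).
  rewrite integral_indic// setIidl.
    by rewrite [leRHS](lebesgue_measure_itv `[r0, +oo[) /= ltry.
  by move=> x /=; rewrite !in_itv/= !andbT; apply: le_trans; rewrite (le_trans ler01).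
apply: ge0_le_integral => //.
- by move=> r _; rewrite lee_fin.
- exact: measurable_funTS.
- apply: measurable_funTS; apply: emeasurable_funM => //.
  by apply/measurable_EFinP; exact: exprn_measurable.
- move=> r _; rewrite /g indicE; case: (boolP (_ \in _)) => [|_]; last by rewrite mul0e.
  rewrite inE/= in_itv/= andbT mul1e expr1 lee_fin; exact: le_trans.
Qed.

(** The shape common to the three dimensions: v is J(r) for n = 1 and r J(r) for n = 3, with l = exp
    (- r); for n = 2 it is A(r cosh s), with l = exp (- r cosh s), under the integral over s. In
    each case v / l is h(l). *)
Lemma scaled_error (B : nat -> R) N (v l S : R) : 0 < l ->
  `|v / l - \sum_(0 <= j < N) B j * l ^+ j| <= S ->
  `|v - \sum_(0 <= j < N) B j * l ^+ j.+1| <= S * l.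
Proof.
move=> l0 H; rewrite -ler_pdivrMr// -[X in _ / X](gtr0_norm l0) -normf_div mulrBl.
rewrite mulr_suml; under eq_bigr do rewrite exprSr mulrA mulfK ?gt_eqF//.
exact: H.
Qed.

Lemma kernel_pointwise_error n (J : R -> R) (B : nat -> R) N (S r : R) :
  n \in [:: 1; 2; 3]%N -> kernel_assumption n J ->
  (n = 2%N -> J t @[t --> +oo] --> (0 : R)) ->
  (forall l, 0 < l <= 1 ->
    `|profile n J l - \sum_(0 <= j < N.+1) B j * l ^+ j| <= S) ->
  0 < r ->
  `|J r - \sum_(1 <= j < N.+2) B j.-1 / kcoef n j.-1 * green n j r| <=
  S * unit_green n r.
Proof.
move=> n123 kJ J0 HS r0; rewrite big_add1 /=.
have l01 (t : R) : 0 < t -> 0 < expR (- t) <= 1.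
  by move=> t0; rewrite expR_gt0/= -expR0 ler_expR oppr_le0 ltW.
under eq_bigr do rewrite mulrAC -mulrA.
have l0 t : expR (- t) != 0 :> R by rewrite gt_eqF// expR_gt0.
move: n123 kJ J0 HS; rewrite !inE => /or3P[] /eqP -> kJ J0 HS.
- under eq_bigr do rewrite green_kcoef1.
  apply: scaled_error; first exact: expR_gt0.
  by have := HS _ (l01 _ r0); rewrite /= (negbTE (l0 r)) expRK opprK.
- have [C C0 JC] := derive_ray_ub kJ; have CJ : C_in 1 `[0, +oo[ J by case: kJ.
  have {}J0 := J0 erefl.
  have mI : measurable (`[0, +oo[%classic : set (measurableTypeR R)) by [].
  have iA := integrable_abelA CJ C0 JC J0 r0.
  have JE := abel_inversion CJ C0 JC J0 r0.
  have [iB BE] := sum_M0 B N.+1 r0.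
  under eq_bigr do rewrite green_kcoef2.
  (* As J vanishes at infinity, [JE] writes J r - 0 as an integral over s, and the error is
     estimated under the integral sign. *)
  rewrite BE -[X in `|X - _|]subr0 -JE -RintegralB//.
  have iS := integrable_expR_cosh r0.
  rewrite -[unit_green 2 r]/(M0 r) /M0 -RintegralZl//.
  have iAB := integrableB mI iA iB.
  rewrite (le_trans (le_normr_Rintegral mI iAB))//; apply: le_Rintegral => //.
  + exact: (integrable_norm iAB).
  + rewrite (_ : EFin \o _ = (fun s => S%:E * (expR (- r * cosh s))%:E)%E)//.
    exact: integrableZl.
  move=> s _; have t0 : 0 < r * cosh s by rewrite mulr_gt0// cosh_gt0.
  under eq_bigr => j _.
    rewrite (_ : - (j.+1%:R * r) * cosh s = - (r * cosh s) * j.+1%:R); last first.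
      by rewrite !mulNr -mulrA mulrC.
    rewrite expRM_natr; over.
  rewrite mulNr; apply: scaled_error; first exact: expR_gt0.
  have := HS _ (l01 _ t0); rewrite /= (negbTE (l0 _)) expRK opprK.
  by rewrite /abelA gt_eqF.
- under eq_bigr do rewrite green_kcoef3// mulrA.
  rewrite -mulr_suml -[J r](mulKf (lt0r_neq0 r0)) mulrC -mulrBl normrM.
  rewrite normfV (gtr0_norm r0) /= powR_inv1 ?(ltW r0)// mulrA ler_pM2r ?invr_gt0//.
  apply: scaled_error; first exact: expR_gt0.
  have := HS _ (l01 _ r0); rewrite /= (negbTE (l0 r)) expRK opprK ifF//.
  by apply/negbTE; rewrite lt_eqF// -expR0 ltr_expR oppr_lt0.
Qed.

Lemma kernel_sum_error n (J : R -> R) (K : T n -> R) (B : nat -> R) N (S : R) :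
  n \in [:: 1; 2; 3]%N -> (lebesgue R n).-integrable setT (EFin \o K) ->
  {ae lebesgue R n, forall x, K x = J (enorm x)} -> kernel_assumption n J ->
  (forall l, 0 < l <= 1 ->
    `|profile n J l - \sum_(0 <= j < N.+1) B j * l ^+ j| <= S) ->
  (Lnorm (lebesgue R n) 1 (fun x => (K x -
     kernel_sum n N (fun j => B j.-1 / kcoef n j.-1) x)%:E) <=
   (2 * pi `^ (n%:R / 2) / Gamma (n%:R / 2) * S)%:E)%E.
Proof.
move=> n123 iK KJ kJ HS; apply: Lnorm1_radial_ub => //.
- by apply: le_trans (HS 1 _); rewrite ?ltr01 ?lexx.
- by have /integrableP[/measurable_EFinP] := iK.
- exact: measurable_kernel_sum.
apply: (filterS _ KJ) => x Kx x0; rewrite Kx; apply: kernel_pointwise_error => //.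
move=> n2; subst n; have [C C0 JC] := derive_ray_ub kJ.
have CJ : C_in 1 `[0, +oo[ J by case: kJ.
have /cvg_ex[c Jc] := cvgy_of_derive_ray_ub CJ C0 JC.
by have c0 := radial_integrable_lim0 iK KJ Jc; rewrite c0 in Jc.
Qed.

End kernel_error.

(** * Bernstein polynomials *)

Section modulus.
Context (R : realType).
Implicit Types (g h : R -> R) (x l eta : R).

Lemma modulus_ub g M eta l1 l2 : (forall l, l \in `[0, 1] -> `|g l| <= M) ->
  l1 \in `[0, 1] -> l2 \in `[0, 1] -> `|l1 - l2| <= eta ->
  `|g l1 - g l2| <= modulus g eta.
Proof.
move=> gM l1I l2I l12; apply: sup_ubound; last by exists l1, l2.
exists (M + M) => _ [x [y [xI yI _ ->]]].
by rewrite (le_trans (ler_normB _ _))// lerD// gM.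
Qed.

(** Two points at distance at most k eta are joined inside [0, 1] by k equal steps, each of length
    at most eta. *)
Lemma modulus_chain g (w eta : R) :
  (forall l1 l2, l1 \in `[0, 1] -> l2 \in `[0, 1] -> `|l1 - l2| <= eta ->
     `|g l1 - g l2| <= w) ->
  forall k l1 l2, l1 \in `[0, 1] -> l2 \in `[0, 1] -> `|l1 - l2| <= k%:R * eta ->
  `|g l1 - g l2| <= k%:R * w.
Proof.
move=> gw; elim=> [|k IH] l1 l2 l1I l2I.
  by rewrite mul0r normr_le0 subr_eq0 => /eqP ->; rewrite subrr normr0 mul0r.
move=> l12; pose l3 := l1 + (l2 - l1) / k.+1%:R.
have k0 : 0 < k.+1%:R :> R by [].
have k1 : 0 < (k.+1%:R^-1 : R) <= 1.
  by rewrite invr_gt0 k0/= invf_le1// ler1n.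
have l3I : l3 \in `[0, 1].
  rewrite /l3; move: (k.+1%:R^-1) k1 l1I l2I => c /andP[c0 c1].
  rewrite !in_itv/= => /andP[? ?] /andP[? ?]; nra.
have -> : g l1 - g l2 = (g l1 - g l3) + (g l3 - g l2) by rewrite addrA subrK.
rewrite (le_trans (ler_normD _ _))// -natr1 mulrDl addrC mul1r.
rewrite lerD//.
  apply: IH => //.
  have -> : l3 - l2 = (l1 - l2) * (k%:R / k.+1%:R).
    by rewrite /l3 -natr1; field; rewrite natr1 gt_eqF.
  rewrite normrM (@ger0_norm _ (_ / _)) ?divr_ge0// mulrA ler_pdivrMr//.
  by rewrite mulrC -mulrA ler_wpM2l// mulrC.
apply: gw => //.
have -> : l1 - l3 = (l1 - l2) / k.+1%:R.
  by rewrite /l3; field; rewrite gt_eqF.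
by rewrite normrM (@ger0_norm _ (_^-1)) ?invr_ge0// ler_pdivrMr// mulrC.
Qed.

Lemma modulus_linear g (w eta : R) : 0 < eta ->
  (forall l1 l2, l1 \in `[0, 1] -> l2 \in `[0, 1] -> `|l1 - l2| <= eta ->
     `|g l1 - g l2| <= w) ->
  forall l1 l2, l1 \in `[0, 1] -> l2 \in `[0, 1] ->
  `|g l1 - g l2| <= (1 + `|l1 - l2| / eta) * w.
Proof.
move=> eta0 gw l1 l2 l1I l2I.
have w0 : 0 <= w by apply: le_trans (gw _ _ l1I l1I _); rewrite ?normr_ge0// subrr normr0 ltW.
have q0 : 0 <= `|l1 - l2| / eta by rewrite divr_ge0// ltW.
rewrite (le_trans (modulus_chain gw (k := (Num.truncn (`|l1 - l2| / eta)).+1) l1I l2I _))//.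
  by rewrite -ler_pdivrMr// ltW// truncnS_gt.
by rewrite ler_wpM2r// -natr1 addrC lerD2l truncn_le.
Qed.

End modulus.

Section bernstein.
Context (R : realType).
Implicit Types (h : R -> R) (f : nat -> R) (x l : R).

Definition bernstein_sum N f x : R :=
  \sum_(i < N.+1) f i * ('C(N, i)%:R * x ^+ i * (1 - x) ^+ (N - i)).

Lemma bin_split N i k : (i <= N)%N -> (k <= N - i)%N ->
  ('C(N, i + k) * 'C(i + k, i) = 'C(N, i) * 'C(N - i, k))%N.
Proof.
move=> iN kN; have ikN : (i + k <= N)%N by rewrite -leq_subRL.
apply/eqP; rewrite -(@eqn_pmul2r (i`! * k`! * (N - (i + k))`!)) ?muln_gt0 ?fact_gt0//.
apply/eqP; transitivity (N`!).
  rewrite -(bin_fact ikN) -[in RHS](bin_fact (leq_addr k i)) addKn; lia.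
rewrite -(bin_fact iN) -(bin_fact kN) subnDA; lia.
Qed.

Lemma bernstein_coefE N h x :
  \sum_(0 <= j < N.+1) bernstein_coef N h j * x ^+ j =
  bernstein_sum N (fun i => h (i%:R / N%:R)) x.
Proof.
pose F (j nu : nat) : R := h (nu%:R / N%:R) *
  ((-1) ^+ (j - nu) * 'C(N, j)%:R * 'C(j, nu)%:R * x ^+ j).
transitivity (\sum_(0 <= j < N.+1) \sum_(0 <= nu < N.+1 | (nu < j.+1)%N) F j nu).
  apply: eq_big_nat => j /andP[_ jN]; rewrite /bernstein_coef (big_nat_widen _ _ N.+1)//.
  by rewrite mulr_suml; apply: eq_bigr => i _; rewrite /F; ring.
rewrite (exchange_big_dep_nat xpredT)//= big_mkord; apply: eq_bigr => -[i iN] _ /=.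
rewrite -[X in \sum_(X <= _ < _ | _) _]/0%N.
transitivity (\sum_(i <= j < N.+1) F j i).
  by rewrite [RHS](@big_nat_widenl _ _ _ i 0)//; apply: eq_bigl.
rewrite -{1}(add0n i) big_addn subSn// big_mkord exprBn mulr_sumr mulr_sumr.
apply: eq_bigr => -[k kN] _ /=; rewrite /F addnK -[(_ * _) *+ _]mulr_natr expr1n mulr1.
have E : 'C(N, k + i)%:R * 'C(k + i, i)%:R = 'C(N, i)%:R * 'C(N - i, k)%:R :> R.
  by rewrite -!natrM addnC (bin_split (i := i) (k := k)).
rewrite exprD; congr (_ * _).
transitivity ((-1) ^+ k * x ^+ i * x ^+ k * ('C(N, k + i)%:R * 'C(k + i, i)%:R)); first by ring.
by rewrite E; ring.
Qed.

(** Pascal's rule, that is, conditioning on one Bernoulli trial of success probability x, whose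
    success shifts the index. *)
Lemma bernstein_sum_rec N f x :
  bernstein_sum N.+1 f x =
  (1 - x) * bernstein_sum N f x + x * bernstein_sum N (f \o S) x.
Proof.
rewrite /bernstein_sum big_ord_recl /=.
under eq_bigr => i _ do rewrite /bump /= add1n binS natrD !mulrDl mulrDr subSS.
rewrite big_split /= addrA; congr (_ + _).
  rewrite big_ord_recr /= (@bin_small N N.+1)// !mul0r mulr0 addr0.
  rewrite [in RHS]big_ord_recl mulrDr /= !bin0 !subn0; congr (_ + _).
    by rewrite exprS; ring.
  rewrite mulr_sumr; apply: eq_bigr => i _; rewrite /bump /= add1n.
  by rewrite -(subnSK (ltn_ord i)) [in LHS](exprS (1 - x)); ring.
by rewrite mulr_sumr; apply: eq_bigr => i _; rewrite exprS; ring.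
Qed.

(** Mean and second moment of the binomial law in one induction: quadratics in i are stable under
    the shift of [bernstein_sum_rec], so a, b and c stay general. *)
Lemma bernstein_sum_quadratic N x (a b c : R) :
  bernstein_sum N (fun i => a + b * i%:R + c * i%:R ^+ 2) x =
  a + b * (N%:R * x) + c * (N%:R * x * (1 - x) + (N%:R * x) ^+ 2).
Proof.
elim: N a b c => [|N IH] a b c.
  by rewrite /bernstein_sum big_ord1 /= bin0 !expr0 expr0n /=; ring.
rewrite bernstein_sum_rec IH.
have -> : bernstein_sum N ((fun i => a + b * i%:R + c * i%:R ^+ 2) \o S) x =
    bernstein_sum N (fun i => (a + b + c) + (b + 2 * c) * i%:R + c * i%:R ^+ 2) x.
  by apply: eq_bigr => i _ /=; congr (_ * _); rewrite -natr1; ring.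
rewrite IH -natr1; ring.
Qed.

Lemma derive_in_continuous (A : set R) h x : A x -> cvg (quotient_in A h x) ->
  h y @[y --> within A (nbhs x)] --> h x.
Proof.
move=> Ax /cvg_ex[l q].
have i0 : y - x @[y --> within A x^'] --> x - x.
  by apply: cvg_within_filter; apply: cvgB; [exact: nbhs_dnbhs|exact: cvg_cst].
have c : h x + (h y - h x) / (y - x) * (y - x) @[y --> within A x^'] --> h x + l * (x - x).
  by apply: cvgD; [exact: cvg_cst|exact: cvgM q i0].
rewrite subrr mulr0 addr0 in c.
move=> P xP; have := c P xP => H.
have {H} H : \forall y \near x, y != x -> A y ->
  P (h x + (h y - h x) / (y - x) * (y - x)) by exact: H.
apply: filterS H => y H Ay; have [->|yx] := eqVneq y x; first exact: nbhs_singleton xP.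
by have := H yx Ay; rewrite divfK ?subr_eq0// addrC subrK.
Qed.

(** At 0 and 1 the derivative is one-sided. It enters there only through the continuity of h; the
    mean value theorem takes derivatives at interior points, where [derive_in] is the ordinary
    one. *)
Lemma MVT_derive_in h x y : (forall z, `[0, 1]%classic z -> cvg (quotient_in `[0, 1] h z)) ->
  x \in `[0, 1] -> y \in `[0, 1] ->
  exists2 xi, xi \in `[0, 1] /\ `|xi - x| <= `|y - x| &
    h y - h x = derive_in `[0, 1] h xi * (y - x).
Proof.
move=> dh.
have ch (a b : R) : a \in `[0, 1] -> b \in `[0, 1] -> {within `[a, b], continuous h}.
  rewrite !in_itv/= => /andP[a0 _] /andP[_ b1].
  have cI : {within `[0, 1], continuous h}.
    by apply/subspace_continuousP => z z01; apply: derive_in_continuous => //; exact: dh.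
  apply: continuous_subspaceW cI => z /=; rewrite !in_itv/= => /andP[az zb].
  by rewrite (le_trans a0 az) (le_trans zb b1).
have dh' (a b z : R) : a \in `[0, 1] -> b \in `[0, 1] -> z \in `]a, b[ ->
    is_derive z 1 h (derive_in `[0, 1] h z).
  rewrite !in_itv/= => /andP[a0 _] /andP[_ b1] /andP[az zb].
  apply: derive_in_nbhs.
    by apply: filterS (near_in_itvoo (_ : z \in `]a, b[)); rewrite ?in_itv/= ?az//;
      move=> t; rewrite /= !in_itv/= => /andP[/ltW a_t /ltW tb];
      rewrite (le_trans a0 a_t) (le_trans tb b1).
  by apply: dh; rewrite /= in_itv/= (ltW (le_lt_trans a0 az)) (ltW (lt_le_trans zb b1)).
move=> xI yI; have [xy|yx|->] := ltgtP x y.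
- have [xi xixy E] := MVT xy (fun z => @dh' x y z xI yI) (ch _ _ xI yI).
  exists xi => //; move: xixy xI yI; rewrite !in_itv/= => /andP[? ?] /andP[? ?] /andP[? ?].
  by split; [apply/andP; split; lra|rewrite !ger0_norm ?subr_ge0; lra].
- have [xi xixy E] := MVT yx (fun z => @dh' y x z yI xI) (ch _ _ yI xI).
  exists xi; last by rewrite -opprB E -mulrN opprB.
  move: xixy xI yI; rewrite !in_itv/= => /andP[? ?] /andP[? ?] /andP[? ?].
  by split; [apply/andP; split; lra|rewrite !ler0_norm ?subr_le0; lra].
- by exists y => //; rewrite !subrr mulr0.
Qed.

(** d is N^(-1/2), characterized by [d0] and [d2] so that no real power occurs. *)
Variables (N : nat) (x d : R).
Hypothesis N0 : (0 < N)%N.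
Hypothesis x01 : x \in `[0, 1].
Hypothesis d0 : 0 < d.
Hypothesis d2 : N%:R * d ^+ 2 = 1.

Let p i := 'C(N, i)%:R * x ^+ i * (1 - x) ^+ (N - i).

Let p_ge0 i : 0 <= p i.
Proof.
move: x01; rewrite in_itv/= => /andP[x0 x1].
by rewrite !mulr_ge0 ?exprn_ge0 ?subr_ge0.
Qed.

Let node (i : 'I_N.+1) : i%:R / N%:R \in `[0 : R, 1].
Proof. by rewrite in_itv/= divr_ge0// ler_pdivrMr ?ltr0n// mul1r ler_nat leq_ord. Qed.

Let bernstein_sum_le f1 f2 : (forall i : 'I_N.+1, f1 i <= f2 i) ->
  bernstein_sum N f1 x <= bernstein_sum N f2 x.
Proof. by move=> f12; apply: ler_sum => i _; apply: ler_wpM2r; [exact: p_ge0|exact: f12]. Qed.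

Let nN0 : N%:R != 0 :> R. Proof. by rewrite pnatr_eq0 -lt0n. Qed.

Let bernstein_sum_cst (a : R) : bernstein_sum N (fun=> a) x = a.
Proof.
transitivity (bernstein_sum N (fun i => a + 0 * i%:R + 0 * i%:R ^+ 2) x).
  by apply: eq_bigr => i _; rewrite !mul0r !addr0.
by rewrite bernstein_sum_quadratic !mul0r !addr0.
Qed.

Let bernstein_sum_center (a : R) :
  bernstein_sum N (fun i => a * (i%:R / N%:R - x)) x = 0.
Proof.
transitivity (bernstein_sum N (fun i => - (a * x) + a / N%:R * i%:R + 0 * i%:R ^+ 2) x).
  by apply: eq_bigr => i _; congr (_ * _); ring.
by rewrite bernstein_sum_quadratic; field.
Qed.

(** In units of d the variance x (1 - x) / N becomes x (1 - x), which is at most 1/4. *)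
Let bernstein_sum_variance (a b : R) : 0 <= b ->
  bernstein_sum N (fun i => a + b * ((i%:R / N%:R - x) / d) ^+ 2) x <= a + b / 4.
Proof.
move=> b0.
have -> : bernstein_sum N (fun i => a + b * ((i%:R / N%:R - x) / d) ^+ 2) x =
   bernstein_sum N (fun i => (a + b * N%:R * x ^+ 2) + -
     (2 * b * x) * i%:R + b / N%:R * i%:R ^+ 2) x.
  apply: eq_bigr => i _; congr (_ * _).
  have -> : ((i%:R / N%:R - x) / d) ^+ 2 = N%:R * (i%:R / N%:R - x) ^+ 2.
    rewrite expr_div_n; apply: (mulIf (expf_neq0 2 (lt0r_neq0 d0))).
    by rewrite divfK ?expf_neq0 ?lt0r_neq0// mulrAC d2 mul1r.
  by field.
rewrite bernstein_sum_quadratic.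
have -> : a + b * N%:R * x ^+ 2 + - (2 * b * x) * (N%:R * x) +
    b / N%:R * (N%:R * x * (1 - x) + (N%:R * x) ^+ 2) = a + b * (x * (1 - x)).
  by field.
rewrite lerD2l ler_wpM2l//.
have : 0 <= (x - 1 / 2) ^+ 2 by rewrite sqr_ge0.
by nra.
Qed.

(* Trades the first absolute moment of the Bernstein weights for their variance. *)
Let norm_le_sqr (t : R) : `|t| <= 2^-1 + 2^-1 * t ^+ 2.
Proof.
have : 0 <= (`|t| - 1) ^+ 2 by rewrite sqr_ge0.
by rewrite -(real_normK (num_real t)); nra.
Qed.

Let bernstein_sum_norm (a : R) f :
  `|a - bernstein_sum N f x| <= bernstein_sum N (fun i => `|f i - a|) x.
Proof.
rewrite -{1}(bernstein_sum_cst a) -sumrB (le_trans (ler_norm_sum _ _ _))//.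
by apply: ler_sum => i _; rewrite -mulrBl normrM distrC (ger0_norm (p_ge0 _)).
Qed.

Lemma bernstein_error0 h w :
  (forall l1 l2, l1 \in `[0, 1] -> l2 \in `[0, 1] -> `|l1 - l2| <= d ->
     `|h l1 - h l2| <= w) ->
  `|h x - bernstein_sum N (fun i => h (i%:R / N%:R)) x| <= 2 * w.
Proof.
move=> hw; have w0 : 0 <= w.
  by apply: le_trans (hw _ _ x01 x01 _); rewrite ?normr_ge0// subrr normr0 ltW.
rewrite (le_trans (bernstein_sum_norm _ _))//.
(* With s = |i/N - x| / d, [modulus_linear] gives the bound (1 + s) w <= (3/2 + s^2 / 2) w, and the
   mean of s^2 is at most 1/4. *)
apply: le_trans (_ : 3 / 2 * w + w / 2 / 4 <= _); last by lra.
apply: le_trans (bernstein_sum_variance _ (_ : 0 <= w / 2)); last by rewrite divr_ge0.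
apply: bernstein_sum_le => i.
rewrite (le_trans (modulus_linear d0 hw (node i) x01))//.
have := norm_le_sqr ((i%:R / N%:R - x) / d); rewrite normrM (@ger0_norm _ d^-1) ?invr_ge0
  ?(ltW d0)//.
set s := `|_ - x| / d; set t := (_ / d) ^+ 2 => st.
have := ler_wpM2r w0 st; lra.
Qed.

Lemma bernstein_error1 h w :
  (forall z, `[0, 1]%classic z -> cvg (quotient_in `[0, 1] h z)) ->
  (forall l1 l2, l1 \in `[0, 1] -> l2 \in `[0, 1] -> `|l1 - l2| <= d ->
     `|derive_in `[0, 1] h l1 - derive_in `[0, 1] h l2| <= w) ->
  `|h x - bernstein_sum N (fun i => h (i%:R / N%:R)) x| <= 2 * d * w.
Proof.
move=> dh hw; have w0 : 0 <= w.
  by apply: le_trans (hw _ _ x01 x01 _); rewrite ?normr_ge0// subrr normr0 ltW.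
set D := derive_in `[0, 1] h.
(* The linear term has mean zero; once it is subtracted, only the oscillation of the derivative
   matters. *)
have -> : bernstein_sum N (fun i => h (i%:R / N%:R)) x =
    bernstein_sum N (fun i => h (i%:R / N%:R) - D x * (i%:R / N%:R - x)) x.
  rewrite -[LHS]subr0 -(bernstein_sum_center (D x)) -sumrB.
  by apply: eq_bigr => i _; rewrite mulrBl.
rewrite (le_trans (bernstein_sum_norm _ _))//.
have dw : 0 <= d * w by rewrite mulr_ge0// ltW.
(* With s = |i/N - x| / d, each term is at most (s + s^2) d w <= (1/2 + 3/2 s^2) d w, whose mean is
   at most (1/2 + 3/8) d w. *)
rewrite -mulrA; apply: le_trans (_ : d * w / 2 + 3 / 2 * (d * w) / 4 <= _); last by lra.
apply: le_trans (bernstein_sum_variance _ (_ : 0 <= 3 / 2 * (d * w))); last first.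
  by rewrite !mulr_ge0// ltW.
apply: bernstein_sum_le => i.
have [xi [xiI xix] E] := MVT_derive_in dh x01 (node i).
rewrite addrAC E -mulrBl normrM.
have H : `|D xi - D x| <= (1 + `|i%:R / N%:R - x| / d) * w.
  rewrite (le_trans (modulus_linear d0 hw xiI x01))// ler_wpM2r// lerD2l.
  by rewrite ler_wpM2r// invr_ge0 ltW.
apply: le_trans (ler_wpM2r (normr_ge0 _) H) _.
have := norm_le_sqr ((i%:R / N%:R - x) / d); rewrite normrM (@ger0_norm _ d^-1) ?invr_ge0
  ?(ltW d0)//.
have -> : ((i%:R / N%:R - x) / d) ^+ 2 = (`|i%:R / N%:R - x| / d) ^+ 2.
  by rewrite !expr_div_n real_normK// num_real.
set s := `|_ - x| / d; have -> : `|i%:R / N%:R - x| = s * d by rewrite /s divfK ?lt0r_neq0.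
have s0 : 0 <= s by rewrite divr_ge0// ltW.
move=> st; have -> : (1 + s) * w * (s * d) = (s + s ^+ 2) * (d * w) by ring.
have := ler_wpM2r dw st; lra.
Qed.

End bernstein.

(** * Lagrange interpolation at the Chebyshev nodes *)

Section chebyshev.
Context (R : realType).
Implicit Types (n k : nat) (t x y : R).

(** Lets sums run over all k <= n: where n - 2 k is truncated, the coefficient is 0. *)
Lemma cheb_C_eq0 n k : (n < 2 * k)%N -> cheb_C R n k = 0.
Proof.
by move=> nk; rewrite /cheb_C bin_small ?mulr0//; lia.
Qed.

Lemma cheb_C0 n : (0 < n)%N -> cheb_C R n.+1 0 = 2 * cheb_C R n 0.
Proof.
move=> n0; rewrite /cheb_C !bin0 !mulr1 !subn0 !divff ?pnatr_eq0 -?lt0n// !mulr1 !mul1r.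
rewrite (_ : (n.+1%:Z - (2 * 0)%:Z - 1)%R = (n%:Z - (2 * 0)%:Z - 1 + 1)%R) ?expfzDr//;
  first by rewrite expr1z mulrC.
by lia.
Qed.

(** The recurrence T_(n+2) = 2 x T_(n+1) - T_n compared at x^(n - 2 k). At n = 0 the factor n / (n -
    k) is 0 / 0 = 0 instead of giving the coefficient of T_0; hence the two base cases 1 and 2 in
    [cos_nat_mul]. *)
Lemma cheb_C_rec n k : (0 < n)%N ->
  cheb_C R n.+2 k.+1 = 2 * cheb_C R n.+1 k.+1 - cheb_C R n k.
Proof.
move=> n0; have [nk|kn] := ltnP n (2 * k).
  by rewrite !cheb_C_eq0 ?mulr0 ?subr0//; lia.
rewrite /cheb_C.
have [m mE] : exists m, n = (m + k)%N by exists (n - k)%N; lia.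
have m0 : (0 < m)%N by lia.
have -> : (n.+2 - k.+1 = m.+1)%N by lia.
have -> : (n.+1 - k.+1 = m)%N by lia.
have -> : (n - k = m)%N by lia.
have -> : (n.+2%:Z - (2 * k.+1)%:Z - 1)%R = (n%:Z - (2 * k)%:Z - 1)%R by lia.
have -> : (n%:Z - (2 * k)%:Z - 1)%R = ((n.+1%:Z - (2 * k.+1)%:Z - 1) + 1)%R by lia.
rewrite expfzDr// expr1z exprS; move: (2 ^ _) => p; move: ((-1) ^+ k) => s.
have /(congr1 (fun i => i%:R : R)) := mul_bin_diag m.+1 k; rewrite /= !natrM.
have /(congr1 (fun i => i%:R : R)) := mul_bin_left m k; rewrite /= !natrM natrB; last by lia.
rewrite binS natrD mE -!natr1 !natrD.
have m1 : m%:R + 1 != 0 :> R by rewrite natr1 pnatr_eq0.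
have mn0 : m%:R != 0 :> R by rewrite pnatr_eq0 -lt0n.
move: ('C(m, k)%:R : R) ('C(m, k.+1)%:R : R) (m%:R : R) (k%:R : R) m1 mn0 =>
  A B M K M1 M0 E1 E2.
(* A and B are C(m, k) and C(m, k + 1) with m = n - k. Both sides of the recurrence reduce to C(m +
   1, k + 1) + C(m, k), up to the same factor. *)
have F1 : (M + K + 1 + 1) / (M + 1) * (B + A) = A + (B + A).
  by rewrite mulrAC; apply: (mulIf M1); rewrite divfK//; move: E2; lra.
have F2 : (M + K + 1) / M * B + (M + K) / M * A = A + (B + A).
  rewrite mulrAC [X in _ + X]mulrAC -mulrDl; apply: (mulIf M0); rewrite divfK//.
  by move: E1; lra.
transitivity (- (s * (p * 2)) * ((M + K + 1 + 1) / (M + 1) * (B + A))); first by ring.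
by rewrite F1 -F2; ring.
Qed.

Lemma cos_nat_mul n t : (0 < n)%N ->
  cos (n%:R * t) = \sum_(k < n.+1) cheb_C R n k * cos t ^+ (n - 2 * k).
Proof.
have C10 : cheb_C R 1 0 = 1.
  rewrite /cheb_C bin0 (_ : (1%N%:Z - (2 * 0)%N%:Z - 1)%R = 0)//.
  by rewrite expr0z subn0 divff ?oner_eq0// !mulr1.
have C21 : cheb_C R 2 1 = - 1.
  rewrite /cheb_C (_ : (2%N%:Z - (2 * 1)%N%:Z - 1)%R = - 1)//.
  by rewrite (_ : (2 - 1)%N = 1%N)// binn exprN1 expr1 divr1 mulr1; field.
elim/ltn_ind: n => -[|[|[|n]]] // IH _.
- by rewrite !big_ord_recr big_ord0 /= [X in _ + X * _]cheb_C_eq0//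
    mul0r addr0 add0r C10 !mul1r.
- rewrite !big_ord_recr big_ord0 /= [X in _ + X * _]cheb_C_eq0// mul0r addr0 add0r.
  by rewrite cheb_C0// C10 C21 mulr1 mulN1r mulr_natl cos_mulr2n -mulr_natl expr0.
have H1 := IH n.+1 (ltnW (ltnSn n.+2)) isT.
have H2 := IH n.+2 (ltnSn n.+2) isT.
have -> : cos (n.+3%:R * t) = 2 * cos t * cos (n.+2%:R * t) - cos (n.+1%:R * t).
  have -> : n.+3%:R * t = n.+2%:R * t + t by rewrite -[in LHS]natr1 mulrDl mul1r.
  have -> : n.+1%:R * t = n.+2%:R * t - t by rewrite -[in RHS]natr1 mulrDl mul1r addrK.
  by rewrite cosD cosB; ring.
rewrite H1 H2 [RHS]big_ord_recl [in RHS]cheb_C0// mulr_sumr.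
have -> : \sum_(k < n.+3) 2 * cos t * (cheb_C R n.+2 k * cos t ^+ (n.+2 - 2 * k)) =
    \sum_(k < n.+4) 2 * cheb_C R n.+2 k * cos t ^+ (n.+3 - 2 * k).
  rewrite [RHS]big_ord_recr /= cheb_C_eq0 ?mulr0 ?mul0r ?addr0; last by lia.
  apply: eq_bigr => k _; have [nk|kn] := ltnP n.+2 (2 * k).
    by rewrite cheb_C_eq0// !(mulr0, mul0r).
  have -> : (n.+3 - 2 * k = (n.+2 - 2 * k).+1)%N by lia.
  by rewrite exprS; ring.
have -> : \sum_(k < n.+2) cheb_C R n.+1 k * cos t ^+ (n.+1 - 2 * k) =
    \sum_(k < n.+3) cheb_C R n.+1 k * cos t ^+ (n.+1 - 2 * k).
  by rewrite [RHS]big_ord_recr /= cheb_C_eq0 ?mul0r ?addr0//; lia.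
rewrite [X in X - _]big_ord_recl -addrA; congr (_ + _); rewrite -sumrB.
apply: eq_bigr => k _; rewrite /= /bump /= add1n [in RHS]cheb_C_rec//.
have -> : (n.+3 - 2 * k.+1 = n.+1 - 2 * k)%N by lia.
by ring.
Qed.

Lemma cheb_xiE n m : (m <= n)%N ->
  cheb_xi R n m = \sum_(nu < n.+1 | (2 * nu + m <= n)%N) cheb_mu R n nu (n - 2 * nu - m).
Proof.
move=> mn.
have E b : (forall nu, (nu < b.+1)%N = (2 * nu + m <= n)%N) ->
    \sum_(0 <= nu < b.+1) cheb_mu R n nu (n - 2 * nu - m) =
    \sum_(nu < n.+1 | (2 * nu + m <= n)%N) cheb_mu R n nu (n - 2 * nu - m).
  move=> H; have bn : (b.+1 <= n.+1)%N.
    by have := H b; rewrite ltnSn => /esym; lia.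
  by rewrite (big_nat_widen _ _ _ _ _ bn) big_mkord; apply: eq_bigl => nu; rewrite /= H.
rewrite /cheb_xi; case: ifP => no; apply: E => nu.
  by have := odd_double_half n; have := odd_double_half m; rewrite no; case: (odd m); lia.
have := odd_double_half n; have := odd_double_half m; rewrite no uphalf_half.
by case: (odd m); lia.
Qed.

(** The numbers [cheb_xi R n m] are the coefficients of the shifted Chebyshev polynomial T_n(2 x -
    1), obtained by expanding each (2 x - 1)^(n - 2 k). *)
Lemma cheb_xi_cos n t : (0 < n)%N ->
  \sum_(m < n.+1) cheb_xi R n m * (1 / 2 + 1 / 2 * cos t) ^+ m = cos (n%:R * t).
Proof.
move=> n0; rewrite cos_nat_mul//; set x := 1 / 2 + _.
have -> : cos t = 2 * x - 1 by rewrite /x; field.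
transitivity (\sum_(m < n.+1) \sum_(k < n.+1 | (2 * k + m <= n)%N)
    cheb_mu R n k (n - 2 * k - m) * x ^+ m).
  apply: eq_bigr => -[m mn] _ /=; rewrite cheb_xiE// mulr_suml; exact: eq_bigr.
rewrite (exchange_big_dep xpredT)//=; apply: eq_bigr => -[k kn] _ /=.
have [nk|kn2] := ltnP n (2 * k).
  by rewrite cheb_C_eq0// mul0r big1// => -[m mn] /=; lia.
rewrite exprBn mulr_sumr (eq_bigl (fun m : 'I_n.+1 => (m < (n - 2 * k).+1)%N)); last first.
  by move=> m /=; lia.
have ln : ((n - 2 * k).+1 <= n.+1)%N by lia.
rewrite -(big_ord_widen _ (fun m => cheb_mu R n k (n - 2 * k - m) * x ^+ m) ln).
rewrite [RHS](reindex_inj rev_ord_inj) /=.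
apply: eq_bigr => -[m mn] _ /=; rewrite subSS expr1n mulr1 /cheb_mu -[(_ * (2 * x) ^+ _) *+
  _]mulr_natr.
rewrite [(2 * x) ^+ _]exprMn; have -> : (n - 2 * k - (n - 2 * k - m) = m)%N by lia.
by ring.
Qed.

(** A factor 2^(n-1) comes from T_n and 2^n from the argument 2 x - 1. *)
Lemma cheb_xi_lead n : (0 < n)%N -> cheb_xi R n n = 2 ^+ (2 * n - 1).
Proof.
move=> n0; rewrite cheb_xiE// (bigD1 ord0) //= big1 ?addr0; last first.
  by move=> [[|i] i_n]//=; lia.
rewrite /cheb_mu /cheb_C muln0 !subn0 subnn !bin0 !expr0 divff ?pnatr_eq0 -?lt0n//
  !mul1r !mulr1.
rewrite (_ : (n - 0)%N = n) ?subn0// -[2 ^+ n]/(2 ^ n%:Z) -expfzDr//.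
by rewrite -[RHS]/(2 ^ (2 * n - 1)%N%:Z); congr (_ ^ _); lia.
Qed.

End chebyshev.

(** * The interpolation polynomial in Lagrange form *)

Section lagrange.
Context (R : realType).
Implicit Types (h : R -> R) (t x : R).

(* Applied to the Chebyshev polynomial and one of its roots: the inner sums are
   then the coefficients cheb_tau of the cofactor of that root. *)
Lemma synthetic_division (A : comNzRingType) (xi : nat -> A) n (x r : A) :
  (x - r) * (\sum_(j < n) (\sum_(j <= k < n) r ^+ (k - j) * xi k.+1) * x ^+ j) =
  \sum_(m < n.+1) xi m * x ^+ m - \sum_(m < n.+1) xi m * r ^+ m.
Proof.
rewrite 2!big_ord_recl !expr0 opprD addrACA subrr add0r -sumrB.
transitivity ((x - r) * \sum_(k < n) \sum_(j < k.+1) r ^+ (k - j) * xi k.+1 * x ^+ j).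
  congr (_ * _).
  transitivity (\sum_(j < n) \sum_(k < n | (j <= k)%N) r ^+ (k - j) * xi k.+1 * x ^+ j).
    by apply: eq_bigr => j _; rewrite big_geq_mkord mulr_suml; apply: eq_bigl.
  rewrite (exchange_big_dep xpredT)//=; apply: eq_bigr => k _.
  by rewrite (big_ord_widen n (fun j => r ^+ (k - j) * xi k.+1 * x ^+ j))//; apply: eq_bigl.
rewrite mulr_sumr; apply: eq_bigr => k _ /=; rewrite /bump /= add1n -mulrBr subrXX.
rewrite [RHS]mulrCA [in RHS]mulr_sumr; congr (_ * _).
rewrite [RHS](reindex_inj rev_ord_inj) /=; apply: eq_bigr => j _.
rewrite subSS subKn; last by rewrite -ltnS.
by rewrite -mulrA mulrCA; congr (_ * _); rewrite mulrC.
Qed.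

Definition cheb_angle n k : R := (2 * k + 1)%:R * pi / (2 * n)%:R.

Lemma cheb_nodeE n k : cheb_node R n k = 1 / 2 + 1 / 2 * cos (cheb_angle n k).
Proof. by []. Qed.

Lemma cos_addkpi k t : cos (t + k%:R * pi) = (-1) ^+ k * cos t.
Proof.
elim: k => [|k IH]; first by rewrite mul0r addr0 expr0 mul1r.
by rewrite -natr1 mulrDl mul1r addrA cosDpi IH exprS mulN1r mulNr.
Qed.

Lemma sin_addkpi k t : sin (t + k%:R * pi) = (-1) ^+ k * sin t.
Proof.
elim: k => [|k IH]; first by rewrite mul0r addr0 expr0 mul1r.
by rewrite -natr1 mulrDl mul1r addrA sinDpi IH exprS mulN1r mulNr.
Qed.

Section nodes.
Variable n : nat.
Hypothesis n0 : (0 < n)%N.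

Let nn0 : n%:R != 0 :> R. Proof. by rewrite pnatr_eq0 -lt0n. Qed.

Lemma mul_cheb_angle k : n%:R * cheb_angle n k = pi / 2 + k%:R * pi.
Proof.
by rewrite /cheb_angle natrD !natrM; field.
Qed.

Lemma cheb_angle_itv k : (k < n)%N -> 0 < cheb_angle n k < pi.
Proof.
move=> kn; rewrite /cheb_angle; have n2 : 0 < (2 * n)%:R :> R by rewrite ltr0n; lia.
rewrite divr_gt0 ?mulr_gt0 ?pi_gt0// ?ltr0n ?addn1//=.
by rewrite ltr_pdivrMr// mulrC ltr_pM2l ?pi_gt0// ltr_nat; lia.
Qed.

Lemma cheb_node_inj k l : (k < n)%N -> (l < n)%N ->
  cheb_node R n k = cheb_node R n l -> k = l.
Proof.
move=> kn ln; rewrite !cheb_nodeE => /addrI /mulfI => H.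
have {}H : cos (cheb_angle n k) = cos (cheb_angle n l) :> R by apply: H; rewrite mulf_neq0.
have /andP[k0 kp] := cheb_angle_itv kn; have /andP[l0 lp] := cheb_angle_itv ln.
have := cos_inj _ _ H; rewrite !in_itv/= (ltW k0) (ltW kp) (ltW l0) (ltW lp).
move=> /(_ isT isT) /eqP.
rewrite /cheb_angle eqr_div ?pnatr_eq0 -?lt0n ?muln_gt0 ?n0//.
have pi0 : pi != 0 :> R by rewrite gt_eqF ?pi_gt0.
rewrite -!mulrA !(mulrCA _ pi) (inj_eq (mulfI pi0)).
by rewrite -!natrM eqr_nat => /eqP; nia.
Qed.

Definition cheb_poly : {poly R} := \poly_(m < n.+1) cheb_xi R n m.

Lemma horner_cheb_poly t : cheb_poly.[1 / 2 + 1 / 2 * cos t] = cos (n%:R * t).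
Proof. by rewrite horner_poly -cheb_xi_cos. Qed.

Lemma cheb_poly_node k : cheb_poly.[cheb_node R n k] = 0.
Proof.
by rewrite cheb_nodeE horner_cheb_poly mul_cheb_angle cos_addkpi cos_pihalf mulr0.
Qed.

Let lead : R := 2 ^+ (2 * n - 1).

Let lead0 : lead != 0. Proof. by rewrite expf_neq0. Qed.

Lemma cheb_poly_prod :
  cheb_poly = lead *: \prod_(k < n) ('X - (cheb_node R n k)%:P).
Proof.
have sP : size cheb_poly = n.+1 by rewrite size_poly_eq// cheb_xi_lead.
have lP : lead_coef cheb_poly = lead.
  by rewrite lead_coefE sP coef_poly ltnSn cheb_xi_lead.
rewrite -lP [LHS](@all_roots_prod_XsubC _ _ [seq cheb_node R n k | k <- iota 0 n]).
- rewrite big_map; congr (_ *: _).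
  by rewrite -(big_mkord xpredT (fun k => 'X - (cheb_node R n k)%:P)) /index_iota subn0.
- by rewrite size_map size_iota.
- by apply/allP => _ /mapP[k _ ->]; apply/rootP; exact: cheb_poly_node.
- rewrite uniq_rootsE map_inj_in_uniq ?iota_uniq// => k l.
  by rewrite !mem_iota !add0n => /andP[_ kn] /andP[_ ln]; exact: cheb_node_inj.
Qed.

(** The Lagrange basis polynomial of a node before normalization. *)
Definition omit_node (nu : nat) : {poly R} :=
  \prod_(k < n | k != nu :> nat) ('X - (cheb_node R n k)%:P).

Lemma cheb_poly_omit nu : (nu < n)%N ->
  cheb_poly = ('X - (cheb_node R n nu)%:P) * (lead *: omit_node nu).
Proof.
move=> nun; rewrite cheb_poly_prod (bigD1 (Ordinal nun))//= -scalerAr; congr (_ *: (_ * _)).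
Qed.

Lemma cheb_tau_poly nu : (nu < n)%N ->
  \sum_(j < n) (cheb_tau R n j nu)%:P * 'X^j = lead *: omit_node nu.
Proof.
move=> nun; have X0 : 'X - (cheb_node R n nu)%:P != 0 :> {poly R} by rewrite polyXsubC_eq0.
apply: (mulfI X0); rewrite -cheb_poly_omit//.
(* The division takes place in the ring of polynomials, with x the indeterminate and r a
   constant. *)
have := synthetic_division (fun k => (cheb_xi R n k)%:P) n 'X (cheb_node R n nu)%:P.
have -> : \sum_(m < n.+1) (cheb_xi R n m)%:P * (cheb_node R n nu)%:P ^+ m = 0.
  rewrite -[RHS]/(0%:P) -(cheb_poly_node nu) horner_poly rmorph_sum; apply: eq_bigr => m _.
  by rewrite /= polyCM polyC_exp.
rewrite subr0 /cheb_poly poly_def => H.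
rewrite (eq_bigr (fun m : 'I_n.+1 => (cheb_xi R n m)%:P * 'X ^+ m)); last first.
  by move=> m _; rewrite mul_polyC.
rewrite -H; congr (_ * _); apply: eq_bigr => j _; congr (_ * _).
rewrite /cheb_tau rmorph_sum; apply: eq_bigr => k _ /=; by rewrite polyCM polyC_exp.
Qed.

(** For P = [cheb_poly], the left-hand side is P' at the node by the product rule. Differentiating
    P(1/2 + 1/2 cos t) = cos (n t) at the node angle gives P' sin t / 2 = n sin (n t), where sin (n
    t) = (-1)^nu. *)
Lemma cheb_poly_deriv nu : (nu < n)%N ->
  lead * (omit_node nu).[cheb_node R n nu] = 2 * n%:R * (-1) ^+ nu / sin (cheb_angle n nu).
Proof.
move=> nun; set t := cheb_angle n nu.
have st : sin t != 0.
  by rewrite gt_eqF// sin_gt0_pi//; exact: cheb_angle_itv.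
have D1 : cheb_poly^`().[cheb_node R n nu] = lead * (omit_node nu).[cheb_node R n nu].
  rewrite {1}(cheb_poly_omit nun) derivM hornerD !hornerM derivXsubC hornerXsubC subrr
    mul0r addr0.
  by rewrite hornerC mul1r hornerZ.
have F1 : is_derive t (1 : R) (fun t => cheb_poly.[1 / 2 + 1 / 2 * cos t])
    (cheb_poly^`().[cheb_node R n nu] * (1 / 2 * - sin t)).
  have H : is_derive t (1 : R) (fun t => 1 / 2 + 1 / 2 * cos t) (1 / 2 * - sin t).
    by apply: is_derive_eq; rewrite /GRing.scale /= add0r mul1r.
  exact: (is_derive1_comp (is_derive_poly cheb_poly _) H).
have F2 : is_derive t (1 : R) (fun t => cos (n%:R * t)) (- sin (n%:R * t) * n%:R).
  have H : is_derive t (1 : R) (n%:R \*: (id : R -> R)) (n%:R *: (1 : R)) by apply: is_deriveZ.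
  have := is_derive1_comp (is_derive_cos _) H.
  by rewrite /GRing.scale /= mulr1.
have E : (fun t => cheb_poly.[1 / 2 + 1 / 2 * cos t]) = (fun t => cos (n%:R * t)).
  by apply/funext => u; exact: horner_cheb_poly.
rewrite E in F1.
have := @derive_val _ _ _ _ _ _ _ F1; rewrite (@derive_val _ _ _ _ _ _ _ F2) D1 mul_cheb_angle.
rewrite sin_addkpi sin_pihalf mulr1 => H.
by apply: (mulIf st); rewrite divfK//; lra.
Qed.

Lemma omit_node_neq0 nu : (nu < n)%N -> (omit_node nu).[cheb_node R n nu] != 0.
Proof.
move=> nun; rewrite horner_prod; apply/prodf_neq0 => k kn.
rewrite hornerXsubC subr_eq0; apply: contra kn => /eqP.
by move/(cheb_node_inj nun (ltn_ord k)) => ->.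
Qed.

Lemma omit_node_eq0 nu k : (k < n)%N -> k != nu -> (omit_node nu).[cheb_node R n k] = 0.
Proof.
move=> kn kE; rewrite horner_prod (bigD1 (Ordinal kn))//= hornerXsubC subrr mul0r.
by [].
Qed.

(** The sum minus 1 has degree less than n and vanishes at the n distinct nodes. *)
Lemma sum_omit_node x :
  \sum_(nu < n) (omit_node nu).[x] / (omit_node nu).[cheb_node R n nu] = 1.
Proof.
pose Q : {poly R} := \sum_(nu < n) (omit_node nu).[cheb_node R n nu]^-1 *: omit_node nu - 1.
suff Q0 : Q = 0.
  have := congr1 (fun p : {poly R} => p.[x]) Q0.
  rewrite /Q hornerD hornerN hornerC horner_sum horner0 => /eqP; rewrite subr_eq0 => /eqP <-.
  by apply: eq_bigr => nu _; rewrite hornerZ mulrC.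
apply: (@roots_geq_poly_eq0 _ _ [seq cheb_node R n k | k <- iota 0 n]).
- apply/allP => z /mapP[k]; rewrite mem_iota add0n => /= kn ->; apply/rootP.
  rewrite /Q hornerD hornerN hornerC horner_sum (bigD1 (Ordinal kn))//= big1.
    by rewrite addr0 hornerZ mulVf ?subrr// omit_node_neq0.
  move=> i ik; rewrite hornerZ (@omit_node_eq0 i k) ?mulr0// eq_sym.
  by apply: contra ik => /eqP ik; exact/eqP/val_inj.
- rewrite map_inj_in_uniq ?iota_uniq// => k l.
  by rewrite !mem_iota !add0n => /andP[_ kn] /andP[_ ln]; exact: cheb_node_inj.
- rewrite size_map size_iota; apply: (leq_trans (size_polyD _ _)).
  rewrite geq_max size_polyN size_polyC oner_eq0 n0 andbT.
  apply: (leq_trans (size_sum _ _ _)); apply/bigmax_leqP => nu _.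
  apply: (leq_trans (size_scale_leq _ _)).
  apply: (leq_trans (size_poly_prod_leq _ _)).
  rewrite (eq_bigr (fun=> 2%N)); last by move=> k _; rewrite size_XsubC.
  rewrite sum_nat_const (_ : #|_| = n.-1); first by move: n0; case: (n) => // m _ /=; lia.
  by have := cardC1 nu; rewrite card_ord => <-; apply: eq_card => k; rewrite !inE.
Qed.

End nodes.

(** By [cheb_tau_poly] the inner sums are the cofactors times the leading coefficient 2^(2 N + 1),
    which the prefactor of [lagrange_coef] removes. *)
Lemma lagrange_coefE N h x :
  \sum_(0 <= j < N.+1) lagrange_coef N h j * x ^+ j =
  \sum_(nu < N.+1) h (cheb_node R N.+1 nu) *
    ((omit_node N.+1 nu).[x] / (omit_node N.+1 nu).[cheb_node R N.+1 nu]).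
Proof.
rewrite big_mkord.
transitivity (\sum_(nu < N.+1) 1 / 2 ^+ (2 * N + 1) * cheb_zeta N h nu *
    \sum_(j < N.+1) cheb_tau R N.+1 j nu * x ^+ j).
  transitivity (\sum_(j < N.+1) \sum_(nu < N.+1)
      1 / 2 ^+ (2 * N + 1) * cheb_zeta N h nu * (cheb_tau R N.+1 j nu * x ^+ j)).
    apply: eq_bigr => j _; rewrite /lagrange_coef big_mkord mulr_sumr mulr_suml.
    by apply: eq_bigr => nu _; rewrite !mulrA.
  by rewrite exchange_big; apply: eq_bigr => nu _; rewrite mulr_sumr.
apply: eq_bigr => nu _.
have := congr1 (fun p : {poly R} => p.[x]) (cheb_tau_poly (ltn0Sn N) (ltn_ord nu)).
rewrite horner_sum hornerZ (eq_bigr (fun j : 'I_N.+1 => cheb_tau R N.+1 j nu * x ^+ j));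
  last first.
  by move=> j _; rewrite hornerM hornerC hornerXn.
move=> ->; rewrite /cheb_zeta.
have -> : \prod_(0 <= k < N.+1 | k != nu) (cheb_node R N.+1 nu - cheb_node R N.+1 k) =
    (omit_node N.+1 nu).[cheb_node R N.+1 nu].
  by rewrite big_mkord horner_prod; apply: eq_bigr => k _; rewrite hornerXsubC.
have -> : (2 * N.+1 - 1 = 2 * N + 1)%N by lia.
have := @omit_node_neq0 N.+1 (ltn0Sn N) nu (ltn_ord nu).
have : 2 ^+ (2 * N + 1) != 0 :> R by rewrite expf_neq0.
move: (2 ^+ _) => a a0 o0.
by field; rewrite o0 a0.
Qed.

Lemma lagrange_error_node N h k : (k < N.+1)%N ->
  h (cheb_node R N.+1 k) =
  \sum_(0 <= j < N.+1) lagrange_coef N h j * cheb_node R N.+1 k ^+ j.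
Proof.
move=> kN; rewrite lagrange_coefE (bigD1 (Ordinal kN))//= big1 ?addr0.
  by rewrite divff ?mulr1// omit_node_neq0.
move=> i ik; rewrite (@omit_node_eq0 _ i k) ?mul0r ?mulr0// eq_sym.
by apply: contra ik => /eqP ik; exact/eqP/val_inj.
Qed.

(** The basis polynomials sum to 1, which brings h x under the sum. With P = [cheb_poly], each of
    them is P(x) / ((x - x_nu) P'(x_nu)), and P(x) = cos (n t). *)
Lemma lagrange_errorE N h t : let n := N.+1 in let x := 1 / 2 + 1 / 2 * cos t in
  (forall k, (k < n)%N -> x != cheb_node R n k) ->
  h x - \sum_(0 <= j < n) lagrange_coef N h j * x ^+ j =
  \sum_(nu < n) (h x - h (cheb_node R n nu)) *
    ((-1) ^+ nu * cos (n%:R * t) * sin (cheb_angle n nu) /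
     (n%:R * (cos t - cos (cheb_angle n nu)))).
Proof.
move=> n x xn; rewrite lagrange_coefE.
transitivity (h x * (\sum_(nu < n) (omit_node n nu).[x] / (omit_node n nu).[cheb_node R n nu]) -
    \sum_(nu < n) h (cheb_node R n nu) * ((omit_node n nu).[x] / (omit_node n
      nu).[cheb_node R n nu])).
  by rewrite sum_omit_node// mulr1.
rewrite mulr_sumr -sumrB; apply: eq_bigr => nu _; rewrite -mulrBl; congr (_ * _).
have nun := ltn_ord nu.
have o0 := @omit_node_neq0 n (ltn0Sn N) nu nun.
have := @cheb_poly_deriv n (ltn0Sn N) nu nun.
have := congr1 (fun p : {poly R} => p.[x]) (cheb_poly_omit (ltn0Sn N) nun).
rewrite horner_cheb_poly// hornerM hornerZ hornerXsubC.
have := xn _ nun; rewrite -/n -subr_eq0 => d0.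
have : x - cheb_node R n nu = 1 / 2 * (cos t - cos (cheb_angle n nu)).
  by rewrite /x cheb_nodeE; ring.
have s0 : sin (cheb_angle n nu) != 0 :> R.
  by rewrite gt_eqF// sin_gt0_pi//; exact: cheb_angle_itv.
have : 2 ^+ (2 * n - 1) != 0 :> R by rewrite expf_neq0.
have n0 : n%:R != 0 :> R by rewrite pnatr_eq0.
have e1 : (-1) ^+ nu * (-1) ^+ nu = 1 :> R by rewrite -expr2 sqrr_sign.
move: d0 o0 s0 n0 e1.
move: (x - _) (cos t - cos (cheb_angle n nu)) (omit_node n nu).[x] (omit_node n nu).[_]
  (sin _) (2 ^+ (2 * n - 1)) (n%:R : R) (cos (_ * t)) ((-1) ^+ nu).
move=> d c ox on s l m cc e d0 on0 s0 m0 e1 l0 dc H1 H2.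
have c0 : c != 0 by apply: contra d0 => /eqP c0; rewrite dc c0 mulr0.
have lE : l = 2 * m * e / s / on by rewrite -H2 mulfK.
rewrite H1 lE dc; transitivity (e * e * ox / on); first by rewrite e1 mul1r.
by field; rewrite on0 s0 m0 c0.
Qed.

End lagrange.

(** * The interpolation error *)

Section trigonometric_bounds.
Context (R : realType).
Implicit Types (x y b s : R) (n : nat).

Let MVT_sin x y : x < y -> exists2 c, x < c < y & sin y - sin x = cos c * (y - x).
Proof.
move=> xy; have [|c cxy E] := MVT xy (fun z _ => is_derive_sin z).
  by apply: continuous_subspaceT; exact: continuous_sin.
by exists c => //; rewrite in_itv/= in cxy.
Qed.

Lemma cos_lip x y : `|cos x - cos y| <= `|x - y|.
Proof.
wlog xy : x y / x < y.
  move=> H; have [xy|yx|->] := ltgtP x y; [exact: H| |by rewrite !subrr].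
  by rewrite distrC [leRHS]distrC; exact: H.
have [|c _ E] := MVT xy (fun z _ => is_derive_cos z).
  by apply: continuous_subspaceT; exact: continuous_cos.
by rewrite distrC E normrM normrN [leRHS]distrC; apply: ler_piMl => //; exact: sin_max.
Qed.

Lemma sin_le_id x : 0 <= x -> sin x <= x.
Proof.
rewrite le_eqVlt => /predU1P[<-|x0]; first by rewrite sin0.
have [c _] := MVT_sin x0; rewrite sin0 !subr0 => ->.
by apply: ler_piMl (ltW x0) (cos_le1 _).
Qed.

Lemma cos_le_sinc x : 0 <= x <= pi -> x * cos x <= sin x.
Proof.
move=> /andP[]; rewrite le_eqVlt => /predU1P[<-|x0] xpi; first by rewrite sin0 mul0r.
have [c /andP[c0 cx]] := MVT_sin x0; rewrite sin0 !subr0 => ->.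
rewrite mulrC ler_wpM2r ?(ltW x0)// ltW// ltr_cos// in_itv/=.
  by rewrite (ltW c0) (le_trans (ltW cx)).
by rewrite (ltW x0).
Qed.

(** Concavity of sin on [0, pi]: the chord slope sin y / y decreases. *)
Lemma sin_chord y b : 0 <= y <= b -> b <= pi -> y * sin b <= b * sin y.
Proof.
move=> /andP[]; rewrite le_eqVlt => /predU1P[<-|y0]; first by rewrite mul0r sin0 mulr0.
rewrite le_eqVlt => /predU1P[->//|yb] bpi.
have [c1 /andP[c10 c1y]] := MVT_sin y0; rewrite sin0 !subr0 => E1.
have [c2 /andP[yc2 c2b] E2] := MVT_sin yb.
have : cos c2 < cos c1.
  rewrite ltr_cos ?in_itv/=; first exact: lt_trans yc2.
    by rewrite (ltW c10) (le_trans (ltW (lt_trans c1y yb))).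
  by rewrite (ltW (lt_trans y0 yc2)) (le_trans (ltW c2b)).
have -> : sin b = cos c2 * (b - y) + sin y by rewrite -E2 subrK.
rewrite E1 -subr_ge0 => c12.
have -> : b * (cos c1 * y) - y * (cos c2 * (b - y) + cos c1 * y) =
  y * (b - y) * (cos c1 - cos c2) by ring.
by rewrite !mulr_ge0// ?subr_ge0 ltW.
Qed.

(** The triple-angle formula makes s = sin (pi / 6) a positive root of (s + 1) (2 s - 1)^2, so s =
    1/2, and s <= pi / 6. *)
Lemma pi_ge3 : 3 <= pi :> R.
Proof.
have p0 := pi_gt0 R; set s := sin (pi / 6 : R).
have s0 : 0 < s by apply: sin_gt0_pi; apply/andP; split; lra.
have : sin (pi / 2 : R) = 3 * s - 4 * s ^+ 3.
  have -> : pi / 2 = pi / 6 + (pi / 6) *+ 2 :> R by rewrite -mulr_natl; field.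
  rewrite sinD sin_mulr2n cos_mulr2n -/s.
  have := cos2sin2 (pi / 6 : R); rewrite -/s => H.
  transitivity (s * (2 * cos (pi / 6) ^+ 2 - 1) + 2 * cos (pi / 6) ^+ 2 * s);
    first by rewrite !mulr2n; ring.
  by rewrite H; ring.
rewrite sin_pihalf => H.
have /eqP : (s + 1) * (2 * s - 1) ^+ 2 = 0.
  have -> : (s + 1) * (2 * s - 1) ^+ 2 = 1 - (3 * s - 4 * s ^+ 3) by ring.
  by rewrite -H subrr.
rewrite mulf_eq0 expf_eq0/= => /orP[/eqP|/eqP] sE; first by lra.
have : s <= pi / 6 by apply: sin_le_id; lra.
by lra.
Qed.

Lemma pi_le4 : pi <= 4 :> R.
Proof. by have := pihalf_lt2 R; lra. Qed.

(** By symmetry s <= 1/2. With u = 1/2 - s the claim reads cos (pi u) <= 1 - 4 u^2, that is, sin (pi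
    u / 2)^2 >= 2 u^2. This is the square of the chord inequality on [0, pi / 4], as sin (pi / 4)^2
    = 1/2. *)
Lemma sin_le_parabola s : 0 <= s <= 1 -> sin (pi * s) <= 4 * s * (1 - s).
Proof.
have p0 := pi_gt0 R.
wlog s2 : s / s <= 1 / 2.
  move=> H s01; have [/H|s2] := leP s (1 / 2); first exact.
  have -> : pi * s = - (pi * (1 - s)) + pi by ring.
  rewrite sinDpi sinN opprK (le_trans (H _ _ _))//; [lra|lra|].
  by rewrite le_eqVlt; apply/orP; left; apply/eqP; ring.
move=> /andP[s0 _]; set u := 1 / 2 - s; set b : R := pi / 4.
have u0 : 0 <= u <= 1 / 2 by rewrite /u; apply/andP; split; lra.
set y := pi * u / 2.
have yb : 0 <= y <= b by rewrite /y /b; apply/andP; split; nra.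
have sb : sin b ^+ 2 = 1 / 2.
  have := cos_mulr2n b; rewrite (_ : b *+ 2 = pi / 2); last by rewrite /b -mulr_natl; field.
  by rewrite cos_pihalf cos2sin2 -mulr_natl; lra.
have b0 : 0 < b by rewrite /b; lra.
have bpi : b <= pi by rewrite /b; lra.
have sb0 : 0 <= sin b by apply: sin_ge0_pi; rewrite (ltW b0).
have chord := sin_chord yb bpi.
have : (y * sin b) ^+ 2 <= (b * sin y) ^+ 2.
  rewrite lerXn2r ?nnegrE//; first by rewrite mulr_ge0//; case/andP: yb.
  by rewrite (le_trans _ chord)// mulr_ge0//; case/andP: yb.
rewrite !exprMn sb => H.
have -> : pi * s = - (y *+ 2) + pi / 2 by rewrite /y /u -mulr_natl; field.
rewrite sinDpihalf cosN cos_mulr2n cos2sin2 -mulr_natl.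
suff : 2 * u ^+ 2 <= sin y ^+ 2 by rewrite /u; nra.
by rewrite -(ler_pM2l (exprn_gt0 2 p0)); lra.
Qed.

(** The difference of the two sides has derivative z^2 / ((1 + z) (2 + z)^2) >= 0. For x = 1 / n
    this becomes 2 / (2 n + 1) <= ln ((n + 1) / n), the induction step of [sum_inv_odd_le]. *)
Lemma ln_ge_ratio x : 0 <= x -> 2 * x / (2 + x) <= ln (1 + x).
Proof.
rewrite le_eqVlt => /predU1P[<-|x0]; first by rewrite mulr0 mul0r addr0 ln1.
pose F (z : R) := ln (1 + z) + 4 * (2 + z)^-1.
have dF (z : R) : 0 <= z -> is_derive z 1 F (z ^+ 2 / ((1 + z) * (2 + z) ^+ 2)).
  move=> z0; have z1 : 0 < 1 + z by lra.
  have z2 : 2 + z != 0 by rewrite gt_eqF//; lra.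
  have H1 : is_derive z (1 : R) (fun z => 1 + z) 1.
    by have := is_deriveD (is_derive_cst (1 : R) z (1 : R)) (is_derive_id z (1 : R));
      rewrite add0r.
  have H2 : is_derive z (1 : R) (fun z => 2 + z) 1.
    by have := is_deriveD (is_derive_cst (2 : R) z (1 : R)) (is_derive_id z (1 : R));
      rewrite add0r.
  have H3 := is_derive1_comp (is_derive1_ln z1) H1.
  have H4 : is_derive z (1 : R) (fun z => (2 + z)^-1) (- (2 + z) ^- 2 *: (1 : R)).
    by split; [apply: derivableV|rewrite deriveV// derive_val].
  have H5 : is_derive z 1 (4 \*: (fun z => (2 + z)^-1)) (4 *: (- (2 + z) ^- 2 *: (1 : R))).
    exact: is_deriveZ.
  apply: (@is_derive_eq _ _ _ _ _ _ _ _ (is_deriveD H3 H5)).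
  rewrite /GRing.scale /= !mulr1; field.
  by rewrite z2 gt_eqF.
have dFI z : z \in `]0, x[ -> is_derive z 1 F (z ^+ 2 / ((1 + z) * (2 + z) ^+ 2)).
  by rewrite in_itv/= => /andP[/ltW z0 _]; exact: dF.
have [|c] := MVT x0 dFI.
  apply: continuous_in_subspaceT => z; rewrite inE/= in_itv/= => /andP[z0 _].
  by apply/differentiable_continuous/derivable1_diffP; have [] := dF z z0.
rewrite in_itv/= => /andP[c0 _]; rewrite subr0 => E.
have : 0 <= F x - F 0.
  by rewrite E mulr_ge0 ?(ltW x0)// divr_ge0 ?sqr_ge0// mulr_ge0 ?sqr_ge0//; lra.
rewrite /F addr0 ln1 addr0 add0r => H.
have -> : 2 * x / (2 + x) = 4 * 2^-1 - 4 * (2 + x)^-1 by field; rewrite gt_eqF//; lra.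
by lra.
Qed.

Lemma sum_inv_odd_le n : (0 < n)%N ->
  \sum_(i < n) (2 * i + 1)%:R^-1 <= 1 + 1 / 2 * ln n%:R :> R.
Proof.
case: n => // n _; elim: n => [|n IH].
  by rewrite big_ord1 ln1 mulr0 addr0 invr1.
rewrite big_ord_recr/=; apply: (le_trans (lerD IH (lexx _))).
have := @ln_ge_ratio n.+1%:R^-1 ltac:(by rewrite invr_ge0).
have n0 : 0 < n.+1%:R :> R by [].
have -> : 1 + n.+1%:R^-1 = n.+2%:R / n.+1%:R :> R.
  by rewrite -[n.+2%:R]natr1 mulrDl divff ?gt_eqF// mul1r.
rewrite ln_div ?posrE//.
have -> : 2 * n.+1%:R^-1 / (2 + n.+1%:R^-1) = 2 * (2 * n.+1 + 1)%:R^-1 :> R.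
  rewrite natrD natrM; move: (n.+1%:R : R) n0 => m m0; field.
  by rewrite !gt_eqF//; lra.
by lra.
Qed.

(* Summation by parts: D 0 * T is the value of the sum for constant D. *)
Lemma alternating_sum_bound n (w D : nat -> R) (om : R) :
  (forall i, w i.+1 <= w i) -> (forall i, 0 <= w i) ->
  (forall i, `|D i.+1 - D i| <= 2 * om) ->
  let T := \sum_(i < n) (-1) ^+ i * w i in
  0 <= T <= w 0 /\
  `|\sum_(i < n) (-1) ^+ i * w i * D i - D 0 * T| <= om * (\sum_(i < n) w i - T).
Proof.
elim: n w D => [|n IH] w D wd w0 dD /=.
  by rewrite !big_ord0 mulr0 !subrr normr0 mulr0 lexx w0.
have [/andP[T0 T1] H] := IH (fun i => w i.+1) (fun i => D i.+1)
  (fun i => wd i.+1) (fun i => w0 i.+1) (fun i => dD i.+1).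
rewrite !big_ord_recl/= expr0 !mul1r.
have -> : \sum_(i < n) (-1) ^+ lift ord0 i * w (lift ord0 i) =
    - \sum_(i < n) (-1) ^+ i * w i.+1.
  by rewrite -sumrN; apply: eq_bigr => i _; rewrite exprS mulN1r mulNr.
have -> : \sum_(i < n) (-1) ^+ lift ord0 i * w (lift ord0 i) * D (lift ord0 i) =
    - \sum_(i < n) (-1) ^+ i * w i.+1 * D i.+1.
  by rewrite -sumrN; apply: eq_bigr => i _; rewrite exprS mulN1r !mulNr.
set T := \sum_(i < n) _ * w _.
have -> : \sum_(i < n) w (lift ord0 i) = \sum_(i < n) w i.+1 by apply: eq_bigr.
move: H; rewrite -/T; move: T0 T1; rewrite -/T.
move: (\sum_(i < n) (_ * D _)) (\sum_(i < n) w _) => S W T0 T1 H.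
split; first by have := wd 0%N; move=> ?; apply/andP; split; lra.
have -> : w 0%N * D 0%N - S - D 0%N * (w 0%N - T) =
  - ((S - D 1%N * T) + (D 1%N - D 0%N) * T) by ring.
rewrite normrN (le_trans (ler_normD _ _))// normrM (ger0_norm T0).
have := ler_wpM2r T0 (dD 0%N); lra.
Qed.

Definition cot x := cos x / sin x.

Lemma cot_le x : 0 < x <= pi -> cot x <= x^-1.
Proof.
move=> /andP[x0]; rewrite le_eqVlt => /predU1P[->|xpi].
  by rewrite /cot sinpi invr0 mulr0 invr_ge0 pi_ge0.
have s0 : 0 < sin x by rewrite sin_gt0_pi// x0.
rewrite /cot ler_pdivrMr// mulrC ler_pdivlMr// mulrC cos_le_sinc//.
by rewrite (ltW x0) ltW.
Qed.

Lemma cot_decr x y : 0 < x <= y -> y < pi -> cot y <= cot x.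
Proof.
move=> /andP[x0 xy] ypi.
have sx : 0 < sin x by rewrite sin_gt0_pi// x0 (le_lt_trans xy).
have sy : 0 < sin y by rewrite sin_gt0_pi// (lt_le_trans x0 xy).
rewrite /cot ler_pdivrMr// mulrAC ler_pdivlMr// -subr_ge0.
rewrite [cos x * _]mulrC -sinB; apply: sin_ge0_pi; apply/andP; split; lra.
Qed.

Lemma cot_ge0 x : 0 <= x <= pi / 2 -> 0 <= cot x.
Proof.
move=> /andP[x0 xp]; have p0 := pi_gt0 R.
rewrite /cot divr_ge0// ?cos_ge0_pihalf ?sin_ge0_pi//; apply/andP; split; lra.
Qed.

End trigonometric_bounds.

(** * The weights of the interpolation error *)

Section lebesgue_function.
Context (R : realType).
Implicit Types (s om del : R) (n i : nat) (D : nat -> R).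

Let pi0 : 0 < pi :> R. Proof. exact: pi_gt0. Qed.

(* The interpolation error at t splits into two such sums, one over the nodes to
   the right of t, at distances (i + s) pi / n, and one over those to its left. *)
Definition cot_sum n s D : R := \sum_(i < n) (-1) ^+ i * cot ((i%:R + s) * pi / (2 * n)%:R)
  * D i.

(** [del] measures the excess of |D 0| over [om]. Since D 0 multiplies the alternating sum T <= w 0,
    the excess costs at most [del] times the first weight, itself at most 2 n / (pi s). *)
Lemma cot_sum_bound n s D om del : (0 < n)%N -> 0 < s < 1 -> 0 <= om -> 0 <= del ->
  `|D 0%N| <= (1 + del) * om -> del <= 1 -> (forall i, `|D i.+1 - D i| <= 2 * om) ->
  `|cot_sum n s D| <=
    om * ((2 * n)%:R / pi * (\sum_(i < n) (i%:R + s)^-1 + del / s)).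
Proof.
move=> n0 /andP[s0 s1] om0 del0 D0 del1 dD.
have n2 : 0 < (2 * n)%:R :> R by rewrite ltr0n; lia.
have pi2 : pi / 2 < pi :> R by rewrite ltr_pdivrMr// ltr_pMr// ltr1n.
pose x i : R := (i%:R + s) * pi / (2 * n)%:R.
have x0 i : 0 < x i by rewrite divr_gt0// mulr_gt0// ltr_wpDl.
have xpi i : (i < n)%N -> x i <= pi / 2.
  move=> i_n; rewrite /x ler_pdivrMr//.
  have -> : pi / 2 * (2 * n)%:R = n%:R * pi :> R by rewrite natrM; field.
  rewrite ler_pM2r//; have : i.+1%:R <= n%:R :> R by rewrite ler_nat.
  by rewrite -natr1; lra.
(* Weights equal to 0 from index n on stay nonincreasing for all indices. *)
pose w i := if (i < n)%N then cot (x i) else 0.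
have wd i : w i.+1 <= w i.
  rewrite /w; have [i1n|i1n] := ltnP i.+1 n.
    rewrite (ltnW i1n); apply: cot_decr.
      rewrite x0 /x ler_pM2r ?invr_gt0// ler_pM2r//.
      by rewrite lerD2r ler_nat ltnW.
    exact: le_lt_trans (xpi _ i1n) pi2.
  case: ifP => // i_n; apply: cot_ge0.
  by rewrite ltW// xpi.
have w0 i : 0 <= w i.
  by rewrite /w; case: ifP => // i_n; rewrite cot_ge0// ltW//= xpi.
have := alternating_sum_bound n wd w0 dD; rewrite /=.
set T := \sum_(i < n) _ * w _ => -[/andP[T0 T1]].
have -> : \sum_(i < n) (-1) ^+ i * w i * D i = cot_sum n s D.
  by apply: eq_bigr => i _; rewrite /w ltn_ord.
move=> H.
have Hw : \sum_(i < n) w i + del * w 0%N <=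
    (2 * n)%:R / pi * (\sum_(i < n) (i%:R + s)^-1 + del / s).
  have cx i : (i < n)%N -> w i <= (2 * n)%:R / pi * (i%:R + s)^-1.
    move=> i_n; rewrite /w i_n (le_trans (cot_le _))//.
      by rewrite x0 (le_trans (xpi _ i_n))// ltW.
    by rewrite /x invf_div mulrC invfM [in leRHS]mulrC -mulrA; lra.
  rewrite mulrDr mulr_sumr lerD//; first by apply: ler_sum => i _; exact: cx.
  by rewrite mulrCA ler_wpM2l//; have := cx 0%N n0; rewrite add0r.
rewrite (le_trans _ (ler_wpM2l om0 Hw))//.
have -> : cot_sum n s D = (cot_sum n s D - D 0%N * T) + D 0%N * T by rewrite subrK.
rewrite (le_trans (ler_normD _ _))// normrM (ger0_norm T0).
have := ler_wpM2r T0 D0; have := ler_wpM2l (mulr_ge0 om0 del0) T1; lra.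
Qed.

(** With p = s (1 - s) <= 1/4, the i-th term on the left is p (2 i + 1) / (i (i + 1) + p). It is
    nondecreasing in p and equals 1 / (2 i + 1) at p = 1/4. *)
Lemma weight_sum_bound n s : 0 < s < 1 ->
  s * (1 - s) * (\sum_(i < n) (i%:R + s)^-1 + \sum_(i < n) (i%:R + (1 - s))^-1) <=
  \sum_(i < n) (2 * i + 1)%:R^-1.
Proof.
move=> /andP[s0 s1]; rewrite -big_split/= mulr_sumr; apply: ler_sum => i _.
rewrite natrD natrM; move: (i%:R : R) (ler0n R i) => {}i i0.
have a0 : 0 < i + s by lra.
have b0 : 0 < i + (1 - s) by lra.
have -> : s * (1 - s) * ((i + s)^-1 + (i + (1 - s))^-1) =
    s * (1 - s) * (2 * i + 1) / ((i + s) * (i + (1 - s))).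
  by field; rewrite !gt_eqF.
have c0 : 0 < 2 * i + 1 by lra.
rewrite ler_pdivrMr ?mulr_gt0// [leRHS]mulrC ler_pdivlMr//.
have := mulr_ge0 (addr_ge0 (mulr_ge0 i0 i0) i0) (sqr_ge0 (s - 1 / 2)); lra.
Qed.

Lemma lagrange_sum_bound N s D D' om : let n := N.+1 in (0 < N)%N -> 0 < s < 1 -> 0 <= om ->
  (forall i, `|D i.+1 - D i| <= 2 * om) -> (forall i, `|D' i.+1 - D' i| <= 2 * om) ->
  `|D 0%N| <= 2 * om -> `|D' 0%N| <= 2 * om ->
  (s * pi / n%:R <= 2 / N%:R -> `|D 0%N| <= om) ->
  ((1 - s) * pi / n%:R <= 2 / N%:R -> `|D' 0%N| <= om) ->
  sin (pi * s) / (2 * n)%:R * `|cot_sum n s D + cot_sum n (1 - s) D'| <=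
  (2 + 2 / pi * ln N%:R) * om.
Proof.
move=> n N0 s01 om0 dD dD' D2 D2' D1 D1'; have p0 : 0 < pi :> R := pi0.
have s01' : 0 < 1 - s < 1 by case/andP: s01 => ? ?; apply/andP; split; lra.
have NR : 0 < N%:R :> R by rewrite ltr0n.
have nR : 0 < n%:R :> R by [].
(* [del] is 1 when the nearest node on the right is farther than 2 / N, in which case |D 0| <= 2
   [om] is used, and 0 otherwise; [del'] does the same on the left. *)
pose del : R := ((2 / N%:R : R) < s * pi / n%:R)%R%:R.
pose del' : R := ((2 / N%:R : R) < (1 - s) * pi / n%:R)%R%:R.
have H := @cot_sum_bound n s D om del isT s01 om0 _ _ _ dD.
have H' := @cot_sum_bound n (1 - s) D' om del' isT s01' om0 _ _ _ dD'.
have {}H : `|cot_sum n s D| <= om * ((2 * n)%:R / pi * (\sum_(i < n) (i%:R + s)^-1 + del / s)).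
  apply: H; rewrite /del; [by []| |by case: (_ < _)].
  by case: ltP => //= ?; rewrite addr0 mul1r D1.
have {}H' : `|cot_sum n (1 - s) D'| <=
    om * ((2 * n)%:R / pi * (\sum_(i < n) (i%:R + (1 - s))^-1 + del' / (1 - s))).
  apply: H'; rewrite /del'; [by []| |by case: (_ < _)].
  by case: ltP => //= ?; rewrite addr0 mul1r D1'.
have := weight_sum_bound n s01.
have : \sum_(i < n) (2 * i + 1)%:R^-1 <= 1 + 1 / 2 * ln n%:R :> R by exact: sum_inv_odd_le.
move: (\sum_(i < n) (2 * i + 1)%:R^-1) H H' => W.
move: (\sum_(i < n) _) (\sum_(i < n) _) => S' S H H' HW HS.
have n2 : 0 < (2 * n)%:R :> R by [].
have [s0 s1] := andP s01.
have sn0 : 0 <= sin (pi * s) by apply: sin_ge0_pi; apply/andP; split; nra.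
have snp : sin (pi * s) <= 4 * s * (1 - s) by apply: sin_le_parabola; rewrite !ltW.
have step : sin (pi * s) / (2 * n)%:R * `|cot_sum n s D + cot_sum n (1 - s) D'| <=
    om * (4 / pi * (W + del * (1 - s) + del' * s)).
  apply: (@le_trans _ _ (4 * s * (1 - s) / (2 * n)%:R *
      (om * ((2 * n)%:R / pi * (S + del / s)) + om * ((2 * n)%:R / pi * (S' + del' / (1 -
        s)))))).
    apply: ler_pM => //; first by rewrite divr_ge0// ltW.
      by rewrite ler_pM2r// invr_gt0.
    by rewrite (le_trans (ler_normD _ _))// lerD.
  have -> : 4 * s * (1 - s) / (2 * n)%:R *
      (om * ((2 * n)%:R / pi * (S + del / s)) + om * ((2 * n)%:R / pi * (S' + del' / (1 -
        s)))) =
      om * (4 / pi * (s * (1 - s) * (S + S') + del * (1 - s) + del' * s)).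
    field; rewrite !gt_eqF//; lra.
  by rewrite ler_wpM2l// ler_wpM2l//; [rewrite divr_ge0// ltW|rewrite !lerD2r].
rewrite (le_trans step)// mulrC ler_wpM2r//.
have lnN : ln n%:R <= ln N%:R + N%:R^-1 :> R.
  have -> : n%:R = N%:R * (1 + N%:R^-1) :> R by rewrite /n -natr1 mulrDr mulr1 divff// gt_eqF.
  rewrite lnM ?posrE ?ltr_wpDr// ?invr_ge0 ?ler0n//.
  by rewrite lerD2l; apply: le_ln1Dx; rewrite (lt_trans (ltrN10 _))// invr_gt0.
have pi3 := pi_ge3 R; have pi4 := pi_le4 R.
have N1 : N%:R^-1 <= 1 :> R by rewrite invf_le1// ler1n.
have Ni : 0 < N%:R^-1 :> R by rewrite invr_gt0.
(* At most one of [del] and [del'] is 1: they require s, respectively 1 - s, to exceed 2 (1 + 1 / N)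
   / pi, which is at least 1/2 as pi <= 4. The factor 1 - s or s is then smaller than 1 minus this
   threshold. *)
have E : W + del * (1 - s) + del' * s <= 1 + 1 / 2 * (ln N%:R + N%:R^-1) +
    Num.max 0 (1 - 2 * (1 + N%:R^-1) / pi).
  have nE : n%:R = N%:R * (1 + N%:R^-1) :> R by rewrite /n -natr1 mulrDr mulr1 divff// gt_eqF.
  have tr (z : R) : 2 / N%:R < z * pi / n%:R -> 2 * (1 + N%:R^-1) / pi < z.
    rewrite ltr_pdivlMr// => h; rewrite ltr_pdivrMr//; move: h; rewrite nE.
    by rewrite -[2 / _ * _]mulrA mulKf ?gt_eqF.
  have : 1 / 2 <= 2 * (1 + N%:R^-1) / pi :> R by rewrite ler_pdivlMr//; lra.
  move: (tr s) (tr (1 - s)); rewrite /del /del' => t1 t2 h.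
  move: (2 * (1 + N%:R^-1) / pi) t1 t2 h => M t1 t2 h.
  have M0 : 0 <= Num.max 0 (1 - M) by rewrite le_max lexx.
  have MM : 1 - M <= Num.max 0 (1 - M) by rewrite le_max lexx orbT.
  by case: ltP => [/t1 h1|_]; case: ltP => [/t2 h2|_] /=; rewrite ?mul1r ?mul0r; lra.
have L0 : 0 <= ln N%:R :> R by rewrite ln_ge0// ler1n.
apply: (@le_trans _ _ (4 / pi * (1 + 1 / 2 * (ln N%:R + N%:R^-1) + Num.max 0 (1 -
  2 * (1 + N%:R^-1) / pi)))).
  by rewrite ler_wpM2l// divr_ge0// ltW.
move: (N%:R^-1 : R) N1 Ni => v v1 v0; rewrite -(ler_pM2r pi0).
have -> : 4 / pi * (1 + 1 / 2 * (ln N%:R + v) + Num.max 0 (1 - 2 * (1 + v) / pi)) * pi =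
  4 * (1 + 1 / 2 * (ln N%:R + v) + Num.max 0 (1 - 2 * (1 + v) / pi)).
  by rewrite [LHS]mulrAC divfK// gt_eqF.
have -> : (2 + 2 / pi * ln N%:R) * pi = 2 * pi + 2 * ln N%:R :> R.
  by rewrite mulrDl [2 / pi * _ * _]mulrAC divfK// gt_eqF.
have [h|h] := leP 0 (1 - 2 * (1 + v) / pi); last by lra.
suff : 8 + 2 * v - 8 * (1 + v) / pi <= 2 * pi by lra.
(* After multiplication by pi, the difference of the two sides is 2 (pi - 2)^2 + 2 v (4 - pi). *)
rewrite -(ler_pM2r pi0) mulrBl divfK ?gt_eqF//; nra.
Qed.

End lebesgue_function.

(** * The error as an alternating sum of cotangents *)

Section lagrange_error.
Context (R : realType).
Implicit Types (h : R -> R) (t x : R) (k i : nat).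

Lemma sum_periodic (V : zmodType) (F : nat -> V) p m : (forall k, F (k + p)%N = F k) ->
  \sum_(k < p) F (m + k)%N = \sum_(k < p) F k.
Proof.
move=> Fp; elim: m => [|m IH]; first exact: eq_bigr.
rewrite -IH; case: p Fp {IH} => [|p] Fp; first by rewrite !big_ord0.
rewrite big_ord_recr [RHS]big_ord_recl/= addrC addn0 addSnnS Fp.
by congr (_ + _); apply: eq_bigr => k _; rewrite /bump /= add1n addSnnS.
Qed.

Lemma cotN x : cot (- x) = - cot x.
Proof. by rewrite /cot cosN sinN invrN mulrN. Qed.

Lemma cotDpi x : cot (x + pi) = cot x.
Proof. by rewrite /cot cosDpi sinDpi invrN mulrNN. Qed.

(** Half-angle formulas. Up to sign, the second cotangent is the first one at the reflected angle -
    y; this is why each node will occur twice. *)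
Lemma sin_over_cosB x y : cos x != cos y ->
  sin y / (cos x - cos y) = 1 / 2 * (cot ((y - x) / 2) + cot ((y + x) / 2)).
Proof.
move=> xy; set b := (y - x) / 2; set a := (y + x) / 2.
have yE : y = a + b by rewrite /a /b; field.
have xE : x = a - b by rewrite /a /b; field.
have cE : cos x - cos y = 2 * (sin a * sin b) by rewrite xE yE cosB cosD; ring.
have : cos x - cos y != 0 by rewrite subr_eq0.
rewrite cE mulf_eq0 negb_or mulf_eq0 negb_or => /and3P[_ a0 b0].
rewrite yE sinD /cot; field; by rewrite a0 b0.
Qed.

Variables (N : nat) (h : R -> R) (t : R).
Let n := N.+1.
Let G u := h (1 / 2 + 1 / 2 * cos u).
Let F k := (-1) ^+ k * cot ((cheb_angle R n k - t) / 2) * (G t - G (cheb_angle R n k)).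

Let n0 : n%:R != 0 :> R. Proof. by rewrite pnatr_eq0. Qed.

Let angleD k i : cheb_angle R n (k + i) = cheb_angle R n k + i%:R * pi / n%:R.
Proof. by rewrite /cheb_angle mulnDr addnAC natrD !natrM; field. Qed.

Let angle_period k : cheb_angle R n (k + 2 * n) = cheb_angle R n k + pi *+ 2.
Proof. by rewrite angleD natrM mulrAC mulfK// mulr_natl. Qed.

Let G_period u : G (u + pi *+ 2) = G u.
Proof. by rewrite /G cosD2pi. Qed.

Let F_period k : F (k + 2 * n) = F k.
Proof.
rewrite /F angle_period G_period.
have -> : (cheb_angle R n k + pi *+ 2 - t) / 2 = (cheb_angle R n k - t) / 2 + pi.
  by rewrite mulr2n; field.
by rewrite cotDpi mul2n -addnn exprD exprD -expr2 sqrr_sign mulr1.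
Qed.

(** Index 2 n - 1 - k carries the angle 2 pi - t_k, where G takes the same value. Its opposite
    parity cancels the sign coming from the odd function [cot]. *)
Let F_rev k : (k < n)%N ->
  F (n + (n - k.+1)) = (-1) ^+ k * cot ((cheb_angle R n k + t) / 2) * (G t -
    G (cheb_angle R n k)).
Proof.
move=> kn; rewrite /F.
have -> : cheb_angle R n (n + (n - k.+1)) = - cheb_angle R n k + pi *+ 2.
  apply: (@addIr _ (cheb_angle R n k)); rewrite addrAC addNr add0r.
  rewrite /cheb_angle ![(2 * _ + 1)%:R]natrD ![(2 * _)%:R]natrM.
  have -> : (n + (n - k.+1))%:R = 2 * n%:R - k%:R - 1 :> R.
    by rewrite natrD natrB// -natr1; ring.
  by rewrite -mulr_natl; field.
rewrite G_period {2}/G cosN -/(G _).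
have -> : (- cheb_angle R n k + pi *+ 2 - t) / 2 = - ((cheb_angle R n k + t) / 2) + pi.
  by rewrite mulr2n; field.
rewrite cotDpi cotN; have -> : (n + (n - k.+1) = 2 * (n - k.+1) + k.+1)%N by lia.
by rewrite exprD exprM sqrrN !expr1n mul1r exprS mulN1r mulrNN.
Qed.

(* The nodes are continued 2 n-periodically to all indices, each one occurring
   twice per period since the cosine is even. *)
Lemma lagrange_cot_sum : (forall k, (k < n)%N -> cos t != cos (cheb_angle R n k)) ->
  G t - \sum_(0 <= j < n) lagrange_coef N h j * (1 / 2 + 1 / 2 * cos t) ^+ j =
  cos (n%:R * t) / (2 * n)%:R * \sum_(k < 2 * n) F k.
Proof.
move=> tn; rewrite /G lagrange_errorE; last first.
  have c0 : 1 / 2 != 0 :> R by rewrite mulf_neq0.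
  by move=> k kn; rewrite cheb_nodeE (inj_eq (addrI _)) (inj_eq (mulfI c0)) tn.
have -> : \sum_(k < 2 * n) F k = \sum_(k < n) (F k + F (n + (n - k.+1))).
  rewrite mul2n -addnn big_split_ord big_split /=; congr (_ + _).
  by rewrite [LHS](reindex_inj rev_ord_inj).
rewrite mulr_sumr; apply: eq_bigr => nu _.
have nun := ltn_ord nu; rewrite F_rev// /F -!/(G _) -mulrDl -mulrDr.
have -> : (-1) ^+ nu * cos (n%:R * t) * sin (cheb_angle R n nu) /
    (n%:R * (cos t - cos (cheb_angle R n nu))) =
    (-1) ^+ nu * cos (n%:R * t) / n%:R *
    (sin (cheb_angle R n nu) / (cos t - cos (cheb_angle R n nu))).
  by rewrite invfM; ring.
rewrite -[G ((2 * nu + 1)%:R * pi / _)]/(G (cheb_angle R n nu)) sin_over_cosB ?tn//.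
move: (cheb_angle R n nu) (cot _) (cot _) (cos _) (G _) (G _) ((-1) ^+ nu).
move=> a c1 c2 c g1 g2 e; rewrite natrM; field.
by [].
Qed.

(** In the application q indexes the nearest node to the right of t and s lies in ]0, 1[, the
    distance being measured in spacings pi / n. The condition n <= q leaves room for n natural
    indices below q. *)
Variables (s : R) (q : nat).
Hypothesis qs : cheb_angle R n q - t = s * pi / n%:R.
Hypothesis nq : (n <= q)%N.

Let F_right i : F (q + i) =
  (-1) ^+ q * ((-1) ^+ i * cot ((i%:R + s) * pi / (2 * n)%:R) * (G t -
    G (cheb_angle R n (q + i)))).
Proof.
rewrite /F; have -> : (cheb_angle R n (q + i) - t) / 2 = (i%:R + s) * pi / (2 * n)%:R.
  by rewrite angleD addrAC qs natrM; field.
by rewrite exprD !mulrA.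
Qed.

Let F_left i : (i < n)%N -> F (q - 1 - i) =
  (-1) ^+ q * ((-1) ^+ i * cot ((i%:R + (1 - s)) * pi / (2 * n)%:R) *
    (G t - G (cheb_angle R n (q - 1 - i)))).
Proof.
move=> i_n; have [k -> qE] : exists2 k, (q - 1 - i)%N = k & q = (k + i.+1)%N.
  by exists (q - 1 - i)%N => //; lia.
rewrite /F.
have -> : (cheb_angle R n k - t) / 2 = - ((i%:R + (1 - s)) * pi / (2 * n)%:R).
  have -> : cheb_angle R n k - t = s * pi / n%:R - i.+1%:R * pi / n%:R.
    by rewrite -qs qE angleD; ring.
  by rewrite -natr1 natrM; field.
have ee : (-1) ^+ i * (-1) ^+ i = 1 :> R by rewrite -expr2 sqrr_sign.
rewrite cotN qE exprD exprS; move: (cot _) (G t - _) ((-1) ^+ k) ((-1) ^+ i) ee => c g e f ee.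
by transitivity (- (f * f) * (e * c * g)); [rewrite ee|]; ring.
Qed.

(** By periodicity the sum may start at q - n. The upper half of this period lies to the right of t;
    the lower half, read backwards, lies to its left. *)
Lemma sum_F_shift : \sum_(k < 2 * n) F k = (-1) ^+ q *
  (cot_sum n s (fun i => G t - G (cheb_angle R n (q + i))) +
   cot_sum n (1 - s) (fun i => G t - G (cheb_angle R n (q - 1 - i)))).
Proof.
rewrite -(sum_periodic (q - n) F_period) mul2n -addnn big_split_ord/= addrC mulrDr.
congr (_ + _); rewrite /cot_sum mulr_sumr.
  by apply: eq_bigr => i _; rewrite -F_right; congr F; have := ltn_ord i; lia.
rewrite (reindex_inj rev_ord_inj)/=; apply: eq_bigr => i _.
by rewrite -F_left//; congr F; have := ltn_ord i; lia.
Qed.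

Lemma cos_nt : cos (n%:R * t) = (-1) ^+ q * sin (pi * s).
Proof.
have -> : n%:R * t = (pi / 2 - pi * s) + q%:R * pi.
  have -> : t = cheb_angle R n q - s * pi / n%:R by rewrite -qs; ring.
  by rewrite mulrBr mul_cheb_angle// [n%:R * (_ / _)]mulrC divfK//; ring.
by rewrite cos_addkpi -opprB cosN cosBpihalf.
Qed.

End lagrange_error.

(** * The uniform bound for the interpolation error *)

Section lagrange_bound.
Context (R : realType).
Variables (N : nat) (h : R -> R) (M : R).
Hypothesis N0 : (0 < N)%N.
Hypothesis hM : forall l, l \in `[0, 1] -> `|h l| <= M.
Let n := N.+1.
Let om := modulus h N%:R^-1.
Let G u := h (1 / 2 + 1 / 2 * cos u).

Let NR : 0 < N%:R :> R. Proof. by rewrite ltr0n. Qed.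

Let nR : 0 < n%:R :> R. Proof. by []. Qed.

Let cos_itv (u : R) : 1 / 2 + 1 / 2 * cos u \in `[0, 1].
Proof. by rewrite in_itv/=; have := cos_le1 u; have := cos_geN1 u => ? ?; apply/andP;
  split; lra. Qed.

Let om0 : 0 <= om.
Proof.
have z01 : (0 : R) \in `[0, 1] by rewrite in_itv/= lexx ler01.
have := @modulus_ub R h M N%:R^-1 0 0 hM z01 z01; rewrite !subrr normr0 => -> //.
Qed.

(** The map 1/2 + 1/2 cos is Lipschitz with constant 1/2, so an angle 2 / N moves the point by at
    most 1 / N. *)
Let G_modulus k u v : `|u - v| <= k%:R * (2 / N%:R) -> `|G u - G v| <= k%:R * om.
Proof.
move=> uv; apply: (@modulus_chain R h om N%:R^-1 _ k); [|exact: cos_itv|exact: cos_itv|].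
  by move=> l1 l2 l1I l2I l12; exact: modulus_ub hM l1I l2I l12.
have -> : 1 / 2 + 1 / 2 * cos u - (1 / 2 + 1 / 2 * cos v) = 1 / 2 * (cos u - cos v) by ring.
rewrite normrM ger0_norm ?divr_ge0//.
have := le_trans (cos_lip u v) uv; rewrite mulrCA; lra.
Qed.

Let angleS k : cheb_angle R n k.+1 = cheb_angle R n k + pi / n%:R.
Proof. by rewrite /cheb_angle !natrD !natrM -natr1; field; rewrite gt_eqF. Qed.

(** Neighbouring node angles are at most two steps 2 / N apart, since pi <= 4. *)
Let pin : pi / n%:R <= 2%:R * (2 / N%:R) :> R.
Proof.
rewrite mulrA ler_pdivrMr// mulrAC ler_pdivlMr//.
by rewrite ler_pM ?pi_ge0// ?ler_nat//; have := pi_le4 R; lra.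
Qed.

Let G_step t k : `|(G t - G (cheb_angle R n k.+1)) - (G t - G (cheb_angle R n k))| <= 2%:R * om.
Proof.
have -> : (G t - G (cheb_angle R n k.+1)) - (G t - G (cheb_angle R n k)) =
  G (cheb_angle R n k) - G (cheb_angle R n k.+1) by ring.
apply: G_modulus; rewrite distrC angleS addrAC subrr add0r ger0_norm//.
by rewrite divr_ge0// pi_ge0.
Qed.

Lemma lagrange_error x : x \in `[0, 1] ->
  `|h x - \sum_(0 <= j < n) lagrange_coef N h j * x ^+ j| <= (2 + 2 / pi * ln N%:R) * om.
Proof.
rewrite in_itv/= => /andP[x0 x1].
have C0 : 0 <= 2 + 2 / pi * ln N%:R :> R.
  by rewrite addr_ge0// mulr_ge0 ?divr_ge0 ?pi_ge0 ?ln_ge0// ler1n.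
(* The shift by 2 pi leaves room for n nodes with natural indices below t. *)
pose t := acos (2 * x - 1) + pi *+ 2.
have xI : -1 <= 2 * x - 1 <= 1 by apply/andP; split; lra.
have ct : cos t = 2 * x - 1 by rewrite /t cosD2pi acosK.
have xE : x = 1 / 2 + 1 / 2 * cos t by rewrite ct; field.
(* At a node the error is 0; elsewhere the cotangent formula applies. *)
have [/existsP[k /eqP ck]|/existsPn tn] := boolP [exists k : 'I_n, cos t == cos (cheb_angle
  R n k)].
  have -> : x = cheb_node R n k by rewrite cheb_nodeE -ck.
  by rewrite -lagrange_error_node// subrr normr0 mulr_ge0.
have {}tn k : (k < n)%N -> cos t != cos (cheb_angle R n k) by move=> kn;
  exact: (tn (Ordinal kn)).
have cnt : cos (n%:R * t) != 0.
  rewrite -horner_cheb_poly// cheb_poly_prod// hornerZ mulf_neq0 ?expf_neq0//.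
  rewrite horner_prod; apply/prodf_neq0 => k _; rewrite hornerXsubC subr_eq0 cheb_nodeE.
  apply: contra (tn _ (ltn_ord k)) => /eqP /addrI /mulfI H; apply/eqP/H.
  by rewrite mulf_neq0.
have p0 := pi_gt0 R.
have t2 : 2 * pi <= t by rewrite mulr_natl /t lerDr acos_ge0.
(* u locates t on the scale where node k sits at k, since the angle of node k is (k + 1/2) pi /
   n. *)
pose u := n%:R * t / pi - 1 / 2.
have un : 2 * n%:R - 1 / 2 <= u.
  by rewrite /u lerD2r ler_pdivlMr// -mulrA mulrCA ler_pM2l.
have u0 : 0 <= u.
  have : 1 <= n%:R :> R by rewrite ler1n.
  by move: un; lra.
have [q /andP[qu uq]] : exists q : nat, u < q%:R <= u + 1.
  by exists (Num.truncn u).+1; rewrite truncnS_gt -natr1 lerD2r truncn_le u0.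
pose s : R := q%:R - u.
have nq : (n <= q)%N.
  rewrite -ltnS -(ltr_nat R) -[q.+1%:R]natr1.
  have : 1 <= n%:R :> R by rewrite ler1n.
  by move: un qu; lra.
have qs : cheb_angle R n q - t = s * pi / n%:R.
  have n0 : n%:R != 0 :> R by rewrite gt_eqF.
  have pi0 : pi != 0 :> R by rewrite gt_eqF.
  rewrite /s /u /cheb_angle natrD !natrM; move: (n%:R : R) (pi : R) n0 pi0 => m p m0 p1.
  by field; rewrite m0 p1.
have s0 : 0 < s by rewrite /s subr_gt0.
(* s = 1 would place t on the angle of index q - 1, where cos (n t) vanishes. *)
have s1 : s < 1.
  have : s <= 1 by rewrite /s; lra.
  rewrite le_eqVlt => /predU1P[sE|//]; move: cnt.
  by rewrite (cos_nt qs) sE mulr1 sinpi mulr0 eqxx.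
have Gright z : s * pi / n%:R <= z -> `|t - cheb_angle R n (q + 0)| <= z.
  by rewrite addn0 distrC qs ger0_norm// divr_ge0// mulr_ge0// ltW.
have Gleft (z : R) : (1 - s) * pi / n%:R <= z -> `|t - cheb_angle R n (q - 1 - 0)| <= z.
  have -> : t - cheb_angle R n (q - 1 - 0) = (1 - s) * pi / n%:R.
    have -> : t = cheb_angle R n q - s * pi / n%:R by rewrite -qs; ring.
    have -> : cheb_angle R n q = cheb_angle R n (q - 1 - 0) + pi / n%:R.
      by rewrite -angleS subn0 subn1 prednK// (leq_trans _ nq).
    by ring.
  by rewrite ger0_norm// divr_ge0// mulr_ge0 ?subr_ge0// ltW.
have scale (z : R) : 0 <= z <= 1 -> z * pi / n%:R <= 2%:R * (2 / N%:R).
  move=> /andP[z0 z1]; rewrite (le_trans _ pin)// -mulrA ler_piMl//.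
  by rewrite divr_ge0// ltW.
rewrite xE; have := lagrange_cot_sum h tn; rewrite (sum_F_shift h qs nq) (cos_nt qs) /= => ->.
rewrite !normrM normr_sign [1 * `|sin _|]mul1r [1 * `|_ + _|]mul1r normfV normr_nat.
rewrite (@ger0_norm _ (sin _)); last first.
  by apply: sin_ge0_pi; apply/andP; split; nra.
apply: lagrange_sum_bound => //.
- by rewrite s0.
- by move=> i; rewrite addnS; exact: G_step.
(* Once i >= q - 1, the truncated index stays at 0 and the difference vanishes. *)
- move=> i; rewrite subnS; case: (q - 1 - i)%N => [|m] /=;
    first by rewrite subrr normr0 mulr_ge0.
  by rewrite distrC; exact: G_step.
- by apply: (G_modulus (k := 2)); apply: Gright; apply: scale; rewrite !ltW.
- by apply: (G_modulus (k := 2)); apply: Gleft; apply: scale; apply/andP; split; lra.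
- by move=> H; rewrite -[om]mul1r; apply: (G_modulus (k := 1)); rewrite mul1r; exact: Gright.
- by move=> H; rewrite -[om]mul1r; apply: (G_modulus (k := 1)); rewrite mul1r; exact: Gleft.
Qed.

End lagrange_bound.

Lemma continuous_itv_bounded (R : realType) (f : R -> R) : {within `[0, 1], continuous f} ->
  exists M, forall l, l \in `[0, 1] -> `|f l| <= M.
Proof.
move=> cf; have [c1 _ f1] := EVT_max ler01 cf; have [c2 _ f2] := EVT_min ler01 cf.
exists (Num.max (f c1) (- f c2)) => l l01.
by rewrite ler_norml lerNl !le_max lerN2 f1 // f2// orbT.
Qed.

Lemma lipschitz_itv_bounded (R : realType) (f : R -> R) : [lipschitz f x | x in `[0, 1]] ->
  exists M, forall l, l \in `[0, 1] -> `|f l| <= M.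
Proof.
move=> /pinfty_ex_gt0[k k0 fk]; exists (k + `|f 0|) => l l01.
have I0 : (0 : R) \in `[0, 1] by rewrite in_itv/= lexx ler01.
have := fk (l, 0) (conj l01 I0); rewrite /= subr0 => flk.
rewrite -[f l](subrK (f 0)) (le_trans (ler_normD _ _))// lerD2r (le_trans flk)//.
move: l01; rewrite in_itv/= => /andP[l0 l1].
by rewrite ger0_norm// ler_piMr// ltW.
Qed.

Theorem corollary1 (R : realType) :
  (forall m : nat, m \in [:: 0; 1]%N ->
    exists E : R, 0 < E /\
    forall (n : nat) (J : R -> R) (K : n.-tuple (measurableTypeR R) -> R)
           (N : nat),
      n \in [:: 1; 2; 3]%N -> (0 < N)%N ->
      (lebesgue R n).-integrable setT (EFin \o K) ->
      {ae lebesgue R n, forall x, K x = J (enorm x)} ->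
      kernel_assumption n J ->
      let h := profile n J in
      let KN := kernel_sum n N
        (fun j => bernstein_coef N h j.-1 / kcoef n j.-1) in
      C_in m `[0, 1] h ->
      (Lnorm (lebesgue R n) 1 (fun x => (K x - KN x)%:E) <=
       (2 * E * pi `^ (n%:R / 2) / Gamma (n%:R / 2) * N%:R `^ (- (m%:R / 2)) *
        modulus (iter m (derive_in `[0, 1]) h) (N%:R `^ (- (1 / 2))))%:E)%E)
  /\
  (forall (n : nat) (J : R -> R) (K : n.-tuple (measurableTypeR R) -> R)
          (N : nat),
      n \in [:: 1; 2; 3]%N -> (0 < N)%N ->
      (lebesgue R n).-integrable setT (EFin \o K) ->
      {ae lebesgue R n, forall x, K x = J (enorm x)} ->
      kernel_assumption n J ->
      let h := profile n J in
      let KN := kernel_sum n N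
        (fun j => lagrange_coef N h j.-1 / kcoef n j.-1) in
      [lipschitz h x | x in `[0, 1]] ->
      (Lnorm (lebesgue R n) 1 (fun x => (K x - KN x)%:E) <=
       (2 * pi `^ (n%:R / 2) / Gamma (n%:R / 2) * (2 + 2 / pi * ln N%:R) *
        modulus h (N%:R^-1))%:E)%E).
Proof.
have itv01 (l : R) : 0 < l <= 1 -> l \in `[0, 1].
  by rewrite in_itv/= => /andP[/ltW -> ->].
split; last first.
  move=> n J K N n123 N0 iK KJ HJ h KN lip.
  have [M hM] := lipschitz_itv_bounded lip.
  rewrite -mulrA; apply: (kernel_sum_error n123 iK KJ HJ) => l /itv01 l01.
  exact: lagrange_error hM _ l01.
move=> m m01; exists 2; split => // n J K N n123 N0 iK KJ HJ h KN hm.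
pose d : R := N%:R `^ (- (1 / 2)).
have NR : 0 < N%:R :> R by rewrite ltr0n.
have d0 : 0 < d by rewrite powR_gt0.
have d2 : N%:R * d ^+ 2 = 1.
  by rewrite /d -powR_mulrn ?powR_ge0// -powRrM mulNr divfK// powRN powRr1 ?ltW// divff//
    gt_eqF.
rewrite -/d; set w := modulus _ d.
have -> : 2 * 2 * pi `^ (n%:R / 2) / Gamma (n%:R / 2) * N%:R `^ (- (m%:R / 2)) * w =
    2 * pi `^ (n%:R / 2) / Gamma (n%:R / 2) * (2 * N%:R `^ (- (m%:R / 2)) * w) by ring.
apply: (kernel_sum_error n123 iK KJ HJ) => l /itv01 l01; rewrite bernstein_coefE.
move: m01 hm; rewrite !inE => /orP[/eqP mE|/eqP mE]; rewrite /w mE /=.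
- rewrite mul0r oppr0 powRr0 mulr1 => hc.
  have [M hM] := continuous_itv_bounded hc.
  apply: (bernstein_error0 N0 l01 d0 d2) => l1 l2 l1I l2I l12.
  exact: modulus_ub hM l1I l2I l12.
- move=> [dh hc]; have [M hM] := continuous_itv_bounded hc.
  apply: (bernstein_error1 N0 l01 d0 d2) => // l1 l2 l1I l2I l12.
  exact: modulus_ub hM l1I l2I l12.
Qed.
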